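(* Let $(F,\mathcal{H},\gamma)$ be a Gaussian Fréchet space. Then for any Borel probability measure $\nu$ on $F$, $$\inf_{\pi\in\Pi(\nu,\gamma)}\int_{F\times F} d_{\mathcal{H}}(x,y)^2\,d\pi(x,y)\;\le\; 2\,H(\nu\,|\,\gamma).$$
   Context: A Gaussian Fréchet space is a triple $(F,\mathcal{H},\gamma)$ where $F$ is a separable Fréchet space (a locally convex topological vector space which is separable and completely metrizable), $\gamma$ is a Gaussian measure on the Borel $\sigma$-field of $F$ (every continuous linear functional has a Gaussian, possibly degenerate, law under $\gamma$), and $\mathcal{H}\subseteq F$ is the Cameron–Martin space of $\gamma$, a separable Hilbert space with norm $|\cdot|_{\mathcal{H}}$; explicitly $\mathcal{H}=\{h\in F: |h|_{\mathcal{H}}<\infty\}$, $|h|_{\mathcal{H}}=\sup\{l(h): l\in F^*,\ \mathrm{Var}_\gamma(l)\le 1\}$. The Cameron–Martin metric is $d_{\mathcal{H}}(x,y)=|x-y|_{\mathcal{H}}$ if $x-y\in\mathcal{H}$ and $d_{\mathcal{H}}(x,y)=+\infty$ otherwise. $\Pi(\nu,\gamma)$ is the set of probability measures on the product space with marginals $\nu$ and $\gamma$. The relative entropy is $H(\nu\,|\,\gamma)=\int\log\left(\frac{d\nu}{d\gamma}\right)d\nu$ if $\nu\ll\gamma$ and $+\infty$ otherwise. *)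

(* Defs.v *)
From HB Require Import structures.
From mathcomp Require Import all_boot all_order all_algebra.
From mathcomp Require Import all_classical all_reals all_analysis.

Set Implicit Arguments.
Unset Strict Implicit.
Unset Printing Implicit Defensive.

Import Order.TTheory GRing.Theory Num.Theory.
Import numFieldNormedType.Exports.

Local Open Scope classical_set_scope.
Local Open Scope ring_scope.

Definition separable (T : topologicalType) : Prop :=
  exists2 D : set T, countable D & dense D.

Definition is_metric (R : realType) (T : Type) (dist : T -> T -> R) : Prop :=
  [/\ forall x y, 0 <= dist x y,
      forall x y, dist x y = 0 <-> x = y,
      forall x y, dist x y = dist y x &
      forall x y z, dist x z <= dist x y + dist y z].

Definition metric_induces_topology (R : realType) (T : topologicalType)
    (dist : T -> T -> R) : Prop :=
  forall (x : T) (A : set T),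
    nbhs x A <-> exists2 e : R, 0 < e & [set y | dist x y < e] `<=` A.

Definition metric_complete (R : realType) (T : topologicalType)
    (dist : T -> T -> R) : Prop :=
  forall u : nat -> T,
    (forall e : R, 0 < e ->
      exists N : nat, forall m n : nat, (N <= m)%N -> (N <= n)%N ->
        dist (u m) (u n) < e) ->
    exists x : T, u @ \oo --> x.

Definition completely_metrizable (R : realType) (T : topologicalType) : Prop :=
  exists dist : T -> T -> R,
    [/\ is_metric dist, metric_induces_topology dist & metric_complete dist].

(* Local convexity is part of [tvsType]. The uniformity carried by a [tvsType]
   is not required to be translation invariant, so completeness is expressed
   with a metric inducing the topology and not with that uniformity. *)
Definition separable_frechet (R : realType) (F : tvsType R) : Prop :=
  separable F /\ completely_metrizable R F.

(* A [tvsType] carries no [pointedType] structure, which measurable types need;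
   it is pointed at 0 through this alias. *)
Definition pointed_tvs (R : realType) (F : tvsType R) : Type := F.

HB.instance Definition _ (R : realType) (F : tvsType R) :=
  Choice.on (pointed_tvs F).
HB.instance Definition _ (R : realType) (F : tvsType R) :=
  isPointed.Build (pointed_tvs F) (0 : F).

Notation borel F :=
  (g_sigma_algebraType (@open F : set (set (pointed_tvs F)))).

Definition continuous_dual (R : realType) (F : tvsType R) :
  set {linear F -> R^o} := [set l | continuous l].
Arguments continuous_dual {R} F.

(* [normal_prob m 0] is by convention the uniform law on [0, 1], hence the
   separate treatment of the degenerate case. *)
Definition is_gaussian_law (R : realType) (mu : set R -> \bar R) : Prop :=
  exists m s : R, 0 <= s /\
    forall A : set R, measurable A ->
      mu A = if s == 0 then \d_m A else normal_prob m s A.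

Definition gaussian_measure (R : realType) (F : tvsType R)
    (gamma : probability (borel F) R) : Prop :=
  forall l, continuous_dual F l ->
    is_gaussian_law (pushforward gamma (l : borel F -> R)).

Definition gaussian_frechet_space (R : realType) (F : tvsType R)
    (gamma : probability (borel F) R) : Prop :=
  separable_frechet F /\ gaussian_measure gamma.

Section cameron_martin.
Local Open Scope ereal_scope.
Context (R : realType) (F : tvsType R) (gamma : probability (borel F) R).

Definition cm_norm (h : F) : \bar R :=
  ereal_sup [set (l h : R)%:E | l in
    [set l | continuous_dual F l /\ 'V_gamma[(l : borel F -> R)] <= 1]].

Definition cameron_martin : set F := [set h | cm_norm h < +oo].

Definition cm_dist (x y : F) : \bar R :=
  if (x - y)%R \in cameron_martin then cm_norm (x - y)%R else +oo.

End cameron_martin.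

Section transport_entropy.
Local Open Scope ereal_scope.
Context d (T : measurableType d) (R : realType).
Implicit Types nu mu : probability T R.

(* The couplings live on the product sigma-algebra; for a second countable space
   this is the Borel sigma-algebra of the product topology. *)
Definition couplings nu mu : set (probability (T * T)%type R) :=
  [set pi | (forall A, measurable A -> pushforward pi fst A = nu A) /\
            (forall A, measurable A -> pushforward pi snd A = mu A)].

(* [lne] is -oo on nonpositive numbers, which the density takes only on a
   [nu]-null set; its negative part is always [nu]-integrable, so the integral
   is never of the form oo - oo. *)
Definition relative_entropy nu mu : \bar R :=
  if `[< nu `<< mu >] then
    \int[nu]_x lne (Radon_Nikodym (charge_of_finite_measure nu) mu x)
  else +oo.

End transport_entropy.

Definition cm_transport_cost (R : realType) (F : tvsType R)
    (nu gamma : probability (borel F) R) : \bar R :=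
  ereal_inf [set (\int[pi]_z (cm_dist gamma z.1 z.2) ^+ 2)%E
            | pi in couplings nu gamma].

(* Main.v *)
(* Gram-Schmidt applied to a countable family of continuous functionals that
   separates points and computes the Cameron-Martin norm gives coordinates X_k
   which under gamma are independent, each N(0, 1) or degenerate (independence is
   read off the cosine transforms). Let S_k be the conditional monotone
   rearrangement of X_k given X_0, ..., X_(k-1), from its law under nu to N(0, 1);
   then S has under nu the law of X under gamma. In dimension one, if rho is the
   density of the source and phi that of N(0, 1), integrating
   ln (phi (S) / rho) <= phi (S) / rho - 1 against rho, where
   int phi (S z) dz = int x S x rho dx by the identity int_s^oo w phi w dw = phi s,
   gives Talagrand's inequality. Applied fiberwise, with the chain rule for
   entropy, it yields int sum_k (X_k - S_k)^2 dnu <= 2 H(nu | gamma). As gamma is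
   carried by a countable union of compact sets, x |-> (X_k x)_k has a measurable
   inverse there, so S lifts to a map y with y_* nu = gamma, and
   d_H (x, y x)^2 <= sum_k (X_k x - S_k x)^2. *)
Require Import Defs.
From HB Require Import structures.
From mathcomp Require Import all_boot all_order all_algebra.
From mathcomp Require Import all_classical all_reals all_analysis.
From mathcomp Require Import measurable_realfun.
From mathcomp Require Import ring lra.

Set Implicit Arguments.
Unset Strict Implicit.
Unset Printing Implicit Defensive.

Import Order.TTheory GRing.Theory Num.Theory.
Import numFieldNormedType.Exports.

Local Open Scope classical_set_scope.
Local Open Scope ring_scope.

(** The classical one-dimensional argument differentiates the transport map, but here the source
    density is only measurable. If T is the inverse of S, then phi (S) / rho stands for the
    derivative of T at S, and the identity for the integral of phi (S) is Gaussian integration by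
    parts for T, obtained by Fubini with no derivative. Each step conditions on the original past
    X_0, ..., X_(k-1), not on the transported one. The free phase a in cos (t x + a) carries both
    the real and the imaginary part of a characteristic function while everything stays real.
    Degenerate coordinates cannot be discarded: a functional of variance 0 may be needed to separate
    points. They are constant almost everywhere for gamma, hence for nu, and cost nothing. The
    measurability of d_H is never established: its square is bounded by a measurable series before
    the cost is computed. *)

Lemma measurable_cosT d (T : measurableType d) (R : realType) (f : T -> R) :
  measurable_fun [set: T] f -> measurable_fun [set: T] (fun x => cos (f x)).
Proof.
move=> mf; apply: (@measurableT_comp _ _ _ _ _ _ (@cos R)) => //.
by apply: continuous_measurable_fun => x; exact: continuous_cos.
Qed.

(** For nonnegative values the inverse is the real power of exponent -1, which is measurable; the
    value 0 at 0 is the same on both sides. *)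
Lemma measurable_funV_ge0 d (T : measurableType d) (R : realType) (f : T -> R) :
  (forall x, 0 <= f x) -> measurable_fun [set: T] f ->
  measurable_fun [set: T] (fun x => (f x)^-1).
Proof.
move=> f0 mf; rewrite (_ : (fun x => _) = fun x => f x `^ (- 1)).
  exact: (measurableT_comp (measurable_powR _)).
by apply/funext => x; rewrite powR_inv1.
Qed.

(** * Integrals against normal laws *)

Section whole_line.
Context {R : realType}.
Local Notation mu := (@lebesgue_measure R).

Lemma cvg_integral_itvNnn (f : R -> R) : mu.-integrable [set: R] (EFin \o f) ->
  (\int[mu]_(x in `[(- n%:R)%R, n%:R%R]) (f x)%:E)%E @[n --> \oo] -->
  (\int[mu]_x (f x)%:E)%E.
Proof.
move=> fi.
have mf : measurable_fun [set: R] (EFin \o f) by exact: measurable_int fi.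
under eq_fun do rewrite integral_mkcond.
have := @dominated_convergence _ _ R mu setT measurableT
   (fun n => (EFin \o f) \_ `[(- n%:R)%R, n%:R%R]) (EFin \o f) (fun x => `|f x|%:E).
case => //.
- by move=> n; apply/(measurable_restrictT (EFin \o f)) => //;
    exact: measurable_funTS.
- apply: aeW => x _; apply: cvg_near_cst.
  exists (Num.truncn `|x|).+1 => //= n /= nx; rewrite patchE ifT// inE/= in_itv/=.
  rewrite -ler_norml (le_trans (ltW (truncnS_gt _)))// ler_nat//.
- exact: integrable_abse fi.
- apply: aeW => x n _ /=; rewrite patchE; case: ifP => //= _; last first.
    by rewrite normr0 lee_fin.
Qed.

(* The FTC on [-n, n] followed by dominated convergence. *)
Lemma integral_derivative_eq0 (F f : R -> R) (C : R) :
  (forall x, is_derive (x : R) (1 : R) F (f x)) -> continuous f ->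
  mu.-integrable [set: R] (EFin \o f) ->
  (forall x, `|F x| * (1 + `|x|) <= C) ->
  (\int[mu]_x (f x)%:E)%E = 0%E.
Proof.
move=> dF cf fi FC.
have FD x : derivable F x 1 by have [] := dF x.
have cF : continuous F by move=> x; exact/differentiable_continuous/derivable1_diffP.
have h1 := cvg_integral_itvNnn fi.
rewrite -cvg_shiftS in h1.
have h2 n : (\int[mu]_(x in `[(- n.+1%:R)%R, n.+1%:R%R]) (f x)%:E)%E =
     ((F n.+1%:R - F (- n.+1%:R))%:E)%E.
  rewrite (@continuous_FTC2 _ f F) ?EFinB//.
  - by rewrite gtrN// ltr0n.
  - exact: continuous_subspaceT.
  - split => //; first exact: (cvg_at_right_filter (cF _)).
    exact: (cvg_at_left_filter (cF _)).
  - by move=> x _; rewrite derive1E; have [_ ->] := dF x.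
move: h1; under eq_fun do rewrite h2.
move=> h1.
have C0 : 0 <= C by rewrite (le_trans _ (FC 0))// mulr_ge0// addr_ge0.
have h3 : (F n.+1%:R - F (- n.+1%:R)) @[n --> \oo] --> (0 : R).
  have h4 : (2 * C * n.+1%:R^-1) @[n --> \oo] --> (0 : R).
    rewrite -[X in _ --> X](mulr0 (2 * C)).
    by apply: cvgM; [exact: cvg_cst|exact: cvg_harmonic].
  apply: norm_cvg0; apply: squeeze_cvgr h4; last first.
    exact: cvg_cst.
  near=> n; rewrite normr_ge0/=.
  rewrite ler_pdivlMr ?ltr0n//.
  have Fn (x : R) : `|x| = n.+1%:R -> `|F x| * n.+1%:R <= C.
    move=> xn; rewrite (le_trans _ (FC x))// ler_wpM2l// xn lerDr//.
  have := Fn n.+1%:R; have := Fn (- n.+1%:R).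
  rewrite normrN ger0_norm// => /(_ erefl) A /(_ erefl) B.
  rewrite (le_trans (ler_wpM2r _ (ler_normB _ _)))// mulrDl; lra.
have h5 : (F n.+1%:R - F (- n.+1%:R))%:E @[n --> \oo] --> 0%:E.
  by apply: cvg_EFin => //; exact: nearW.
exact: (cvg_unique _ h1 h5).
Unshelve. all: by end_near. Qed.

End whole_line.

(** * Integration against a measure with a density *)

Section density.
Context d (T : measurableType d) {R : realType}.
Variables (m : {sigma_finite_measure set T -> \bar R}).
Variables (m' : {finite_measure set T -> \bar R}) (g : T -> R).
Hypothesis mg : measurable_fun [set: T] g.
Hypothesis g0 : forall x, 0 <= g x.
Hypothesis m'E : forall A, measurable A -> m' A = (\int[m]_(x in A) (g x)%:E)%E.

(** The change of variables holds for the Radon-Nikodym derivative; [g] has the same integrals over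
    measurable sets, so both agree almost everywhere. *)
Lemma ge0_integral_density (f : T -> \bar R) :
  measurable_fun [set: T] f -> (forall x, 0 <= f x)%E ->
  (\int[m']_x f x = \int[m]_x (f x * (g x)%:E))%E.
Proof.
move=> mf f0.
have mg' : measurable_fun [set: T] (EFin \o g) by exact/measurable_EFinP.
have dom : m' `<< m.
  apply/null_content_dominatesP => A mA mA0; rewrite m'E//.
  apply: null_set_integral => //; exact: measurable_funTS.
rewrite -(Radon_Nikodym_SigmaFinite.change_of_variables dom)//.
have mRN : measurable_fun [set: T] (Radon_Nikodym_SigmaFinite.f m' m).
  exact: measurable_int (Radon_Nikodym_SigmaFinite.f_integrable dom).
apply: ge0_ae_eq_integral => //.
- exact: emeasurable_funM.
- exact: emeasurable_funM.
- by move=> x _; rewrite mule_ge0// Radon_Nikodym_SigmaFinite.f_ge0.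
- by move=> x _; rewrite mule_ge0// lee_fin.
apply: ae_eqe_mul2l; apply: integral_ae_eq => //.
- exact: Radon_Nikodym_SigmaFinite.f_integrable.
- by move=> A _ mA; rewrite -Radon_Nikodym_SigmaFinite.f_integral// m'E.
Qed.

Lemma integral_density (f : T -> R) : measurable_fun [set: T] f ->
  (\int[m']_x (f x)%:E = \int[m]_x (f x * g x)%:E)%E.
Proof.
move=> mf; have mf' : measurable_fun [set: T] (EFin \o f) by exact/measurable_EFinP.
rewrite integralE [RHS]integralE; congr (_ - _)%E.
- rewrite ge0_integral_density//; last exact: measurable_funepos.
  apply: eq_integral => x _; rewrite !funeposE -[0%E]/(0%:E) -!EFin_max -EFinM.
  by rewrite maxr_pMl// mul0r.
- rewrite ge0_integral_density//; last exact: measurable_funeneg.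
  apply: eq_integral => x _; rewrite !funenegE -!EFinN -[0%E]/(0%:E) -!EFin_max -EFinM.
  by rewrite maxr_pMl// mul0r mulNr.
Qed.

Lemma integrable_density (f : T -> R) : measurable_fun [set: T] f ->
  m'.-integrable [set: T] (EFin \o f) <->
  m.-integrable [set: T] (fun x => (f x * g x)%:E).
Proof.
move=> mf; have mf' : measurable_fun [set: T] (EFin \o f) by exact/measurable_EFinP.
have h : (\int[m']_x `|(f x)%:E| = \int[m]_x `|(f x * g x)%:E|)%E.
  rewrite ge0_integral_density//; last exact: measurableT_comp.
  by apply: eq_integral => x _; rewrite EFinM abseM (@gee0_abs _ (g x)%:E) ?lee_fin.
split => /integrableP[_ fi]; apply/integrableP; split => //.
- by apply/measurable_EFinP; exact: measurable_funM.
- by rewrite -h.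
- by rewrite h.
Qed.

End density.

(** * Stein's identity, moments and cosine transform of a normal law *)

Section normal_law.
Context {R : realType}.
Variables (m s : R).
Hypothesis s0 : s != 0.
Local Notation mu := (@lebesgue_measure R).
Local Notation p := (normal_pdf m s).

Lemma is_derive_normal_pdf (x : R) :
  is_derive (x : R) (1 : R) p (- (x - m) / s ^+ 2 * p x).
Proof.
rewrite normal_pdfE// /normal_fun.
apply: is_derive_eq => /=.
rewrite /GRing.scale/=.
by field.
Qed.

(** Half of the Gaussian exponent absorbs the square, by [u * exp (- u) <= 1] with
    [u = (x - m)^2 / (4 s^2)]. The other half is a normal density of variance 2 s^2, whose
    normalization accounts for the factor sqrt 2. *)
Lemma normal_pdf_sqr_ub (x : R) :
  (x - m) ^+ 2 * p x <= 4 * s ^+ 2 * Num.sqrt 2 * normal_pdf m (Num.sqrt 2 * s) x.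
Proof.
have s20 : 0 < s ^+ 2 by rewrite exprn_even_gt0.
rewrite !normal_pdfE ?mulf_neq0 ?sqrtr_eq0 -?ltNge//.
rewrite /normal_peak /normal_fun exprMn sqr_sqrtr//.
have -> : (Num.sqrt (2 * s ^+ 2 * pi *+ 2))^-1 = (Num.sqrt 2)^-1 * (Num.sqrt (s ^+ 2 * pi *+ 2))^-1 :> R.
  by rewrite -invfM -sqrtrM//; congr (Num.sqrt _)^-1; ring.
set k := (Num.sqrt (s ^+ 2 * pi *+ 2))^-1.
have k0 : 0 <= k by rewrite invr_ge0.
have -> : 4 * s ^+ 2 * Num.sqrt 2 * ((Num.sqrt 2)^-1 * k * expR (- (x - m) ^+ 2 / (2 * s ^+ 2 *+ 2)))
  = k * (4 * s ^+ 2 * expR (- (x - m) ^+ 2 / (2 * s ^+ 2 *+ 2))).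
  by field; rewrite sqrtr_eq0 -ltNge.
rewrite mulrCA ler_wpM2l//.
set u := (x - m) ^+ 2 / (4 * s ^+ 2).
have -> : - (x - m) ^+ 2 / (s ^+ 2 *+ 2) = - u - u by rewrite /u; field.
have -> : - (x - m) ^+ 2 / (2 * s ^+ 2 *+ 2) = - u by rewrite /u; field.
have -> : (x - m) ^+ 2 = 4 * s ^+ 2 * u by rewrite /u; field.
have u1 : u * expR (- u) <= 1.
  by rewrite expRN ler_pdivrMr ?expR_gt0// mul1r (le_trans _ (expR_ge1Dx _))// lerDr.
have -> : 4 * s ^+ 2 * u * expR (- u - u) =
    4 * s ^+ 2 * (u * expR (- u) * expR (- u)) by rewrite expRD; ring.
apply: ler_wpM2l; first by apply: mulr_ge0 => //; exact: ltW.
by rewrite -[leRHS]mul1r ler_wpM2r ?expR_ge0.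
Qed.

Lemma integrable_normal_pdfM (K : R) (f : R -> R) : measurable_fun [set: R] f ->
  (forall x, `|f x| <= K * (1 + (x - m) ^+ 2)) ->
  mu.-integrable [set: R] (fun x => (f x * p x)%:E).
Proof.
move=> mf f1.
have K0 : 0 <= K.
  by rewrite (le_trans (normr_ge0 (f m)))// (le_trans (f1 m))// subrr expr0n addr0 mulr1.
pose g x := p x + 4 * s ^+ 2 * Num.sqrt 2 * normal_pdf m (Num.sqrt 2 * s) x.
apply: (@le_integrable _ _ _ mu _ measurableT _ (fun x => K%:E * (g x)%:E)%E) => //.
- apply/measurable_EFinP; apply: measurable_funM => //.
  exact: measurable_normal_pdf.
- move=> x _ /=; rewrite lee_fin normrM (ger0_norm (normal_pdf_ge0 _ _ _)).
  rewrite (le_trans (ler_wpM2r (normal_pdf_ge0 _ _ _) (f1 x)))//.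
  rewrite (le_trans _ (ler_norm _))// -mulrA ler_wpM2l// mulrDl mul1r.
  by rewrite lerD2l normal_pdf_sqr_ub.
- apply: integrableZl => //.
  rewrite (_ : (fun x => (g x)%:E) = (EFin \o p) \+
    (fun x => (4 * s ^+ 2 * Num.sqrt 2)%:E * (normal_pdf m (Num.sqrt 2 * s) x)%:E))%E.
    apply: integrableD => //; first exact: integrable_normal_pdf.
    by apply: integrableZl => //; exact: integrable_normal_pdf.
  by apply/funext => x/=.
Qed.

(** The first factor is the growth allowed for [G] in [integral_normal_stein], the last one the
    decay required by [integral_derivative_eq0]. *)
Lemma normal_pdf_decay : exists C : R, forall x, (1 + `|x - m|) * p x * (1 + `|x|) <= C.
Proof.
have [C C0 hC] : exists2 C, 0 <= C & forall x, (x - m) ^+ 2 * p x <= C.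
  exists (4 * s ^+ 2 * Num.sqrt 2 * normal_peak (Num.sqrt 2 * s)).
    apply: mulr_ge0; last exact: normal_peak_ge0.
    apply: mulr_ge0; last exact: sqrtr_ge0.
    by apply: mulr_ge0 => //; exact: sqr_ge0.
  move=> x; rewrite (le_trans (normal_pdf_sqr_ub x))// ler_wpM2l//.
    apply: mulr_ge0; last exact: sqrtr_ge0.
    by apply: mulr_ge0 => //; exact: sqr_ge0.
  by rewrite normal_pdf_ub// mulf_neq0// sqrtr_eq0 -ltNge.
exists ((1 + `|m|) * (2 * (normal_peak s + C))) => x.
have p0 := normal_pdf_ge0 m s x.
have h1 : 1 + `|x| <= (1 + `|m|) * (1 + `|x - m|).
  have : `|x| <= `|x - m| + `|m| by rewrite -[in leLHS](subrK m x) ler_normD.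
  have := mulr_ge0 (normr_ge0 m) (normr_ge0 (x - m)); lra.
rewrite (le_trans (ler_wpM2l _ h1))//.
  by rewrite mulr_ge0// addr_ge0.
rewrite mulrCA ler_wpM2l ?addr_ge0//.
have -> : (1 + `|x - m|) * p x * (1 + `|x - m|) = (1 + `|x - m|) ^+ 2 * p x by ring.
have h2 : (1 + `|x - m|) ^+ 2 <= 2 * (1 + (x - m) ^+ 2).
  rewrite -[(x - m) ^+ 2]real_normK ?num_real//.
  by have := sqr_ge0 (1 - `|x - m|); lra.
rewrite (le_trans (ler_wpM2r p0 h2))// -mulrA ler_wpM2l// mulrDl mul1r lerD//.
exact: normal_pdf_ub.
Qed.

(** The difference of the two integrands is the derivative of [s^2 * G * p], which decays fast
    enough for its integral to vanish. *)
Lemma integral_normal_stein (K : R) (G g : R -> R) :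
  (forall x : R, is_derive (x : R) (1 : R) G (g x)) -> continuous g ->
  (forall x, `|G x| <= K * (1 + `|x - m|)) ->
  (forall x, `|g x| <= K * (1 + (x - m) ^+ 2)) ->
  (\int[mu]_x ((x - m) * G x * p x)%:E = \int[mu]_x (s ^+ 2 * g x * p x)%:E)%E.
Proof.
move=> dG cg Gb gb.
have K0 : 0 <= K.
  by rewrite (le_trans (normr_ge0 (g m)))// (le_trans (gb m))// subrr expr0n addr0 mulr1.
have GD x : derivable G x 1 by have [] := dG x.
have cG : continuous G by move=> x; exact/differentiable_continuous/derivable1_diffP.
have cp : continuous p by exact: continuous_normal_pdf.
have s20 : s ^+ 2 != 0 by rewrite expf_neq0.
have mG : measurable_fun [set: R] G by exact: continuous_measurable_fun.
have mg : measurable_fun [set: R] g by exact: continuous_measurable_fun.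
have cxm : continuous (fun x : R => x - m).
  by move=> x; apply: cvgB; [exact: cvg_id|exact: cvg_cst].
pose F x := s ^+ 2 * G x * p x.
pose f x := s ^+ 2 * g x * p x - (x - m) * G x * p x.
have dF (x : R) : is_derive (x : R) (1 : R) F (f x).
  have := is_derive_normal_pdf x => dp; have := dG x => dGx.
  apply: is_derive_eq; rewrite /f /GRing.scale/=.
  by field.
have cf : continuous f.
  move=> x; apply: cvgB; apply: cvgM; try exact: cp; apply: cvgM.
  - exact: cvg_cst.
  - exact: cg.
  - exact: cxm.
  - exact: cG.
have [C hC] := normal_pdf_decay.
have i1 : mu.-integrable [set: R] (fun x => (s ^+ 2 * g x * p x)%:E).
  under eq_fun do rewrite -mulrA EFinM.
  by apply: integrableZl => //; exact: (@integrable_normal_pdfM K).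
have i2 : mu.-integrable [set: R] (fun x => ((x - m) * G x * p x)%:E).
  (* Half of [(x - m) * G x] satisfies the growth bound with the same [K], because a + a^2 <= 2 (1 +
     a^2). *)
  have -> : (fun x => ((x - m) * G x * p x)%:E) =
     (fun x => (2%:E * ((2^-1 * (x - m) * G x) * p x)%:E))%E.
    by apply/funext => x; rewrite -EFinM; congr _%:E; field.
  apply: integrableZl => //; apply: (@integrable_normal_pdfM K).
    apply: measurable_funM => //; apply: measurable_funM => //.
    exact: continuous_measurable_fun.
  move=> x; rewrite !normrM gtr0_norm ?invr_gt0//.
  rewrite -[(x - m) ^+ 2]real_normK ?num_real//.
  have h1 := ler_wpM2l (normr_ge0 (x - m)) (Gb x).
  have h2 := mulr_ge0 K0 (sqr_ge0 (1 - `|x - m|)).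
  rewrite -mulrA -(@ler_pM2l _ 2)// mulrA divff// mul1r (le_trans h1)//.
  have h3 := mulr_ge0 K0 (addr_ge0 ler01 (normr_ge0 (x - m))).
  rewrite -subr_ge0; apply: le_trans (addr_ge0 h2 h3) _.
  rewrite le_eqVlt; apply/orP; left.
  apply/eqP; ring.
have fi : mu.-integrable [set: R] (EFin \o f).
  rewrite (_ : _ \o _ = (fun x => (s ^+ 2 * g x * p x)%:E) \-
     (fun x => ((x - m) * G x * p x)%:E))%E; first exact: integrableB.
  by apply/funext => x /=; rewrite EFinB.
have h : (\int[mu]_x (f x)%:E = 0)%E.
  apply: (@integral_derivative_eq0 R F f (s ^+ 2 * (K * C))) => // x; rewrite /F normrM normrM (ger0_norm (sqr_ge0 s)) -2!(mulrA (s ^+ 2)) -(mulrA `|G x|).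
  apply: ler_wpM2l; first exact: sqr_ge0.
  apply: le_trans (ler_wpM2l K0 (hC x)).
  rewrite (ger0_norm (normal_pdf_ge0 _ _ _)) mulrA mulrA ler_wpM2r ?addr_ge0//.
  by rewrite mulrA ler_wpM2r ?normal_pdf_ge0.
move: h; rewrite /f; under eq_integral do rewrite EFinB.
rewrite integralB//= => /eqP; rewrite sube_eq ?add0e.
- by move=> /eqP.
- exact: integrable_fin_num.
- by rewrite fin_num_adde_defr.
Qed.

Lemma integral_normal_centered : (\int[mu]_x ((x - m) * p x)%:E = 0)%E.
Proof.
under eq_integral do rewrite -[x in x * p _]mulr1.
rewrite (@integral_normal_stein 1 (cst 1) (cst 0)).
- by under eq_integral do rewrite mulr0 mul0r; rewrite integral0.
- by move=> x; exact: cvg_cst.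
- by move=> x; rewrite normr1 mul1r lerDl.
- by move=> x; rewrite normr0 mul1r addr_ge0// sqr_ge0.
Qed.

Lemma integral_normal_variance : (\int[mu]_x ((x - m) ^+ 2 * p x)%:E = (s ^+ 2)%:E)%E.
Proof.
under eq_integral do rewrite expr2.
have dG (x : R) : is_derive (x : R) (1 : R) (fun x : R => x - m) 1.
  by apply: is_derive_eq; rewrite subr0.
rewrite (@integral_normal_stein 1 (fun x => x - m) (cst 1) dG).
- under eq_integral do rewrite mulr1 EFinM.
  rewrite integralZl//; last exact: integrable_normal_pdf.
  by rewrite integral_normal_pdf mule1.
- by move=> x; exact: cvg_cst.
- by move=> x; rewrite mul1r lerDr.
- by move=> x; rewrite normr1 mul1r lerDl sqr_ge0.
Qed.

(* By Stein's identity the transform phi(t) solves phi' = - t s^2 phi. *)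
Lemma normal_char_fun (t a : R) :
  (\int[mu]_x (cos (t * (x - m) + a) * p x)%:E =
   (cos a * expR (- (t ^+ 2 * s ^+ 2) / 2))%:E)%E.
Proof.
pose f (t : R) (x : R) := cos (t * (x - m) + a) * p x.
have mcos t0 : measurable_fun [set: R] (fun x : R => cos (t0 * (x - m) + a)).
  apply: measurable_cosT; apply: measurable_funD => //; apply: measurable_funM => //.
  exact: measurable_funB.
have ifn t0 : mu.-integrable [set: R] (EFin \o f t0).
  apply: (@integrable_normal_pdfM 1) => // x; rewrite mul1r.
  by rewrite (le_trans (cos_max _))// lerDl sqr_ge0.
pose F (t : R) := (\int[mu]_(x in [set: R]) f t x)%R.
have df (t0 x : R) : is_derive (t0 : R) (1 : R) (f^~ x) (- (x - m) * sin (t0 * (x - m) + a) * p x).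
  apply: is_derive_eq; rewrite /GRing.scale/=.
  by ring.
have dF (t0 : R) : is_derive (t0 : R) (1 : R) F (- t0 * s ^+ 2 * F t0).
  pose K (x : R) := (1 + (x - m) ^+ 2) * p x.
  have iK : mu.-integrable [set: R] (EFin \o K).
    apply: (@integrable_normal_pdfM 1) => [|x].
      apply: measurable_funD => //; apply: measurable_funX.
      exact: measurable_funB.
    by rewrite mul1r ger0_norm// addr_ge0// sqr_ge0.
  have d1 x y : derivable (f^~ y) x 1 by have [] := df x y.
  have d2 x y : partial1of2 f x y = - (y - m) * sin (x * (y - m) + a) * p y.
    by rewrite partial1of2E; have [_ ->] := df x y.
  have Kb x y : `|partial1of2 f x y| <= K y.
    rewrite d2 /K normrM (ger0_norm (normal_pdf_ge0 _ _ _)) ler_wpM2r ?normal_pdf_ge0//.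
    rewrite normrM normrN -[(y - m) ^+ 2]real_normK ?num_real//.
    have := ler_wpM2l (normr_ge0 (y - m)) (sin_max (x * (y - m) + a)).
    by have := sqr_ge0 (1 - `|y - m|); have := normr_ge0 (y - m); nra.
  have It : `](t0 - 1), (t0 + 1)[%classic t0 by rewrite /= in_itv/= ltrBlDr ltrDl ltr01.
  have D1 := @derivable_under_integral R _ _ mu f setT measurableT t0 _ _ It
    (fun x _ => ifn x) (fun x y _ _ => d1 x y) K (fun y => _) iK (fun x y _ _ => Kb x y).
  have D2 := @differentiation_under_integral R _ _ mu f setT measurableT t0 _ _ It
    (fun x _ => ifn x) (fun x y _ _ => d1 x y) K (fun y => _) iK (fun x y _ _ => Kb x y).
  have K0 y : 0 <= K y by rewrite mulr_ge0 ?normal_pdf_ge0 ?addr_ge0 ?sqr_ge0.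
  split; first exact: D1.
  rewrite -derive1E D2//.
  under eq_Rintegral do rewrite d2.
  rewrite /Rintegral.
  have ds (x : R) : is_derive (x : R) (1 : R) (fun x => sin (t0 * (x - m) + a))
     (t0 * cos (t0 * (x - m) + a)).
    by apply: is_derive_eq; rewrite /GRing.scale/=; ring.
  have cs (x : R) : continuous (fun x : R => t0 * cos (t0 * (x - m) + a)).
    move=> y; apply: cvgM; first exact: cvg_cst.
    apply: continuous_comp; last exact: continuous_cos.
    apply: cvgD; last exact: cvg_cst.
    apply: cvgM; first exact: cvg_cst.
    by apply: cvgB; [exact: cvg_id|exact: cvg_cst].
  have st := @integral_normal_stein (1 + `|t0|) _ _ ds (cs 0).
  have isin : mu.-integrable [set: R] (fun x => ((x - m) * sin (t0 * (x - m) + a) * p x)%:E).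
    apply: (@integrable_normal_pdfM 1) => [|x].
      apply: measurable_funM; first exact: measurable_funB.
      apply: continuous_measurable_fun => x.
      by have [/derivable1_diffP/differentiable_continuous] := ds x.
    rewrite mul1r normrM -[(x - m) ^+ 2]real_normK ?num_real//.
    have := ler_wpM2l (normr_ge0 (x - m)) (sin_max (t0 * (x - m) + a)).
    by have := sqr_ge0 (1 - `|x - m|); have := normr_ge0 (x - m); nra.
  have -> : (\int[mu]_x (- (x - m) * sin (t0 * (x - m) + a) * p x)%:E =
    (-1)%:E * \int[mu]_x ((x - m) * sin (t0 * (x - m) + a) * p x)%:E)%E.
    rewrite -integralZl//; apply: eq_integral => x _.
    by rewrite -EFinM mulN1r !mulNr.
  rewrite st; last 2 first.
  - move=> x; rewrite (le_trans (sin_max _))//.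
    by rewrite mulr_ege1// lerDl.
  - move=> x; rewrite normrM (le_trans (ler_wpM2l (normr_ge0 _) (cos_max _)))// mulr1.
    rewrite -[leLHS]mulr1 ler_pM// ?lerDr//.
    by rewrite lerDl sqr_ge0.
  have -> : (\int[mu]_x (s ^+ 2 * (t0 * cos (t0 * (x - m) + a)) * p x)%:E =
    (s ^+ 2 * t0)%:E * \int[mu]_x (f t0 x)%:E)%E.
    rewrite -integralZl//; last exact: ifn.
    by apply: eq_integral => x _; rewrite -EFinM /f !mulrA.
  have fn0 : (\int[mu]_x (f t0 x)%:E)%E \is a fin_num.
    by apply: integrable_fin_num => //; exact: ifn.
  rewrite /F /Rintegral -(fineK fn0) -!EFinM /=; ring.
(* The integrating factor of the equation for [F]: [H] has derivative 0. *)
pose H (t : R) := F t * expR (t ^+ 2 * s ^+ 2 / 2).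
have dH (t0 : R) : is_derive (t0 : R) (1 : R) H 0.
  have := dF t0 => ?; apply: is_derive_eq; rewrite /GRing.scale/=.
  by field.
have F0 : F 0 = cos a.
  rewrite /F /f; under eq_Rintegral do rewrite mul0r add0r.
  rewrite RintegralZl//; last exact: integrable_normal_pdf.
  by rewrite /Rintegral integral_normal_pdf mulr1.
have := @is_derive_0_is_cst _ H t 0 dH.
rewrite {2}/H expr0n/= !mul0r expR0 mulr1 F0 /H => HF.
have -> : (\int[mu]_x (cos (t * (x - m) + a) * p x)%:E)%E = (F t)%:E.
  by rewrite /F /Rintegral fineK//; apply: integrable_fin_num => //; exact: ifn.
congr _%:E; rewrite -HF -(mulrA (F t)) -expRD.
by rewrite mulNr addrN expR0 mulr1.
Qed.

Lemma normal_prob_char_fun (t a : R) :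
  (\int[normal_prob m s]_x (cos (t * (x - m) + a))%:E =
   (cos a * expR (- (t ^+ 2 * s ^+ 2) / 2))%:E)%E.
Proof.
rewrite (@integral_density _ _ _ mu (normal_prob m s) p) ?normal_char_fun//.
- exact: measurable_normal_pdf.
- exact: normal_pdf_ge0.
- apply: measurable_cosT; apply: measurable_funD => //; apply: measurable_funM => //.
  exact: measurable_funB.
Qed.

Lemma integrable_normal_prob (K : R) (f : R -> R) : measurable_fun [set: R] f ->
  (forall x, `|f x| <= K * (1 + (x - m) ^+ 2)) ->
  (normal_prob m s).-integrable [set: R] (EFin \o f).
Proof.
move=> mf fK; apply/(@integrable_density _ _ _ mu (normal_prob m s) p) => //.
- exact: measurable_normal_pdf.
- exact: normal_pdf_ge0.
- exact: integrable_normal_pdfM fK.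
Qed.

Lemma normal_prob_centered : (\int[normal_prob m s]_x (x - m)%:E = 0)%E.
Proof.
rewrite (@integral_density _ _ _ mu (normal_prob m s) p) ?integral_normal_centered//.
- exact: measurable_normal_pdf.
- exact: normal_pdf_ge0.
- exact: measurable_funB.
Qed.

Lemma normal_prob_variance :
  (\int[normal_prob m s]_x ((x - m) ^+ 2)%:E = (s ^+ 2)%:E)%E.
Proof.
rewrite (@integral_density _ _ _ mu (normal_prob m s) p) ?integral_normal_variance//.
- exact: measurable_normal_pdf.
- exact: normal_pdf_ge0.
- by apply: measurable_funX; exact: measurable_funB.
Qed.

End normal_law.

Section normal_tail.
Context {R : realType}.
Local Notation mu := (@lebesgue_measure R).
Local Notation phi := (normal_pdf (0 : R) 1).

Let ic : mu.-integrable [set: R] (fun x => (x * phi x)%:E).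
Proof.
apply: (@integrable_normal_pdfM _ _ _ _ 1) => // x; rewrite subr0 mul1r.
rewrite -[x ^+ 2]real_normK ?num_real//.
by have := sqr_ge0 (1 - `|x|); have := normr_ge0 x; nra.
Qed.

Let dphi (x : R) : is_derive (x : R) (1 : R) (fun x => - phi x) (x * phi x).
Proof.
have := @is_derive_normal_pdf R 0 1 (oner_neq0 _) x => dp.
by apply: is_derive_eq; rewrite expr1n subr0 divr1 mulNr opprK.
Qed.

Let cx : continuous (fun x : R => x * phi x).
Proof.
by move=> x; apply: cvgM; [exact: cvg_id|exact: continuous_normal_pdf].
Qed.

Let cdphi : continuous (fun x => - phi x).
Proof. by move=> x; apply: cvgN; exact: continuous_normal_pdf. Qed.

Lemma cvgy_normal_pdf01 : phi x @[x --> +oo] --> (0 : R).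
Proof.
have [C hC] := @normal_pdf_decay R 0 1 (oner_neq0 _).
have C0 : 0 <= C.
  by rewrite (le_trans _ (hC 0))// !mulr_ge0 ?normal_pdf_ge0// addr_ge0.
apply/cvgrPdist_le => e e0; near=> x.
have x0 : 0 < x by near: x; exact: nbhs_pinfty_gt.
rewrite sub0r normrN ger0_norm ?normal_pdf_ge0//.
have := hC x; rewrite subr0 (gtr0_norm x0) => h.
have h1 : phi x * x <= C.
  rewrite (le_trans _ h)// ler_pM ?normal_pdf_ge0 ?(ltW x0)//; last by rewrite lerDr.
  by rewrite -[leLHS]mul1r ler_wpM2r ?normal_pdf_ge0// lerDl ltW.
have h2 : e^-1 * C <= x by near: x; apply: nbhs_pinfty_ge; exact: num_real.
by rewrite ler_pdivrMl// in h2; rewrite -(ler_pM2r x0) (le_trans h1).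
Unshelve. all: by end_near. Qed.

Lemma integral_normal_tail (s : R) :
  (\int[mu]_(x in `]s, +oo[) (x * phi x)%:E = (phi s)%:E)%E.
Proof.
have mm D : measurable_fun D (fun x : R => (x * phi x)%:E).
  by apply/measurable_funTS; exact: measurable_int ic.
rewrite integral_itv_obnd_cbnd//.
(* The fundamental theorem on a half-line is applied to a nonnegative integrand, hence only from
   [a >= 0]; a negative [s] adds a bounded interval. *)
have pos (a : R) : 0 <= a -> (\int[mu]_(x in `[a, +oo[) (x * phi x)%:E = (phi a)%:E)%E.
  move=> a0; rewrite (@ge0_continuous_FTC2y _ _ (fun x => - phi x) a 0).
  - by rewrite -EFinB sub0r opprK.
  - by move=> x ax; rewrite mulr_ge0 ?normal_pdf_ge0// (le_trans a0).
  - exact: continuous_subspaceT.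
  - by have /cvgN := cvgy_normal_pdf01; rewrite oppr0; apply.
  - by move=> x _; have [] := dphi x.
  - by apply: cvg_at_right_filter; exact: cdphi.
  - by move=> x _; rewrite derive1E; have [_ ->] := dphi x.
have [|s0] := leP 0 s; first exact: pos.
rewrite (@itv_bndbnd_setU _ _ _ (BLeft 0)) ?bnd_simp ?(ltW s0)//.
rewrite integral_setU//; last first.
  apply/disj_setPS => x [] /=; rewrite !in_itv/= andbT => /andP[_ x0].
  by rewrite leNgt x0.
  exact: mm.
rewrite pos// integral_itv_bndo_bndc; last exact: mm.
rewrite (@continuous_FTC2 _ _ (fun x => - phi x))//.
- by rewrite -EFinB -EFinD opprK addrAC addNr add0r.
- exact: continuous_subspaceT.
- split.
  + by move=> x _; have [] := dphi x.
  + by apply: cvg_at_right_filter; exact: cdphi.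
  + by apply: cvg_at_left_filter; exact: cdphi.
- by move=> x _; rewrite derive1E; have [_ ->] := dphi x.
Qed.

End normal_tail.

Lemma ae_eq_measure d (T : measurableType d) (R : realType)
    (mu : {measure set T -> \bar R}) (A B : set T) :
  measurable A -> measurable B -> {ae mu, forall x, A x <-> B x} -> mu A = mu B.
Proof.
move=> mA mB [N [mN N0 AB]].
suff h (C D : set T) : measurable C -> measurable D ->
    (forall x, ~ N x -> C x -> D x) -> (mu C <= mu D)%E.
  apply/eqP; rewrite eq_le !h// => x Nx; apply: contraPP Nx => ABx; apply;
    by apply: AB => /= -[? ?]; apply: ABx.
move=> mC mD CD; rewrite -(measureU0 mD mN N0).
apply: le_measure; rewrite ?inE//; first exact: measurableU.
by move=> x Cx; have [Nx|Nx] := pselect (N x); [right|left; exact: CD].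
Qed.

(** * Monotone rearrangement *)

Section distribution_function.
Context {R : realType}.
Implicit Types P Q : probability (measurableTypeR R) R.

Definition dfun P (x : R) : R := fine (P `]-oo, x]%classic).

Lemma dfunE P x : P `]-oo, x]%classic = (dfun P x)%:E.
Proof. by rewrite fineK// fin_num_measure. Qed.

Lemma dfun_nd P : {homo dfun P : x y / x <= y}.
Proof.
move=> x y xy; rewrite -lee_fin -!dfunE le_measure ?inE//.
exact: subset_itvl.
Qed.

Lemma dfun_itv01 P x : 0 <= dfun P x <= 1.
Proof. by rewrite -!lee_fin -!dfunE measure_ge0 probability_le1. Qed.

Lemma measurable_dfun P : measurable_fun [set: R] (dfun P).
Proof. by apply: nondecreasing_measurable => // x y; exact: dfun_nd. Qed.

(** The law of the identity under [P] is [P], so results on distribution functions of random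
    variables apply to [dfun P]. *)
Let idR : measurableTypeR R -> R := idfun.

#[local] HB.instance Definition _ :=
  @isMeasurableFun.Build _ _ _ _ idR (@measurable_id _ _ setT).

Lemma dfun_right_continuous P : right_continuous (dfun P).
Proof.
move=> x; apply: fine_cvg; rewrite -dfunE.
exact: (@cdf_right_continuous _ _ _ P (idR : {RV P >-> R})).
Qed.

Lemma cvg_dfunNy P : dfun P x @[x --> -oo] --> (0 : R).
Proof. apply: fine_cvg; exact: (@cvg_cdfNy0 _ _ _ P (idR : {RV P >-> R})). Qed.

Lemma cvg_dfuny P : dfun P x @[x --> +oo] --> (1 : R).
Proof. apply: fine_cvg; exact: (@cvg_cdfy1 _ _ _ P (idR : {RV P >-> R})). Qed.

(* [quantile P u] is only meaningful for [0 < u < 1]. *)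
Definition quantile P (u : R) : R :=
  if 0 < u < 1 then sup [set s | dfun P s < u] else 0.

Let has_sup_quantile P u : 0 < u < 1 -> has_sup [set s | dfun P s < u].
Proof.
move=> /andP[u0 u1]; split.
  have [/= M [_ hM]] : \forall x \near -oo, dfun P x < u.
    by apply: (cvgr_lt 0) => //; exact: cvg_dfunNy.
  by exists (M - 1); apply: hM; rewrite ltrBlDr ltrDl.
have [/= M [_ hM]] : \forall x \near +oo, u < dfun P x.
  by apply: (cvgr_gt 1) => //; exact: cvg_dfuny.
exists M => x /= xu; rewrite leNgt; apply/negP => Mx.
by have := lt_trans xu (hM _ Mx); rewrite ltxx.
Qed.

(** The Galois connection between [dfun] and [quantile]. From left to right it is monotonicity;
    conversely, right continuity pushes the strict inequality slightly beyond [s]. *)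
Lemma quantile_gtE P s u : 0 < u < 1 -> (s < quantile P u) = (dfun P s < u).
Proof.
move=> u01; rewrite /quantile u01; apply/idP/idP.
- move=> /sup_gt [|s' /= s'u ss']; first by case: (has_sup_quantile P u01).
  by rewrite (le_lt_trans _ s'u)// dfun_nd// ltW.
- move=> su.
  have [/= e e0 he] : \forall x \near s^'+, dfun P x < u.
    by apply: (cvgr_lt (dfun P s)) => //; exact: dfun_right_continuous.
  have h : dfun P (s + e / 2) < u.
    apply: he => /=; last by rewrite ltrDl divr_gt0.
    rewrite opprD addrA subrr add0r normrN gtr0_norm ?divr_gt0//.
    by rewrite ltr_pdivrMr// ltr_pMr// ltr1n.
  rewrite (@lt_le_trans _ _ (s + e / 2))// ?ltrDl ?divr_gt0//.
  by apply: ub_le_sup h; case: (has_sup_quantile P u01).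
Qed.

Lemma measurable_quantile P : measurable_fun [set: R] (quantile P).
Proof.
apply: (measurability (@RGenOInfty.G R)) => [|/= _ [_] [s] -> <-].
  exact: RGenOInfty.measurableE.
rewrite setTI.
have -> : quantile P @^-1` `]s, +oo[ = (`]0, 1[ `&` `]dfun P s, +oo[) `|`
    (~` `]0, 1[ `&` (if s < 0 then setT else set0)).
  apply/seteqP; split => u /=; rewrite !in_itv/= !andbT.
  - have [u01|u01] := boolP (0 < u < 1).
      by rewrite quantile_gtE// => ?; left.
    by rewrite /quantile (negbTE u01) => ->; right; split.
  - move=> [[u01]|[/negP u01]]; first by rewrite quantile_gtE.
    by rewrite /quantile (negbTE u01); case: ifP.
apply: measurableU; first exact: measurableI.
apply: measurableI; first by apply: measurableC.
by case: ifP => _; [exact: measurableT|exact: measurable0].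
Qed.

Lemma dfun_ltE P v : 0 < v < 1 ->
  [set x | dfun P x < v] = `]-oo, (quantile P v)[%classic.
Proof. by move=> v01; apply/seteqP; split => x /=; rewrite in_itv/= quantile_gtE. Qed.

Section atomless.
Variable P : probability (measurableTypeR R) R.
Hypothesis P1 : forall x, P [set x] = 0%E.

Lemma prob_itvNyo x : P `]-oo, x[%classic = (dfun P x)%:E.
Proof.
rewrite -dfunE -(@setUitv1 _ _ _ _ true)//= measureU//= ?P1 ?adde0//.
by apply/seteqP; split => y //= [+ yx]; rewrite yx in_itv/= ltxx.
Qed.

(** Without atoms [dfun P] is left continuous as well: its value at the quantile is the limit of its
    values just below, all less than [v]. *)
Lemma dfun_quantile v : 0 < v < 1 -> dfun P (quantile P v) = v.
Proof.
move=> v01; apply/eqP; rewrite eq_le; apply/andP; split; last first.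
  by rewrite leNgt -(quantile_gtE P _ v01) ltxx.
rewrite -lee_fin -prob_itvNyo.
have -> : `]-oo, (quantile P v)[%classic =
    \bigcup_k `]-oo, quantile P v - k.+1%:R^-1]%classic.
  apply/seteqP; split => x /=; rewrite in_itv/=.
    move=> /ltr_add_invr[k hk]; exists k => //=; rewrite in_itv/=.
    by rewrite lerBrDr ltW.
  move=> [k _] /=; rewrite in_itv/= => /le_lt_trans; apply.
  by rewrite ltrBlDr ltrDl invr_gt0 ltr0n.
have h := @nondecreasing_cvg_mu _ _ _ P (fun k => `]-oo, quantile P v - k.+1%:R^-1]%classic).
apply: (cvge_le _ (h _ _ _)) => //.
- apply: nearW => k /=; rewrite dfunE lee_fin ltW// -(quantile_gtE P _ v01).
  by rewrite ltrBlDr ltrDl invr_gt0 ltr0n.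
- exact: bigcup_measurable.
- move=> k l kl; apply/subsetPset; apply: subset_itvl.
  by rewrite bnd_simp lerD2l lerN2 lef_pV2 ?posrE ?ltr0n// ler_nat.
Qed.

Lemma prob_dfun_lt v : 0 < v < 1 -> P [set x | dfun P x < v] = v%:E.
Proof. by move=> v01; rewrite dfun_ltE// prob_itvNyo dfun_quantile. Qed.

Lemma measurable_dfun_le v : measurable [set x | dfun P x <= v].
Proof.
rewrite -[X in measurable X]setTI.
rewrite (_ : [set _ | _] = dfun P @^-1` `]-oo, v]); first exact: measurable_dfun.
by apply/seteqP; split => x /=; rewrite in_itv.
Qed.

Lemma measurable_dfun_lt v : measurable [set x | dfun P x < v].
Proof.
rewrite -[X in measurable X]setTI.
rewrite (_ : [set _ | _] = dfun P @^-1` `]-oo, v[); first exact: measurable_dfun.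
by apply/seteqP; split => x /=; rewrite in_itv.
Qed.

(** Squeezed between the strict inequalities at levels [v] and [v + e]. In other words [dfun P] is
    uniformly distributed under an atomless [P]. *)
Lemma prob_dfun_le v : 0 <= v <= 1 -> P [set x | dfun P x <= v] = v%:E.
Proof.
move=> /andP[v0]; rewrite le_eqVlt => /predU1P[->|v1].
  rewrite (_ : [set _ | _] = setT) ?probability_setT//.
  by apply/seteqP; split => x //= _; case/andP: (dfun_itv01 P x).
apply/eqP; rewrite eq_le; apply/andP; split.
  apply/lee_addgt0Pr => e e0.
  have [ve|ve] := leP 1 (v + e).
    by rewrite (le_trans (probability_le1 _ _)) ?lee_fin//; exact: measurable_dfun_le.
  rewrite -EFinD -(@prob_dfun_lt (v + e)); last by rewrite ve andbT ltr_wpDl.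
  apply: le_measure; rewrite ?inE; [exact: measurable_dfun_le|exact: measurable_dfun_lt|].
  by move=> x /= /le_lt_trans; apply; rewrite ltrDl.
move: v0; rewrite (le_eqVlt 0) => /predU1P[<-|v0]; first exact: measure_ge0.
rewrite -(@prob_dfun_lt v) ?v0//.
apply: le_measure; rewrite ?inE; [exact: measurable_dfun_lt|exact: measurable_dfun_le|].
by move=> x /=; exact: ltW.
Qed.

Lemma prob_dfun_gt v : 0 <= v <= 1 -> P [set x | v < dfun P x] = (1 - v)%:E.
Proof.
move=> v01; rewrite (_ : [set _ | _] = ~` [set x | dfun P x <= v]).
  rewrite probability_setC ?prob_dfun_le//; exact: measurable_dfun_le.
by apply/seteqP; split => x /=; rewrite ltNge => /negP.
Qed.

(** Makes the default value of [quantile] outside (0, 1) invisible to [P]. *)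
Lemma ae_dfun01 : {ae P, forall x, 0 < dfun P x < 1}.
Proof.
have h0 : {ae P, forall x, 0 < dfun P x}.
  exists [set x | dfun P x <= 0]; split; first exact: measurable_dfun_le.
    by rewrite prob_dfun_le// lexx ler01.
  by move=> x /= /negP; rewrite -leNgt.
have h1 : {ae P, forall x, dfun P x < 1}.
  exists [set x | 1 <= dfun P x]; split.
  - rewrite (_ : [set _ | _] = ~` [set x | dfun P x < 1]).
      by apply: measurableC; exact: measurable_dfun_lt.
    by apply/seteqP; split => x /=; rewrite leNgt => /negP.
  - have m1 : measurable [set x | 1 <= dfun P x].
      rewrite (_ : [set _ | _] = ~` [set x | dfun P x < 1]).
        by apply: measurableC; exact: measurable_dfun_lt.
      by apply/seteqP; split => x /=; rewrite leNgt => /negP.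
    apply/eqP; rewrite eq_le measure_ge0 andbT; apply/lee_addgt0Pr => e e0.
    rewrite add0e; have [e1|e1] := leP 1 e.
      by rewrite (le_trans (probability_le1 _ _)).
    have -> : e%:E = P [set x | 1 - e < dfun P x].
      rewrite prob_dfun_gt; last by rewrite subr_ge0 (ltW e1) gerBl ltW.
      by congr _%:E; ring.
    apply: le_measure; rewrite ?inE//.
      rewrite (_ : [set _ | _] = ~` [set x | dfun P x <= 1 - e]).
        by apply: measurableC; exact: measurable_dfun_le.
      by apply/seteqP; split => x /=; rewrite ltNge => /negP.
    by move=> x /=; apply: lt_le_trans; rewrite gtrBl.
  - by move=> x /= /negP; rewrite -leNgt.
by have := ae_filter_ringOfSetsType P => FP; apply: filterS2 h0 h1 => x -> ->.
Qed.

(** Half-lines determine the law, and by [quantile_gtE] the preimage of []s, +oo[] is the event that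
    the uniform variable [dfun P] exceeds [dfun Q s]. Only the source has to be atomless. *)
Lemma pushforward_monotone Q (A : set (measurableTypeR R)) : measurable A ->
  P ((quantile Q \o dfun P) @^-1` A) = Q A.
Proof.
have mS : measurable_fun [set: measurableTypeR R]
    (quantile Q \o dfun P : _ -> measurableTypeR R).
  apply: measurableT_comp; [exact: measurable_quantile|exact: measurable_dfun].
have mSA B : measurable B -> measurable ((quantile Q \o dfun P) @^-1` B).
  by move=> mB; rewrite -[X in measurable X]setTI; exact: mS.
pose PS : {measure set (measurableTypeR R) -> \bar R} :=
  measure_function_pushforward__canonical__measure_function_Measure P mS.
move=> mA; apply: (@measure_unique _ R (measurableTypeR R) (@RGenOInfty.G R)
  (fun k => `](- k%:R)%R, +oo[%classic) _ _ _ _ PS Q) => //.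
- exact: RGenOInfty.measurableE.
- move=> _ _ [x ->] [y ->]; exists (Num.max x y); apply/seteqP.
  by split => z /=; rewrite !in_itv/= !andbT gt_max => /andP.
- by move=> k; eexists.
- apply/seteqP; split => // x _; exists (Num.truncn `|x|).+1 => //=.
  rewrite in_itv/= andbT ltrNl (le_lt_trans _ (truncnS_gt _))//.
  by rewrite -normrN ler_norm.
- move=> _ [s ->] /=.
  have -> : Q `]s, +oo[%classic = (1 - dfun Q s)%:E.
    by rewrite -setCitvl probability_setC// dfunE.
  rewrite -prob_dfun_gt; last exact: dfun_itv01.
  rewrite /pushforward; apply: ae_eq_measure.
  + exact: mSA.
  + rewrite (_ : [set _ | _] = ~` [set x | dfun P x <= dfun Q s]).
      by apply: measurableC; exact: measurable_dfun_le.
    by apply/seteqP; split => x /=; rewrite ltNge => /negP.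
  + have FP := ae_filter_ringOfSetsType P.
    apply: filterS ae_dfun01 => x x01.
    by rewrite /= in_itv/= andbT quantile_gtE.
- move=> k; rewrite (le_lt_trans (probability_le1 _ _)) ?ltry//.
  exact: mSA.
Qed.

End atomless.
End distribution_function.

Lemma integral_monotone_rearrangement (R : realType)
    (P Q : probability (measurableTypeR R) R) (f : R -> R) :
  (forall x, P [set x] = 0%E) -> measurable_fun [set: R] f ->
  Q.-integrable [set: R] (EFin \o f) ->
  P.-integrable [set: R] (EFin \o (f \o (quantile Q \o dfun P))) /\
  (\int[P]_x (f ((quantile Q \o dfun P) x))%:E = \int[Q]_x (f x)%:E)%E.
Proof.
move=> P1 mf fi.
have mS : measurable_fun [set: measurableTypeR R]
    (quantile Q \o dfun P : _ -> measurableTypeR R).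
  apply: measurableT_comp; [exact: measurable_quantile|exact: measurable_dfun].
pose PS : {measure set (measurableTypeR R) -> \bar R} :=
  measure_function_pushforward__canonical__measure_function_Measure P mS.
have PSQ A : measurable A -> PS A = Q A by move=> mA; exact: pushforward_monotone.
have mf' : measurable_fun [set: measurableTypeR R] (EFin \o f) by exact/measurable_EFinP.
have h2 : P.-integrable [set: R] (EFin \o (f \o (quantile Q \o dfun P))).
  apply/integrableP; split.
    by apply/measurable_EFinP; apply: measurableT_comp.
  case/integrableP : fi => _; apply: le_lt_trans.
  rewrite -[X in (\int[P]_(x in X) _)%E](preimage_setT (quantile Q \o dfun P)).
  rewrite -(@ge0_integral_pushforward _ _ _ _ _ _ mS P setT (abse \o (EFin \o f)))//; last 2 first.
  - exact: measurableT_comp.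
  - by move=> y _; exact: abse_ge0.
  by rewrite (eq_measure_integral Q)// => A mA _; exact: PSQ.
split => //.
rewrite -[X in (\int[P]_(x in X) _)%E](preimage_setT (quantile Q \o dfun P)).
rewrite -(integral_pushforward mS mf')//.
by apply: eq_measure_integral => A mA _; exact: PSQ.
Qed.


(** * The one-dimensional transport inequality *)

Section signed_interval.
Context {R : realType}.
Local Notation mu := (@lebesgue_measure R).

(** Its integral over z is w, whatever the sign of w. This writes [w * S w] as an integral over
    levels z, to which Fubini applies. *)
Definition signed_itv (w z : R) : R := (z < w)%R%:R - (z < 0)%R%:R.

Lemma signed_itvE (w z : R) : signed_itv w z =
  if 0 <= w then \1_(`[0, w[%classic : set R) z
  else - \1_(`[w, 0[%classic : set R) z.
Proof.
rewrite /signed_itv !indicE !mem_setE !in_itv/=; case: ifPn => w0.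
  have [z0|z0] := leP 0 z; first by rewrite subr0.
  by rewrite (lt_le_trans z0 w0) subrr.
rewrite -ltNge in w0; have [wz|wz] := leP w z; first by rewrite sub0r.
by rewrite (lt_trans wz w0) subrr oppr0.
Qed.

Lemma integral_signed_itv w : (\int[mu]_z (signed_itv w z)%:E = w%:E)%E.
Proof.
under eq_integral do rewrite signed_itvE.
have [w0|w0] := leP 0 w.
  rewrite integral_indic//= setIT lebesgue_measure_itv/= lte_fin.
  move: w0; rewrite le_eqVlt => /predU1P[<-|->]; first by rewrite ltxx.
  by rewrite oppr0 adde0.
under eq_integral do rewrite EFinN.
rewrite integral_ge0N; last by move=> x _; rewrite lee_fin.
rewrite integral_indic//= setIT lebesgue_measure_itv/= lte_fin.
by rewrite w0 add0e -EFinN opprK.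
Qed.

Lemma integral_abs_signed_itv w : (\int[mu]_z `|signed_itv w z|%:E = `|w|%:E)%E.
Proof.
under eq_integral do rewrite signed_itvE.
have [w0|w0] := leP 0 w.
  under eq_integral do rewrite ger0_norm//.
  rewrite integral_indic//= setIT lebesgue_measure_itv/= lte_fin.
  move: w0; rewrite le_eqVlt => /predU1P[<-|w0]; first by rewrite ltxx normr0.
  by rewrite w0 oppr0 adde0 gtr0_norm.
under eq_integral do rewrite normrN ger0_norm//.
rewrite integral_indic//= setIT lebesgue_measure_itv/= lte_fin.
by rewrite w0 add0e ltr0_norm.
Qed.

Lemma measurable_signed_itv :
  measurable_fun [set: R * R] (fun p => signed_itv p.1 p.2).
Proof.
have mb : measurable_fun [set: bool] (fun b : bool => b%:R : R).
  by move=> _ A _; exact: Logic.I.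
apply: measurable_funB.
  by apply: (measurableT_comp mb); exact: measurable_fun_ltr.
by apply: (measurableT_comp mb); exact: measurable_fun_ltr.
Qed.

Lemma measurable_signed_itv2 w : measurable_fun [set: R] (signed_itv w).
Proof.
have -> : signed_itv w = (fun p => signed_itv p.1 p.2) \o (pair w) by [].
by apply: measurableT_comp; [exact: measurable_signed_itv|exact: pair1_measurable].
Qed.

End signed_interval.

Section talagrand1d.
Context {R : realType}.
Local Notation mu := (@lebesgue_measure R).
Local Notation phi := (normal_pdf (0 : R) 1).
Let N : probability (measurableTypeR R) R := normal_prob 0 1.
Variables (nu : probability (measurableTypeR R) R) (c : R -> R).
Hypothesis mc : measurable_fun [set: R] c.
Hypothesis c0 : forall x, 0 <= c x.
Hypothesis nuE : forall A : set (measurableTypeR R), measurable A ->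
  nu A = (\int[N]_(x in A) (c x)%:E)%E.
Local Notation S := (quantile N \o dfun nu).

Let N1 (x : R) : N [set x] = 0%E.
Proof.
have := @normal_prob_dominates R 0 1.
move=> /null_content_dominatesP; apply => //.
exact: lebesgue_measure_set1.
Qed.

Let nu1 (x : R) : nu [set x] = 0%E.
Proof.
rewrite nuE//; apply: null_set_integral => //.
  by apply/measurable_funTS/measurable_EFinP.
exact: N1.
Qed.

Let mphi : measurable_fun [set: R] phi.
Proof. exact: measurable_normal_pdf. Qed.

Let rho x := c x * phi x.

Let rho_ge0 x : 0 <= rho x. Proof. by rewrite mulr_ge0 ?normal_pdf_ge0. Qed.

Let nuE' (A : set (measurableTypeR R)) : measurable A ->
  nu A = (\int[mu]_(x in A) (rho x)%:E)%E.
Proof.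
move=> mA; rewrite nuE// integral_mkcond.
rewrite (@ge0_integral_density _ _ _ mu N phi)//.
- rewrite [RHS]integral_mkcond; apply: eq_integral => x _.
  by rewrite !patchE; case: ifP => // _; rewrite ?EFinM ?mul0e.
- by move=> x; exact: normal_pdf_ge0.
- apply/(measurable_restrictT (EFin \o c)) => //.
  exact/measurable_funTS/measurable_EFinP.
- by move=> x; rewrite patchE; case: ifP => // _; rewrite lee_fin.
Qed.

Let mS : measurable_fun [set: R] S.
Proof. apply: measurableT_comp; [exact: measurable_quantile|exact: measurable_dfun]. Qed.

Let mrho : measurable_fun [set: R] rho. Proof. exact: measurable_funM. Qed.

Let iN (f : R -> R) : measurable_fun [set: R] f -> (forall x, `|f x| <= 1 + x ^+ 2) ->
  N.-integrable [set: R] (EFin \o f).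
Proof.
move=> mf fb; apply: (@integrable_normal_prob _ 0 1 _ 1) => // x.
by rewrite subr0 mul1r.
Qed.

Let S_int : nu.-integrable [set: R] (EFin \o S) /\ (\int[nu]_x (S x)%:E = 0)%E.
Proof.
have [||h1 h2] := @integral_monotone_rearrangement R nu N id nu1.
- exact: measurable_id.
- apply: iN => // x; rewrite -[x ^+ 2]real_normK ?num_real//.
  by have := sqr_ge0 (1 - `|x|); have := normr_ge0 x; nra.
split => //; rewrite h2.
have := @normal_prob_centered R 0 1 (oner_neq0 _).
by under eq_integral do rewrite subr0.
Qed.

Let S2_int : nu.-integrable [set: R] (fun x => (S x ^+ 2)%:E) /\
  (\int[nu]_x (S x ^+ 2)%:E = 1)%E.
Proof.
have [||h1 h2] := @integral_monotone_rearrangement R nu N (fun x => x ^+ 2) nu1.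
- exact: measurable_funX.
- by apply: iN => [|x]; [exact: measurable_funX|rewrite ger0_norm ?sqr_ge0// lerDr].
split => //; rewrite h2.
have := @normal_prob_variance R 0 1 (oner_neq0 _).
by under eq_integral do rewrite subr0; rewrite expr1n.
Qed.

(** Up to a [nu]-null set, [w > z] amounts to [S w > S z]. The integral is thus that of the identity
    against N beyond [S z], given by [integral_normal_tail]. *)
Let S_tail z : 0 < dfun nu z < 1 ->
  (\int[nu]_(w in `]z, +oo[) (S w)%:E = (phi (S z))%:E)%E.
Proof.
move=> z01.
pose s := S z; pose f := (fun x : R => x * \1_(`]s, +oo[%classic : set R) x).
have mf : measurable_fun [set: R] f.
  by apply: measurable_funM => //; exact: measurable_indic.
have [|h1 h2] := @integral_monotone_rearrangement R nu N f nu1 mf.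
  apply: iN => // x; rewrite -[x ^+ 2]real_normK ?num_real// /f normrM.
  have : `|\1_(`]s, +oo[%classic : set R) x| <= 1 :> R.
    by rewrite indicE; case: (_ \in _); rewrite ?normr1 ?normr0.
  by have := sqr_ge0 (1 - `|x|); have := normr_ge0 x; nra.
transitivity (\int[N]_x (f x)%:E)%E; last first.
  rewrite (@integral_density _ _ _ mu N phi)//; last exact: normal_pdf_ge0.
  rewrite -integral_normal_tail [RHS]integral_mkcond; apply: eq_integral => x _.
  rewrite patchE /f indicE; case: ifP => _; first by rewrite mulr1.
  by rewrite mulr0 mul0r.
rewrite -h2 integral_mkcond; apply: ae_eq_integral => //.
- apply/(measurable_restrictT (EFin \o S)) => //.
  exact/measurable_funTS/measurable_EFinP.
- by apply/measurable_EFinP; apply: measurableT_comp.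
(* Points to the right of z on the same plateau of [dfun nu] carry no mass: the sublevel set and
   []-oo, z]] both have measure [dfun nu z]. *)
have h3 : {ae nu, forall w, ~ (z < w /\ dfun nu w <= dfun nu z)}.
  exists (`]z, +oo[ `&` [set w | dfun nu w <= dfun nu z]); split.
  - by apply: measurableI => //; exact: measurable_dfun_le.
  - have : nu ([set w | dfun nu w <= dfun nu z] `\` `]-oo, z]) = 0%E.
      have -> : nu ([set w | dfun nu w <= dfun nu z] `\` `]-oo, z]%classic) =
          (nu [set w | (dfun nu w <= dfun nu z)%R] -
           nu ([set w | (dfun nu w <= dfun nu z)%R] `&` `]-oo, z]%classic))%E.
        apply: measureD => //; first exact: measurable_dfun_le.
        by rewrite (le_lt_trans (probability_le1 _ _)) ?ltry//; exact: measurable_dfun_le.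
      rewrite setIidr; last by move=> w /=; rewrite in_itv/= => wz; exact: dfun_nd.
      have -> : nu [set w | dfun nu w <= dfun nu z] = nu `]-oo, z]%classic.
        rewrite dfunE prob_dfun_le//.
        by case/andP: z01 => *; rewrite !ltW.
      by rewrite subee ?dfunE.
    by rewrite setDE setCitvl setIC.
  - by move=> w /= /contrapT[zw wz]; rewrite in_itv/= zw.
have FP := ae_filter_ringOfSetsType nu.
apply: filterS2 h3 (ae_dfun01 nu1) => w h w01 _ /=.
rewrite patchE /f indicE !mem_setE !in_itv/= !andbT.
rewrite -/s.
have -> : (z < w) = (s < S w).
  rewrite quantile_gtE// /s /= dfun_quantile//; apply/idP/idP => [zw|].
    by rewrite ltNge; apply/negP => wz; apply: h.
  by apply: contraTT; rewrite -!leNgt => /dfun_nd.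
by case: ifP; rewrite ?mulr1 ?mulr0.
Qed.


Let G01 z := 0 < dfun nu z < 1.

(** Where [dfun nu z] is 0 the tail carries all the mass and [S] has mean 0; where it is 1 the tail
    is null. *)
Let S_tail' z : (\int[nu]_(w in `]z, +oo[) (S w)%:E =
  if G01 z then (phi (S z))%:E else 0)%E.
Proof.
case: ifPn => [/S_tail//|]; rewrite /G01 negb_and -!leNgt => /orP[G0|G1].
  have z0 : nu `]-oo, z]%classic = 0%E.
    rewrite dfunE; congr _%:E; apply/eqP; rewrite eq_le G0.
    by case/andP : (dfun_itv01 nu z).
  rewrite -S_int.2 (negligible_integral _ _ S_int.1 z0)//.
  by rewrite setTD setCitvl.
rewrite null_set_integral//; first exact/measurable_funTS/measurable_EFinP.
transitivity (1 - nu `]-oo, z]%classic)%E.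
  by rewrite -probability_setC// setCitvl.
rewrite dfunE (_ : dfun nu z = 1) ?subee//.
by apply/eqP; rewrite eq_le G1 andbT; case/andP : (dfun_itv01 nu z).
Qed.

Let k (p : R * R) := S p.1 * signed_itv p.1 p.2.

Let mk : measurable_fun [set: R * R] k.
Proof.
apply: measurable_funM; last exact: measurable_signed_itv.
by apply: measurableT_comp.
Qed.

Let mln : measurable_fun [set: R] (fun x => ln (c x)).
Proof. by apply: measurableT_comp => //; exact: measurable_ln. Qed.

(** As [c] has mass 1, the terms [- c + 1] integrate to 0 and the entropy remains. They make the
    integrand nonnegative, so that its integral is meaningful even when infinite. *)
Let Psi x := c x * ln (c x) - c x + 1.

Hypothesis Psi_int : N.-integrable [set: R] (EFin \o Psi).

Let ic : N.-integrable [set: R] (EFin \o c) /\ (\int[N]_x (c x)%:E = 1)%E.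
Proof.
have h : (\int[N]_x (c x)%:E = 1)%E by rewrite -nuE// probability_setT.
split => //; apply/integrableP; split; first exact/measurable_EFinP.
under eq_integral do rewrite /= ger0_norm//.
by rewrite h ltry.
Qed.

Let i1 : N.-integrable [set: R] (EFin \o (cst 1)) /\ (\int[N]_x 1%:E = 1)%E.
Proof.
split; first exact: finite_measure_integrable_cst.
by rewrite integral_cst//= mul1e probability_setT.
Qed.

Let iclnc : N.-integrable [set: R] (EFin \o (fun x => ln (c x) * c x)).
Proof.
have h : N.-integrable [set: R] (EFin \o (fun x => Psi x + c x)).
  exact: (integrableD _ Psi_int ic.1).
rewrite (_ : _ \o _ = (EFin \o (fun x => Psi x + c x - 1))).
  exact: (integrableB _ h i1.1).
by apply/funext => x /=; congr _%:E; rewrite /Psi; ring.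
Qed.

Let lnc_int : nu.-integrable [set: R] (EFin \o (fun x => ln (c x))).
Proof. exact/(@integrable_density _ _ _ N nu c). Qed.

Let integral_lnc : (\int[nu]_x (ln (c x))%:E = \int[N]_x (Psi x)%:E)%E.
Proof.
rewrite (@integral_density _ _ _ N nu c)//.
transitivity (\int[N]_x (Psi x + c x - 1)%:E)%E.
  by apply: eq_integral => x _; congr _%:E; rewrite /Psi; ring.
under eq_integral do rewrite EFinB EFinD.
rewrite integralB//; last 2 first.
- exact: (integrableD _ Psi_int ic.1).
- exact: i1.1.
rewrite integralD//; last exact: ic.1.
by rewrite ic.2 i1.2 addeK.
Qed.

(* Young's inequality between [u ln u] and [exp]. *)
Let young (x : R) : x ^+ 2 * c x <= 4 * (`|ln (c x) * c x| + expR (x ^+ 2 / 4)).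
Proof.
have [c0'|cx0] := eqVneq (c x) 0.
  by rewrite c0' !mulr0 mulr_ge0// addr_ge0// expR_ge0.
have cx : 0 < c x by rewrite lt_neqAle eq_sym cx0 c0.
have := expR_ge1Dx (x ^+ 2 / 4 - ln (c x)).
rewrite expRD expRN lnK ?posrE// ler_pdivlMr// => h.
have : ln (c x) * c x <= `|ln (c x) * c x| by exact: ler_norm.
lra.
Qed.

(** The weight turns the density of N(0, 1) into that of N(0, 2) up to the factor sqrt 2. The 4 here
    and in [young] could be any constant above 2. *)
Let iexp : N.-integrable [set: R] (EFin \o (fun x => expR (x ^+ 2 / 4))).
Proof.
have me : measurable_fun [set: R] (fun x : R => expR (x ^+ 2 / 4)).
  apply: measurableT_comp; first exact: measurable_expR.
  by apply: measurable_funM => //; exact: measurable_funX.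
apply/(@integrable_density _ _ _ mu N phi) => //.
  exact: normal_pdf_ge0.
rewrite (_ : (fun x => _) = (fun x => (Num.sqrt 2)%:E * (normal_pdf 0 (Num.sqrt 2) x)%:E)%E).
  by apply: integrableZl => //; exact: integrable_normal_pdf.
apply/funext => x; rewrite -EFinM; congr _%:E.
rewrite !normal_pdfE ?sqrtr_eq0 -?ltNge// /normal_peak /normal_fun.
rewrite subr0 expr1n mul1r sqr_sqrtr//.
have -> : Num.sqrt (2 * pi *+ 2) = Num.sqrt 2 * Num.sqrt (pi *+ 2) :> R.
  by rewrite -sqrtrM//; congr Num.sqrt; ring.
set r2 := Num.sqrt 2; rewrite invfM -(mulrA r2^-1) (mulrA r2) divff ?mul1r; last first.
  by rewrite sqrtr_eq0 -ltNge.
rewrite mulrCA -expRD; congr (_ * expR _).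
by field.
Qed.

(** Finite entropy relative to N forces a finite second moment, by [young] and [iexp]. Without it
    the quadratic cost could not be expanded. *)
Let x2_int : nu.-integrable [set: R] (fun x => (x ^+ 2)%:E).
Proof.
have mx2 : measurable_fun [set: R] (fun x : R => x ^+ 2) by exact: measurable_funX.
suff h : N.-integrable [set: R] (fun x => (x ^+ 2 * c x)%:E).
  exact: ((@integrable_density _ _ _ N nu c mc c0 nuE (fun x => x ^+ 2) mx2).2 h).
apply: (@le_integrable _ _ _ N _ measurableT _ (fun x => 4%:E *
  (`|ln (c x) * c x| + expR (x ^+ 2 / 4))%:E)%E) => //.
- by apply/measurable_EFinP; apply: measurable_funM.
- move=> x _; rewrite -EFinM/= lee_fin ger0_norm; last by rewrite mulr_ge0 ?sqr_ge0.
  by rewrite (le_trans (young x))// ler_norm.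
- apply: integrableZl => //.
  exact: (integrableD _ (integrable_abse iclnc) iexp).
Qed.

Let xS_int : nu.-integrable [set: R] (fun x => (x * S x)%:E).
Proof.
have abP (a b : R) : 0 <= a -> 0 <= b -> a * b <= a ^+ 2 + b ^+ 2 by nra.
apply: (@le_integrable _ _ _ nu _ measurableT _ (fun x => (x ^+ 2 + S x ^+ 2)%:E)) => //.
- by apply/measurable_EFinP; apply: measurable_funM.
- move=> x _ /=; rewrite lee_fin normrM [leRHS]ger0_norm ?addr_ge0 ?sqr_ge0//.
  rewrite -[x ^+ 2]real_normK ?num_real// -[quantile _ _ ^+ 2]real_normK ?num_real//.
  exact: abP.
- exact: (integrableD _ x2_int S2_int.1).
Qed.

(* The inner integral over [w] is [phi (S z)] by the Gaussian tail identity,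
   the one over [z] is [w * S w]. *)
Let integral_phi_rearrangement :
  (\int[mu]_z (if G01 z then (phi (S z))%:E else 0) = \int[nu]_x (x * S x)%:E)%E.
Proof.
have ik : (nu \x mu)%E.-integrable [set: R * R] (EFin \o k).
  apply/integrable12ltyP; first exact/measurable_EFinP.
  under eq_integral => w _.
    under eq_integral do rewrite /k/= normrM EFinM.
    rewrite ge0_integralZl//; last first.
      apply/measurable_EFinP; apply: measurableT_comp => //.
      exact: measurable_signed_itv2.
    rewrite integral_abs_signed_itv -EFinM -normrM mulrC.
    over.
  by have /integrableP[] := xS_int.
have := Fubini ik.
rewrite (_ : (\int[nu]_x _ = \int[nu]_x (x * S x)%:E)%E); last first.
  apply: eq_integral => w _.
  under eq_integral do rewrite /k/= EFinM.
  rewrite integralZl ?integral_signed_itv ?EFinM 1?muleC//.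
  apply/integrableP; split.
    by apply/measurable_EFinP; exact: measurable_signed_itv2.
  by rewrite integral_abs_signed_itv ltry.
move=> ->; apply: eq_integral => z _; rewrite -S_tail'.
transitivity (\int[nu]_w ((S w)%:E * (\1_(`]z, +oo[%classic : set R) w)%:E - (S w)%:E * (z < 0)%R%:R%:E))%E.
  rewrite integralB//; last 2 first.
  - apply: (@le_integrable _ _ _ nu _ measurableT _ (EFin \o S)) => //.
    + by apply/measurable_EFinP; apply: measurable_funM => //; exact: measurable_indic.
    + move=> w _ /=; rewrite lee_fin normrM indicE; case: (_ \in _).
        by rewrite normr1 mulr1.
      by rewrite normr0 mulr0.
    + exact: S_int.1.
  - by apply: integrableZr => //; exact: S_int.1.
  rewrite integralZr ?S_int.2 ?mul0e ?sube0//; last exact: S_int.1.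
  rewrite [LHS]integral_mkcond; apply: eq_integral => w _ /=.
  by rewrite patchE indicE; case: ifP => _; rewrite ?mule1 ?mule0.
apply: eq_integral => w _; rewrite /k /signed_itv/= mulrBr EFinB !EFinM.
by rewrite indicE mem_setE in_itv/= andbT.
Qed.


(** [ae_dfun01] holds for [nu], whereas the comparison of densities is integrated for Lebesgue
    measure. On the exceptional set the integral of [rho] is 0, so [rho] vanishes there almost
    everywhere. *)
Let ae_rho : {ae mu, forall x, rho x = 0 \/ G01 x}.
Proof.
have [A [mA A0 AG]] := ae_dfun01 nu1.
have h : {ae mu, forall x, A x -> (rho x)%:E = 0%E}.
  apply/ae_eq_integral_abs => //; first exact/measurable_funTS/measurable_EFinP.
  rewrite -[RHS]A0 nuE'//; apply: eq_integral => x _.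
  by rewrite gee0_abs// lee_fin.
have FP := ae_filter_ringOfSetsType mu.
apply: filterS h => x h.
have [xA|xA] := pselect (A x); [left; by case: (h xA)|right].
by apply: contrapT => xG; apply: xA; apply: AG.
Qed.

(** Pointwise this is [1 + t <= exp t] for [t = x^2 / 2 - S^2 / 2 - ln c], since
    [phi (S x) = exp t * rho x] where [rho] is positive. *)
Let rearr_le : (\int[nu]_x (x ^+ 2 / 2 - S x ^+ 2 / 2 - ln (c x) + 1)%:E <=
  \int[nu]_x (x * S x)%:E)%E.
Proof.
rewrite -integral_phi_rearrangement.
rewrite (@integral_density _ _ _ mu nu rho)//; last first.
  apply: measurable_funD => //; apply: measurable_funB => //.
  by apply: measurable_funB; apply: measurable_funM => //; exact: measurable_funX.
set J := (X in (_ <= \int[mu]_x X x)%E).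
have mJ : measurable_fun [set: R] J.
  apply: measurable_fun_ifT => //.
    apply: measurable_and; apply: measurable_fun_ltr => //; exact: measurable_dfun.
  by apply/measurable_EFinP; apply: measurableT_comp.
have J0 x : (0 <= J x)%E by rewrite /J; case: ifP => // _; rewrite lee_fin normal_pdf_ge0.
set U := fun x : R => ((x ^+ 2 / 2 - S x ^+ 2 / 2 - ln (c x) + 1) * rho x)%:E.
have mU : measurable_fun [set: R] U.
  apply/measurable_EFinP; apply: measurable_funM => //.
  apply: measurable_funD => //; apply: measurable_funB => //.
  by apply: measurable_funB; apply: measurable_funM => //; exact: measurable_funX.
rewrite -/(\int[mu]_x U x)%E.
(* Dropping the negative part leaves two nonnegative functions to compare, with no integrability to
   check. *)
rewrite integralE; apply: (@le_trans _ _ (\int[mu]_x U^\+ x)%E).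
  by rewrite geeDl// oppe_le0 integral_ge0.
apply: ae_ge0_le_integral => //; first exact: measurable_funepos.
  by move=> x _; exact: J0.
have FP := ae_filter_ringOfSetsType mu.
apply: filterS ae_rho => x h _.
rewrite funeposE ge_max J0 andbT /U /J.
have [->|rx0] := eqVneq (rho x) 0; first by rewrite mulr0; exact: J0.
case: h => [/eqP|x01]; first by rewrite (negbTE rx0).
rewrite x01 lee_fin.
have cx0 : 0 < c x by rewrite lt_neqAle c0 andbT eq_sym; apply: contra_neq rx0; rewrite /rho => ->; rewrite mul0r.
have e : phi (S x) = expR (x ^+ 2 / 2 - S x ^+ 2 / 2 - ln (c x)) * rho x.
  rewrite expRD expRN lnK ?posrE// /rho mulrA divfK ?gt_eqF//.
  rewrite !normal_pdfE// /normal_fun mulrCA -expRD; congr (_ * expR _).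
  by rewrite !subr0 expr1n; field.
rewrite e ler_wpM2r// addrC expR_ge1Dx//.
Qed.

(** Expand the square and bound the cross term by [rearr_le]: the second moments of x cancel, and
    the second moment 1 of [S] cancels the constants. *)
Lemma rearrangement_cost_aux : (\int[nu]_x ((x - S x) ^+ 2)%:E <=
  2%:E * \int[N]_x (Psi x)%:E)%E.
Proof.
rewrite -integral_lnc.
have ix : nu.-integrable [set: R] (EFin \o (fun x => 2^-1 * x ^+ 2)).
  by apply: (integrableZl _ _ x2_int).
have iS : nu.-integrable [set: R] (EFin \o (fun x => 2^-1 * S x ^+ 2)).
  by apply: (integrableZl _ _ S2_int.1).
have i5 : nu.-integrable [set: R] (EFin \o (fun x => 2^-1 * x ^+ 2 - 2^-1 * S x ^+ 2)).
  exact: (integrableB _ ix iS).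
have i2 : nu.-integrable [set: R]
    (EFin \o (fun x => 2^-1 * x ^+ 2 - 2^-1 * S x ^+ 2 - ln (c x))).
  exact: (integrableB _ i5 lnc_int).
have i0 : nu.-integrable [set: R] (EFin \o (cst 1)).
  exact: finite_measure_integrable_cst.
have := rearr_le.
under eq_integral do rewrite [_ / _]mulrC [S _ ^+ 2 / _]mulrC.
have mT : measurable [set: measurableTypeR R] by exact: measurableT.
have fK (f : R -> R) : nu.-integrable [set: R] (EFin \o f) ->
    (\int[nu]_x (f x)%:E)%E = (\int[nu]_x f x)%:E.
  by move=> fi; rewrite fineK//; exact: integrable_fin_num.
rewrite (fK (fun x => 2^-1 * x ^+ 2 - 2^-1 * S x ^+ 2 - ln (c x) + 1)); last first.
  exact: (integrableD _ i2 i0).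
rewrite RintegralD// RintegralB// RintegralB//.
rewrite (RintegralZl _ mT x2_int) (RintegralZl _ mT S2_int.1).
have -> : (\int[nu]_x 1)%R = 1 by rewrite Rintegral_cst//= probability_setT mulr1.
rewrite (fK _ xS_int) lee_fin.
rewrite (fK _ lnc_int).
have -> : (\int[nu]_x (S x ^+ 2))%R = 1 by rewrite /Rintegral S2_int.2.
move=> h.
have i3 : nu.-integrable [set: R] (EFin \o (fun x => 2 * (x * S x))).
  by apply: (integrableZl _ _ xS_int).
have i4 : nu.-integrable [set: R] (EFin \o (fun x => x ^+ 2 + S x ^+ 2)).
  exact: (integrableD _ x2_int S2_int.1).
rewrite (_ : (\int[nu]_x _ = \int[nu]_x (x ^+ 2 + S x ^+ 2 - 2 * (x * S x))%:E)%E); last first.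
  by apply: eq_integral => x _; congr _%:E; ring.
rewrite (fK (fun x => x ^+ 2 + S x ^+ 2 - 2 * (x * S x))); last exact: (integrableB _ i4 i3).
rewrite RintegralB// RintegralD//; last exact: S2_int.1.
rewrite (RintegralZl _ mT xS_int).
have -> : (\int[nu]_x (S x ^+ 2))%R = 1 by rewrite /Rintegral S2_int.2.
by rewrite -EFinM lee_fin; move: h; set a := Rintegral _ _ _; set b := Rintegral _ _ _; set e := Rintegral _ _ _; lra.
Qed.

End talagrand1d.

Lemma entropy_ge0 (R : realType) (c : R) : 0 <= c -> 0 <= c * ln c - c + 1.
Proof.
rewrite le_eqVlt => /predU1P[<-|c0]; first by rewrite mul0r oppr0 !add0r.
have := expR_ge1Dx (- ln c); rewrite expRN lnK ?posrE// => h.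
by have := ler_wpM2l (ltW c0) h; rewrite divff ?gt_eqF//; lra.
Qed.

Theorem rearrangement_cost (R : realType) (nu : probability (measurableTypeR R) R)
    (c : R -> R) :
  measurable_fun [set: R] c -> (forall x, 0 <= c x) ->
  (forall A : set (measurableTypeR R), measurable A ->
    nu A = \int[normal_prob 0 1]_(x in A) (c x)%:E)%E ->
  (\int[nu]_x ((x - quantile (normal_prob 0 1) (dfun nu x)) ^+ 2)%:E <=
   2%:E * \int[normal_prob 0 1]_x (c x * ln (c x) - c x + 1)%:E)%E.
Proof.
move=> mc c0 nuE.
set I := (\int[normal_prob 0 1]_x _)%E.
have I0 : (0 <= I)%E by apply: integral_ge0 => x _; rewrite lee_fin entropy_ge0.
have [Ioo|Ioo] := ltP I +oo%E; last first.
  by move: Ioo; rewrite leye_eq => /eqP ->; rewrite gt0_muley ?lte_fin// leey.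
apply: rearrangement_cost_aux => //.
apply/integrableP; split.
  apply/measurable_EFinP; apply: measurable_funD => //; apply: measurable_funB => //.
  by apply: measurable_funM => //; apply: measurableT_comp => //; exact: measurable_ln.
by under eq_integral do rewrite /= ger0_norm ?entropy_ge0//.
Qed.

(** * Transport of one coordinate given the past *)

Section density_prob.
Context d (T : measurableType d) {R : realType}.
Variables (m : {measure set T -> \bar R}) (g : T -> R).
Hypothesis mg : measurable_fun [set: T] g.
Hypothesis g0 : forall x, 0 <= g x.
Hypothesis g1 : (\int[m]_x (g x)%:E = 1)%E.

(* The hypotheses are kept as arguments so that the instances below can use them. *)
Definition density_prob (_ : measurable_fun [set: T] g) (_ : forall x, 0 <= g x)
  (_ : (\int[m]_x (g x)%:E = 1)%E) (A : set T) := (\int[m]_(x in A) (g x)%:E)%E.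

Local Notation nu := (density_prob mg g0 g1).

Let nu0 : nu set0 = 0%E. Proof. by rewrite /density_prob integral_set0. Qed.

Let nu_ge0 A : (0 <= nu A)%E.
Proof. by apply: integral_ge0 => x _; rewrite lee_fin. Qed.

Let nu_sigma_additive : semi_sigma_additive nu.
Proof.
move=> A mA tA mUA; rewrite /density_prob.
rewrite ge0_integral_bigcup//.
- by apply: is_cvg_ereal_nneg_natsum_cond => n _ _; exact: nu_ge0.
- exact/measurable_funTS/measurable_EFinP.
- by move=> x _; rewrite lee_fin.
Qed.

HB.instance Definition _ := isMeasure.Build _ _ _ nu nu0 nu_ge0 nu_sigma_additive.

Let nu1 : nu setT = 1%E. Proof. by []. Qed.

HB.instance Definition _ := @Measure_isProbability.Build _ _ R nu nu1.

End density_prob.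

Section one_step.
Context d (P : measurableType d) {R : realType}.
Let N : probability (measurableTypeR R) R := normal_prob 0 1.
Variables (mu : probability P R) (h : P * measurableTypeR R -> R).
Hypothesis mh : measurable_fun [set: P * measurableTypeR R] h.
Hypothesis h0 : forall q, 0 <= h q.
Hypothesis h_fin : (\int[(mu \x N)%E]_q (h q)%:E < +oo)%E.

Let M p : \bar R := (\int[N]_z (h (p, z))%:E)%E.

Definition marginal (p : P) : R := fine (M p).

(** An explicit formula in [h], jointly measurable in the past and the coordinate. Where [marginal]
    is 0 the quotient is 0 by convention; such fibers are negligible for the law of density [h]. *)
Definition conditional_dfun (q : P * R) : R :=
  fine (\int[N]_(w in `]-oo, q.2]) (h (q.1, w))%:E)%E / marginal q.1.

Definition conditional_rearrangement (q : P * R) : R :=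
  quantile N (conditional_dfun q).

Let M0 p : (0 <= M p)%E.
Proof. by apply: integral_ge0 => z _; rewrite lee_fin. Qed.

Lemma marginal_ge0 p : 0 <= marginal p.
Proof. exact: fine_ge0. Qed.

Let mM : measurable_fun [set: P] M.
Proof.
apply: (measurable_fun_fubini_tonelli_F (fun q : P * measurableTypeR R => (h q)%:E)) => //.
exact/measurable_EFinP.
Qed.

Lemma measurable_marginal : measurable_fun [set: P] marginal.
Proof. exact: (measurableT_comp (@fine_measurable R setT measurableT) mM). Qed.

Lemma measurable_conditional_rearrangement :
  measurable_fun [set: P * R] conditional_rearrangement.
Proof.
apply: measurableT_comp; first exact: measurable_quantile.
apply: measurable_funM; last first.
  apply: measurable_funV_ge0 => [q|]; first exact: marginal_ge0.
  by apply: (measurableT_comp measurable_marginal).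
apply: (measurableT_comp (@fine_measurable R setT measurableT)).
(* The moving half-line of integration becomes an indicator inside a jointly measurable integrand,
   as Tonelli requires. *)
pose k (q : (P * R) * measurableTypeR R) : \bar R :=
  (h (q.1.1, q.2) * (q.2 <= q.1.2)%R%:R)%:E.
have mb : measurable_fun [set: bool] (fun b : bool => b%:R : R).
  by move=> _ A _; exact: Logic.I.
have mk : measurable_fun setT k.
  apply/measurable_EFinP; apply: measurable_funM.
    apply: measurableT_comp => //; apply: measurable_fun_pair => //.
    by apply: measurableT_comp.
  apply: (measurableT_comp mb); apply: measurable_fun_ler => //.
  by apply: measurableT_comp.
have := @measurable_fun_fubini_tonelli_F _ _ _ _ R N k mk.
move=> /(_ _)/=.
rewrite (_ : fubini_F N k =
  fun q => \int[N]_(w in `]-oo, q.2]) (h (q.1, w))%:E)%E.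
  by apply => q; rewrite lee_fin mulr_ge0.
apply/funext => q; rewrite /fubini_F [RHS]integral_mkcond.
apply: eq_integral => w _; rewrite patchE /k mem_setE in_itv/=.
by case: (w <= q.2); rewrite ?mulr1 ?mulr0.
Qed.

Let mhp p : measurable_fun [set: measurableTypeR R] (fun z => h (p, z)).
Proof. by apply: measurableT_comp => //; exact: pair1_measurable. Qed.

Section fiber.
Variable p : P.
Hypothesis Mp0 : (0 < M p)%E.
Hypothesis Mpy : (M p < +oo)%E.

Let m0 : 0 < marginal p. Proof. by rewrite fine_gt0// Mp0. Qed.

Let ME : M p = (marginal p)%:E.
Proof. by rewrite fineK// ge0_fin_numE. Qed.

Let c z := h (p, z) / marginal p.

Let mc : measurable_fun [set: measurableTypeR R] c.
Proof. by apply: measurable_funM. Qed.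

Let c0 z : 0 <= c z. Proof. by rewrite divr_ge0// marginal_ge0. Qed.

Let cE (A : set (measurableTypeR R)) : measurable A ->
  (\int[N]_(z in A) (c z)%:E = \int[N]_(z in A) (h (p, z))%:E * (marginal p)^-1%:E)%E.
Proof.
move=> mA; rewrite -ge0_integralZr//.
- exact/measurable_funTS/measurable_EFinP.
- by move=> z _; rewrite lee_fin.
- by rewrite lee_fin invr_ge0 ltW.
Qed.

Let c1 : (\int[N]_z (c z)%:E = 1)%E.
Proof.
rewrite cE//.
by rewrite -/(M p) ME -EFinM divff// gt_eqF.
Qed.

Let nu : probability (measurableTypeR R) R := density_prob mc c0 c1.

Let nuE (A : set (measurableTypeR R)) : measurable A ->
  nu A = (\int[N]_(z in A) (c z)%:E)%E.
Proof. by []. Qed.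

Let dfunE z : dfun nu z = conditional_dfun (p, z).
Proof.
rewrite /dfun nuE// cE// fineM//=.
apply: integrable_fin_num => //.
apply/integrableP; split; first exact/measurable_funTS/measurable_EFinP.
rewrite (le_lt_trans _ Mpy)//.
under eq_integral do rewrite gee0_abs ?lee_fin//.
apply: ge0_subset_integral => //.
  exact/measurable_EFinP.
by move=> x _; rewrite lee_fin.
Qed.

Let RE z : conditional_rearrangement (p, z) = quantile N (dfun nu z).
Proof. by rewrite /conditional_rearrangement dfunE. Qed.

Let mR : measurable_fun [set: R] (fun z => conditional_rearrangement (p, z)).
Proof.
by apply: measurableT_comp; [exact: measurable_conditional_rearrangement|exact: pair1_measurable].
Qed.

Let N1 (x : R) : N [set x] = 0%E.
Proof.
have := @normal_prob_dominates R 0 1.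
move=> /null_content_dominatesP; apply => //.
exact: lebesgue_measure_set1.
Qed.

Let hE z : h (p, z) = marginal p * c z.
Proof. by rewrite /c mulrCA divff ?mulr1// gt_eqF. Qed.

(** Normalizing [h] on a fiber of finite positive mass gives a probability with a density relative
    to N, hence without atoms, and [pushforward_monotone] applies to it. *)
Lemma fiber_law (B : set (measurableTypeR R)) : measurable B ->
  (\int[N]_(z in [set z | B (conditional_rearrangement (p, z))]) (h (p, z))%:E =
   M p * N B)%E.
Proof.
move=> mB.
have mB' : measurable [set z | B (conditional_rearrangement (p, z))].
  by rewrite -[X in measurable X]setTI; exact: mR.
under eq_integral do rewrite hE EFinM.
rewrite ge0_integralZl//; last 3 first.
- exact/measurable_funTS/measurable_EFinP.
- by move=> z _; rewrite lee_fin.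
- by rewrite lee_fin marginal_ge0.
rewrite ME; congr (_ * _)%E.
rewrite -(@pushforward_monotone _ nu _ N B mB).
  rewrite -nuE//; congr (nu _).
  by apply/seteqP; split => z /=; rewrite RE.
move=> x; rewrite nuE//; apply: null_set_integral => //.
  by apply/measurable_funTS/measurable_EFinP.
exact: N1.
Qed.

(** [rearrangement_cost] for the conditional density [h / marginal], multiplied by the mass of the
    fiber. Keeping the mass makes both sides integrable over the past by Tonelli. *)
Lemma fiber_cost :
  (\int[N]_z (h (p, z) * (z - conditional_rearrangement (p, z)) ^+ 2)%:E <=
   2%:E * \int[N]_z (h (p, z) * ln (h (p, z) / marginal p) - h (p, z) + marginal p)%:E)%E.
Proof.
have := @rearrangement_cost R nu c mc c0 nuE.
rewrite (@ge0_integral_density _ _ _ N nu c)//; last 2 first.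
- apply/measurable_EFinP; apply: measurable_funX; apply: measurable_funB => //.
  by apply: measurableT_comp; [exact: measurable_quantile|exact: measurable_dfun].
- by move=> z; rewrite lee_fin sqr_ge0.
move=> /(lee_wpmul2l (ltW Mp0)); rewrite ME.
rewrite -ge0_integralZl//; last 3 first.
- apply: emeasurable_funM; last exact/measurable_EFinP.
  apply/measurable_EFinP; apply: measurable_funX; apply: measurable_funB => //.
  by apply: measurableT_comp; [exact: measurable_quantile|exact: measurable_dfun].
- by move=> z _; rewrite mule_ge0// lee_fin ?sqr_ge0.
- by rewrite lee_fin marginal_ge0.
rewrite muleCA -ge0_integralZl//; last 3 first.
- apply/measurable_EFinP; apply: measurable_funD => //; apply: measurable_funB => //.
  by apply: measurable_funM => //; apply: measurableT_comp => //; exact: measurable_ln.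
- by move=> z _; rewrite lee_fin entropy_ge0.
- by rewrite lee_fin marginal_ge0.
have -> : (\int[N]_z (h (p, z) * (z - conditional_rearrangement (p, z)) ^+ 2)%:E =
    \int[N]_z ((marginal p)%:E *
      (((z - quantile (normal_prob 0 1) (dfun nu z)) ^+ 2)%:E * (c z)%:E)))%E.
  by apply: eq_integral => z _; rewrite RE -!EFinM; congr _%:E; rewrite hE; ring.
move=> /le_trans; apply; rewrite le_eqVlt; apply/orP; left; apply/eqP; congr (_ * _)%E.
apply: eq_integral => z _; rewrite -EFinM; congr _%:E.
by rewrite -/(c z) hE; ring.
Qed.

End fiber.

Let ae_fin : {ae mu, forall p, (M p < +oo)%E}.
Proof.
have h1 : mu.-integrable [set: P] M.
  apply/integrableP; split => //.
  under eq_integral do rewrite gee0_abs//.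
  move: h_fin; rewrite fubini_tonelli1//.
  exact/measurable_EFinP.
have := integrable_ae measurableT h1.
have FP := ae_filter_ringOfSetsType mu.
by apply: filterS => p /(_ Logic.I); rewrite ge0_fin_numE.
Qed.

Let zero_fiber p : M p = 0%E -> {ae N, forall z, h (p, z) = 0}.
Proof.
move=> Mp0.
have : {ae N, forall z, [set: R] z -> (h (p, z))%:E = 0%E}.
  apply/ae_eq_integral_abs => //.
    exact/measurable_EFinP.
  by under eq_integral do rewrite gee0_abs ?lee_fin//.
have FP := ae_filter_ringOfSetsType N.
by apply: filterS => z /(_ Logic.I) [].
Qed.


Let mh' : measurable_fun [set: P * measurableTypeR R] (EFin \o h).
Proof. exact/measurable_EFinP. Qed.

Let mR : measurable_fun [set: P * measurableTypeR R] conditional_rearrangement.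
Proof. exact: measurable_conditional_rearrangement. Qed.

Let fubiniE (f : P * measurableTypeR R -> \bar R) (E : set (P * measurableTypeR R)) :
  measurable E -> measurable_fun setT f -> (forall q, 0 <= f q)%E ->
  (\int[(mu \x N)%E]_(q in E) f q =
   \int[mu]_p \int[N]_(z in [set z | E (p, z)]) f (p, z))%E.
Proof.
move=> mE mf f0; rewrite integral_mkcond (fubini_tonelli1 (f \_ E)); last 2 first.
- by apply/(measurable_restrictT f) => //; exact: measurable_funTS.
- by move=> q; rewrite patchE; case: ifP.
apply: eq_integral => p _; rewrite /fubini_F [RHS]integral_mkcond.
apply: eq_integral => z _; rewrite !patchE; congr (if _ then _ else _).
Qed.

Let measurable_fubiniE (f : P * measurableTypeR R -> \bar R) (E : set (P * measurableTypeR R)) :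
  measurable E -> measurable_fun setT f -> (forall q, 0 <= f q)%E ->
  measurable_fun setT (fun p => \int[N]_(z in [set z | E (p, z)]) f (p, z))%E.
Proof.
move=> mE mf f0.
rewrite (_ : (fun p => _) = fubini_F N (f \_ E)).
  apply: (measurable_fun_fubini_tonelli_F (f \_ E)).
  - by apply/(measurable_restrictT f) => //; exact: measurable_funTS.
  - by move=> q; rewrite patchE; case: ifP.
apply/funext => p; rewrite /fubini_F [LHS]integral_mkcond.
apply: eq_integral => z _; rewrite !patchE; congr (if _ then _ else _).
Qed.

Let h0' q : (0 <= (EFin \o h) q)%E. Proof. by rewrite lee_fin. Qed.

(** On each fiber the rearranged coordinate has law N, so it is independent of the past. Fibers of
    mass 0 contribute 0 to both sides, and those of infinite mass are [mu]-negligible by [h_fin]. *)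
Lemma conditional_rearrangement_law (A : set P) (B : set (measurableTypeR R)) :
  measurable A -> measurable B ->
  (\int[(mu \x N)%E]_(q in [set q | A q.1 /\ B (conditional_rearrangement q)]) (h q)%:E =
   \int[(mu \x N)%E]_(q in [set q | A q.1]) (h q)%:E * N B)%E.
Proof.
move=> mA mB.
have mA' : measurable [set q : P * measurableTypeR R | A q.1].
  by rewrite -[X in measurable X]setTI; exact: measurable_fst.
have mB' : measurable [set q : P * measurableTypeR R | B (conditional_rearrangement q)].
  by rewrite -[X in measurable X]setTI; exact: mR.
have mAB := measurableI _ _ mA' mB'.
rewrite (fubiniE mAB mh' h0') (fubiniE mA' mh' h0').
have FE (p : P) : (\int[N]_(z in [set z | [set q | A q.1] (p, z)]) (h (p, z))%:E =
    (M \_ A) p)%E.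
  rewrite patchE; case: ifPn => [/set_mem|/negP] pA.
    by rewrite (_ : [set z | _] = setT)//; apply/seteqP; split.
  rewrite (_ : [set z | _] = set0) ?integral_set0//.
  by apply/seteqP; split => // z /= /mem_set.
under [in RHS]eq_integral do rewrite FE.
have mMA : measurable_fun [set: P] (M \_ A).
  by apply/(measurable_restrictT M) => //; exact: measurable_funTS.
have MA0 p : (0 <= (M \_ A) p)%E by rewrite patchE; case: ifP.
rewrite -ge0_integralZr//.
apply: ge0_ae_eq_integral => //.
- exact: (measurable_fubiniE mAB mh' h0').
- exact: emeasurable_funM.
- by move=> p _; apply: integral_ge0 => z _; rewrite lee_fin.
- by move=> p _; rewrite mule_ge0.
have FP := ae_filter_ringOfSetsType mu.
apply: filterS ae_fin => p pfin _.
rewrite patchE; case: ifPn => [/set_mem|/negP] pA; last first.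
  rewrite mul0e (_ : [set z | _] = set0) ?integral_set0//.
  by apply/seteqP; split => // z /= [/mem_set].
rewrite (_ : [set z | _] = [set z | B (conditional_rearrangement (p, z))]); last first.
  by apply/seteqP; split => z //= [].
have [Mp0|Mp0] := eqVneq (M p) 0%E.
  rewrite Mp0 mul0e.
  apply/eqP; rewrite eq_le integral_ge0 ?andbT; last by move=> z _; rewrite lee_fin.
  rewrite -[leRHS]Mp0; apply: ge0_subset_integral => //.
  - by rewrite -[X in measurable X]setTI; apply: (measurableT_comp mR (pair1_measurable p)).
  - exact/measurable_EFinP.
by apply: (fiber_law (p := p)) => //; rewrite lt0e Mp0 M0.
Qed.

Lemma integral_marginal (A : set P) : measurable A ->
  (\int[(mu \x N)%E]_(q in [set q | A q.1]) (h q)%:E =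
   \int[mu]_(p in A) (marginal p)%:E)%E.
Proof.
move=> mA.
have mA' : measurable [set q : P * measurableTypeR R | A q.1].
  by rewrite -[X in measurable X]setTI; exact: measurable_fst.
rewrite (fubiniE mA' mh' h0') [RHS]integral_mkcond.
have mmA : measurable_fun [set: P] ((EFin \o marginal) \_ A).
  apply/(measurable_restrictT (EFin \o marginal)) => //.
  by apply/measurable_funTS/measurable_EFinP; exact: measurable_marginal.
apply: ge0_ae_eq_integral => //.
- exact: (measurable_fubiniE mA' mh' h0').
- by move=> p _; apply: integral_ge0 => z _; rewrite lee_fin.
- by move=> p _; rewrite patchE; case: ifP => // _; rewrite lee_fin marginal_ge0.
have FP := ae_filter_ringOfSetsType mu.
apply: filterS ae_fin => p pfin _.
rewrite patchE; case: ifPn => [/set_mem|/negP] pA.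
  rewrite (_ : [set z | _] = setT); last by apply/seteqP; split.
  by rewrite /= /marginal fineK// ge0_fin_numE.
rewrite (_ : [set z | _] = set0) ?integral_set0//.
by apply/seteqP; split => // z /= /mem_set.
Qed.

Let entropy q := h q * ln (h q / marginal q.1) - h q + marginal q.1.

Let ent0 p : (M p < +oo)%E -> {ae N, forall z, 0 <= entropy (p, z)}.
Proof.
move=> pfin; have FP := ae_filter_ringOfSetsType N.
have [Mp0|Mp0] := eqVneq (M p) 0%E.
  apply: filterS (zero_fiber Mp0) => z hz.
  by rewrite /entropy /= hz mul0r oppr0 !add0r marginal_ge0.
have m0 : 0 < marginal p by rewrite fine_gt0// pfin lt0e Mp0 M0.
apply: aeW => z; rewrite /entropy/=.
have -> : h (p, z) = marginal p * (h (p, z) / marginal p).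
  by rewrite mulrCA divff ?mulr1// gt_eqF.
set c := h (p, z) / marginal p.
have c0 : 0 <= c by rewrite divr_ge0// ltW.
have := mulr_ge0 (ltW m0) (entropy_ge0 c0).
rewrite [_ * c / _]mulrAC divff ?gt_eqF// mul1r; lra.
Qed.

Let marg_inv : measurable_fun [set: P * measurableTypeR R] (fun q => (marginal q.1)^-1).
Proof.
apply: measurable_funV_ge0 => [q|]; first exact: marginal_ge0.
by apply: (measurableT_comp measurable_marginal).
Qed.

Let ment : measurable_fun [set: P * measurableTypeR R] entropy.
Proof.
apply: measurable_funD; last by apply: (measurableT_comp measurable_marginal).
apply: measurable_funB => //; apply: measurable_funM => //.
apply: measurableT_comp; first exact: measurable_ln.
exact: measurable_funM.
Qed.

Let cost q := h q * (q.2 - conditional_rearrangement q) ^+ 2.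

Let mcost : measurable_fun [set: P * measurableTypeR R] cost.
Proof.
by apply: measurable_funM => //; apply: measurable_funX; apply: measurable_funB.
Qed.

(** The entropy integrand is nonnegative only almost everywhere: on a fiber of infinite mass
    [marginal] is 0 and the integrand is [- h]. The absolute value gives Tonelli a function that is
    nonnegative everywhere. *)
Lemma conditional_rearrangement_cost :
  (\int[(mu \x N)%E]_q (h q * (q.2 - conditional_rearrangement q) ^+ 2)%:E <=
   2%:E * \int[(mu \x N)%E]_q
     `|(h q * ln (h q / marginal q.1) - h q + marginal q.1)%:E|)%E.
Proof.
rewrite (fubini_tonelli1 (EFin \o cost)); last 2 first.
- by apply/measurable_EFinP; exact: mcost.
- by move=> q; rewrite lee_fin mulr_ge0 ?sqr_ge0.
rewrite (fubini_tonelli1 (abse \o (EFin \o entropy))); last 2 first.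
- by apply: measurableT_comp => //; exact/measurable_EFinP.
- by move=> q; exact: abse_ge0.
rewrite -ge0_integralZl//; last 2 first.
- apply: measurable_fun_fubini_tonelli_F.
    by apply: measurableT_comp => //; exact/measurable_EFinP.
  by move=> q; exact: abse_ge0.
- by move=> p _; apply: integral_ge0 => z _; exact: abse_ge0.
apply: ae_ge0_le_integral => //.
- by move=> p _; apply: integral_ge0 => z _; rewrite lee_fin mulr_ge0 ?sqr_ge0.
- apply: measurable_fun_fubini_tonelli_F; first by apply/measurable_EFinP; exact: mcost.
  by move=> q; rewrite lee_fin mulr_ge0 ?sqr_ge0.
- by move=> p _; rewrite mule_ge0//; apply: integral_ge0 => z _; exact: abse_ge0.
- apply: emeasurable_funM => //; apply: measurable_fun_fubini_tonelli_F.
    by apply: measurableT_comp => //; exact/measurable_EFinP.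
  by move=> q; exact: abse_ge0.
have FP := ae_filter_ringOfSetsType mu.
have FN := ae_filter_ringOfSetsType N.
apply: filterS ae_fin => p pfin _; rewrite /fubini_F/=.
have [Mp0|Mp0] := eqVneq (M p) 0%E.
  rewrite [leLHS](_ : _ = 0%E); first by rewrite mule_ge0// integral_ge0.
  rewrite -(integral0 N [set: measurableTypeR R]).
  apply: ae_eq_integral => //.
    by apply/measurable_EFinP; apply: (measurableT_comp mcost (pair1_measurable p)).
  by apply: filterS (zero_fiber Mp0) => z hz _; rewrite /cost hz mul0r.
have -> : (\int[N]_z `|(entropy (p, z))%:E| = \int[N]_z (entropy (p, z))%:E)%E.
  apply: ae_eq_integral => //.
  - by apply: measurableT_comp => //; apply/measurable_EFinP; apply: (measurableT_comp ment (pair1_measurable p)).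
  - by apply/measurable_EFinP; apply: (measurableT_comp ment (pair1_measurable p)).
  - by apply: filterS (ent0 pfin) => z ez _; rewrite gee0_abs.
by apply: (fiber_cost (p := p)) => //; rewrite lt0e Mp0 M0.
Qed.

End one_step.

(** * Laws on the space of real sequences *)

Section cylinders.
Context {R : realType}.

(** Sides are indexed by all of [nat] although only the first [n] count, so that cylinders of
    different lengths intersect without any change of type. *)
Definition cylinders : set (set (nat -> R)) :=
  [set A | exists n (B : nat -> set R), (forall k, measurable (B k)) /\
     A = [set x | forall k, (k < n)%N -> B k (x k)]].

Definition seqR := g_sigma_algebraType cylinders.

Lemma cylinders_setI : setI_closed cylinders.
Proof.
move=> _ _ [n1 [B1 [mB1 ->]]] [n2 [B2 [mB2 ->]]].
exists (maxn n1 n2), (fun k => (if (k < n1)%N then B1 k else setT) `&`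
  (if (k < n2)%N then B2 k else setT)); split.
  by move=> k; apply: measurableI; case: ifP.
apply/seteqP; split => x /=.
  by move=> [h1 h2] k _; split; case: ifP => // kn; [exact: h1|exact: h2].
move=> h; split => k kn.
- by have [] := h k (leq_trans kn (leq_maxl _ _)); rewrite kn.
- by have [_] := h k (leq_trans kn (leq_maxr _ _)); rewrite kn.
Qed.

Lemma measurable_coord k : measurable_fun [set: seqR] (fun x : seqR => (x k : R)).
Proof.
move=> _ B mB; rewrite setTI; apply: sub_sigma_algebra.
exists k.+1, (fun j => if j == k then B else setT); split.
  by move=> j; case: ifP.
apply/seteqP; split => x /=.
  by move=> Bx j _; case: eqP => // ->.
by move=> /(_ k (ltnSn k)); rewrite eqxx.
Qed.

Lemma measurable_fun_seqR d (T : measurableType d) (f : T -> seqR) :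
  (forall k, measurable_fun [set: T] (fun x => (f x k : R))) ->
  measurable_fun [set: T] f.
Proof.
move=> mf; apply: (@measurability _ _ T seqR setT f cylinders) => //.
move=> _ [_ [n [B [mB ->]]] <-].
rewrite setTI (_ : _ @^-1` _ =
  \bigcap_(k in [set k | (k < n)%N]) ((fun x => f x k) @^-1` B k)); last first.
  by apply/seteqP; split => x /= h k /h.
by apply: bigcap_measurableType => k _; rewrite -[X in measurable X]setTI; exact: mf.
Qed.

Lemma seqR_measure_unique (m1 m2 : {measure set seqR -> \bar R}) :
  (m1 [set: seqR] < +oo)%E ->
  (forall n (B : nat -> set R), (forall k, measurable (B k)) ->
    m1 [set x | forall k, (k < n)%N -> B k (x k)] =
    m2 [set x | forall k, (k < n)%N -> B k (x k)]) ->
  forall A, measurable A -> m1 A = m2 A.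
Proof.
move=> m1T m12 A mA.
apply: (@measure_unique _ R seqR cylinders (fun=> setT)) => //.
- exact: cylinders_setI.
- move=> _; exists 0%N, (fun=> setT); split => //.
  by apply/seteqP; split.
- by rewrite bigcup_const//; exists 0%N.
- by move=> _ [n [B [mB ->]]]; exact: m12.
Qed.

End cylinders.
Arguments seqR R : clear implicits.

Section image_prob.
Context d d' (T : measurableType d) (T' : measurableType d') {R : realType}.
Variables (P : probability T R) (f : T -> T').
Hypothesis mf : measurable_fun [set: T] f.

(* The measurability proof is kept as an argument for the instances below. *)
Definition image_prob (_ : measurable_fun [set: T] f) : set T' -> \bar R :=
  pushforward P f.

Local Notation Pf := (image_prob mf).
Let Pm := measure_function_pushforward__canonical__measure_function_Measure P mf.

Let Pf0 : Pf set0 = 0%E. Proof. exact: (measure0 Pm). Qed.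
Let Pf_ge0 A : (0 <= Pf A)%E. Proof. exact: (measure_ge0 Pm). Qed.
Let Pf_sigma : semi_sigma_additive Pf.
Proof. exact: (@measure_semi_sigma_additive _ _ _ Pm). Qed.

HB.instance Definition _ := isMeasure.Build _ _ _ Pf Pf0 Pf_ge0 Pf_sigma.

Let PfT : Pf setT = 1%E.
Proof. by rewrite /image_prob /pushforward preimage_setT probability_setT. Qed.

HB.instance Definition _ := @Measure_isProbability.Build _ _ R Pf PfT.

Lemma image_probE A : image_prob mf A = P (f @^-1` A).
Proof. by []. Qed.

Lemma ge0_integral_image_prob (g : T' -> \bar R) : measurable_fun setT g ->
  (forall x, 0 <= g x)%E -> (\int[image_prob mf]_x g x = \int[P]_x g (f x))%E.
Proof.
move=> mg g0.
by rewrite (ge0_integral_pushforward mf)// preimage_setT.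
Qed.

Lemma integral_image_prob (g : T' -> \bar R) : measurable_fun setT g ->
  P.-integrable setT (g \o f) ->
  (\int[image_prob mf]_x g x = \int[P]_x g (f x))%E.
Proof.
move=> mg ig.
by rewrite (integral_pushforward mf mg)// preimage_setT.
Qed.

Lemma integrable_image_prob (g : T' -> \bar R) : measurable_fun setT g ->
  P.-integrable setT (g \o f) -> (image_prob mf).-integrable setT g.
Proof.
move=> mg /integrableP[_ ig]; apply/integrableP; split => //.
by rewrite ge0_integral_image_prob//; apply: measurableT_comp.
Qed.

End image_prob.

(** * One transport step for a law on a product with a normal factor *)

Section product_step.
Context d (P : measurableType d) {R : realType}.
Let N : probability (measurableTypeR R) R := normal_prob 0 1.
Variables (mu : probability P R) (nu : probability (P * measurableTypeR R)%type R).
Variable (h : P * measurableTypeR R -> R).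
Hypothesis mh : measurable_fun [set: P * measurableTypeR R] h.
Hypothesis h0 : forall q, 0 <= h q.
Hypothesis nuE : forall A, measurable A -> nu A = (\int[(mu \x N)%E]_(q in A) (h q)%:E)%E.

Let h1 : (\int[(mu \x N)%E]_q (h q)%:E = 1)%E.
Proof. by rewrite -nuE// probability_setT. Qed.

Let h_fin : (\int[(mu \x N)%E]_q (h q)%:E < +oo)%E.
Proof. by rewrite h1 ltry. Qed.

Let M (q : P * measurableTypeR R) : R := marginal h q.1.

Let mM : measurable_fun [set: P * measurableTypeR R] M.
Proof.
apply: (measurableT_comp (measurable_marginal mh h0)) => //.
Qed.

Let mtau := measurable_conditional_rearrangement mh h0.

Lemma step_law (A : set P) (B : set R) : measurable A -> measurable B ->
  (nu [set q | A q.1 /\ B (conditional_rearrangement h q)] =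
   nu [set q | A q.1] * N B)%E.
Proof.
move=> mA mB.
have mA' : measurable [set q : P * measurableTypeR R | A q.1].
  by rewrite -[X in measurable X]setTI; exact: measurable_fst.
have mB' : measurable [set q : P * measurableTypeR R | B (conditional_rearrangement h q)].
  by rewrite -[X in measurable X]setTI; exact: mtau.
rewrite !nuE//; last exact: measurableI.
exact: (conditional_rearrangement_law mh h0 h_fin).
Qed.

Lemma marginal_density (A : set P) : measurable A ->
  (nu [set q | A q.1] = \int[mu]_(p in A) (marginal h p)%:E)%E.
Proof.
move=> mA; rewrite nuE; last by rewrite -[X in measurable X]setTI; exact: measurable_fst.
exact: (integral_marginal mh h0 h_fin).
Qed.

Hypothesis ilnh : nu.-integrable setT (fun q => (ln (h q))%:E).
Hypothesis ilnM : nu.-integrable setT (fun q => (ln (M q))%:E).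

Let M0 q : 0 <= M q. Proof. exact: marginal_ge0. Qed.

Let integral_M : (\int[(mu \x N)%E]_q (M q)%:E = 1)%E.
Proof.
rewrite (fubini_tonelli1 (EFin \o M)); last 2 first.
- exact/measurable_EFinP.
- by move=> q; rewrite lee_fin.
rewrite /fubini_F/= /M/=.
under eq_integral do rewrite integral_cst// [X in (_ * X)%E]probability_setT mule1.
rewrite -(marginal_density measurableT).
by rewrite (_ : [set q | _] = setT) ?probability_setT//; apply/seteqP; split.
Qed.

(** The integral of [h] over the fibers where [M] is 0 is the integral of [marginal] there, which is
    0. This allows [ln (h / M)] to be split into two logarithms. *)
Let ae_M0 : {ae (mu \x N)%E, forall q, M q = 0 -> h q = 0}.
Proof.
have mM0 : measurable [set p | marginal h p = 0].
  have := measurable_marginal mh h0 measurableT (measurable_set1 0).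
  by rewrite setTI.
have mM0' : measurable [set q | M q = 0].
  by have := mM measurableT (measurable_set1 0); rewrite setTI.
have : ae_eq (mu \x N)%E [set q | M q = 0] (EFin \o h) (cst 0%E).
  apply/ae_eq_integral_abs => //.
    by apply/measurable_funTS/measurable_EFinP.
  under eq_integral do rewrite gee0_abs ?lee_fin//.
  rewrite -nuE// (marginal_density mM0).
  by apply: integral0_eq => p /= ->.
have FP := ae_filter_ringOfSetsType (mu \x N)%E.
by apply: filterS => q hq Mq; have /= [] := hq Mq.
Qed.

(** The chain rule: [h * ln (h / M)] splits into the logarithms of the joint and of the marginal
    density, and [M - h] integrates to 0 as both have mass 1. *)
Lemma step_cost :
  (\int[nu]_q ((q.2 - conditional_rearrangement h q) ^+ 2)%:E <=
   2%:E * (\int[nu]_q (ln (h q))%:E - \int[nu]_q (ln (marginal h q.1))%:E))%E.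
Proof.
pose m : probability (P * measurableTypeR R)%type R := (mu \x N)%E.
have im1 : m.-integrable setT (fun q => (ln (h q) * h q)%:E).
  apply/(@integrable_density _ _ _ m nu h) => //.
  by apply: measurableT_comp => //; exact: measurable_ln.
have im2 : m.-integrable setT (fun q => (ln (M q) * h q)%:E).
  apply/(@integrable_density _ _ _ m nu h (mh) h0 nuE (fun q => ln (M q))) => //.
  by apply: measurableT_comp => //; exact: measurable_ln.
have im3 : m.-integrable setT (fun q => (h q)%:E).
  apply/integrableP; split; first exact/measurable_EFinP.
  by under eq_integral do rewrite gee0_abs ?lee_fin//.
have im4 : m.-integrable setT (fun q => (M q)%:E).
  apply/integrableP; split; first exact/measurable_EFinP.
  under eq_integral do rewrite gee0_abs ?lee_fin//.
  by rewrite integral_M ltry.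
have -> : (\int[nu]_q (ln (h q))%:E = \int[m]_q (ln (h q) * h q)%:E)%E.
  apply: (@integral_density _ _ _ m nu h) => //.
  by apply: measurableT_comp => //; exact: measurable_ln.
have -> : (\int[nu]_q (ln (marginal h q.1))%:E = \int[m]_q (ln (M q) * h q)%:E)%E.
  apply: (@integral_density _ _ _ m nu h mh h0 nuE (fun q => ln (M q))) => //.
  by apply: measurableT_comp => //; exact: measurable_ln.
have -> : (\int[nu]_q ((q.2 - conditional_rearrangement h q) ^+ 2)%:E =
    \int[m]_q (h q * (q.2 - conditional_rearrangement h q) ^+ 2)%:E)%E.
  rewrite (@ge0_integral_density _ _ _ m nu h) => //.
  - by apply: eq_integral => q _; rewrite -EFinM mulrC.
  - by apply/measurable_EFinP/measurable_funX/measurable_funB.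
  - by move=> q; rewrite lee_fin sqr_ge0.
apply: (le_trans (conditional_rearrangement_cost mh h0 h_fin)).
rewrite -integralB// -/m.
have im12 := integrableB measurableT im1 im2.
have im34 := integrableB measurableT im4 im3.
have integral0'' : (\int[m]_q ((M q)%:E - (h q)%:E) = 0)%E.
  by rewrite integralB// [X in (X - _)%E]integral_M [X in (_ - X)%E]h1 subee.
rewrite le_eqVlt; apply/orP; left; apply/eqP; congr (2%:E * _)%E.
(* Adding the vanishing integral of [M - h] restores the integrand that is almost everywhere
   nonnegative, hence equal to its absolute value. *)
rewrite -[RHS]adde0 -integral0'' -integralD//.
apply: ae_eq_integral => //.
- apply: measurableT_comp => //; apply/measurable_EFinP.
  apply: measurable_funD => //; apply: measurable_funB => //; apply: measurable_funM => //.
  apply: measurableT_comp; first exact: measurable_ln.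
  apply: measurable_funM => //.
  exact: measurable_funV_ge0.
- by apply: emeasurable_funD; [case/integrableP: im12|case/integrableP: im34].
have FP := ae_filter_ringOfSetsType m.
apply: filterS ae_M0 => q hq _ /=; rewrite -/(M q).
have [Mq|Mq] := eqVneq (M q) 0.
  by rewrite -!EFinD (hq Mq) Mq !(mulr0, mul0r, subr0, addr0, normr0, oppr0).
have Mq0 : 0 < M q by rewrite lt0r Mq M0.
have -> : h q * ln (h q / M q) = h q * (ln (h q) - ln (M q)).
  have [->|hq0] := eqVneq (h q) 0; first by rewrite !mul0r.
  by rewrite ln_div// posrE lt0r hq0 h0.
have e0 : 0 <= h q * (ln (h q) - ln (M q)) - h q + M q.
  have c0 : 0 <= h q / M q by rewrite divr_ge0.
  have := mulr_ge0 (ltW Mq0) (entropy_ge0 c0).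
  have [hq0|hq0] := eqVneq (h q) 0; first by rewrite hq0 !(mul0r, mulr0, oppr0, add0r, mulr1).
  rewrite ln_div// ?posrE ?lt0r ?hq0 ?h0//.
  rewrite mulrDr mulrBr mulrA mulrCA divff// !mulr1; lra.
rewrite ger0_norm// -!EFinD; congr _%:E; ring.
Qed.

End product_step.

Lemma ae_le_integral d (T : measurableType d) (R : realType)
    (mu : {measure set T -> \bar R}) (f g : T -> R) :
  mu.-integrable setT (EFin \o f) -> mu.-integrable setT (EFin \o g) ->
  {ae mu, forall x, f x <= g x} -> (\int[mu]_x (f x)%:E <= \int[mu]_x (g x)%:E)%E.
Proof.
move=> fi gi fg.
have gfin : (\int[mu]_x (g x)%:E)%E \is a fin_num := integrable_fin_num measurableT gi.
rewrite -sube_ge0 ?gfin ?orbT//.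
rewrite -(integralB measurableT gi fi).
have ifg := integrableB measurableT gi fi.
rewrite (@ae_eq_integral _ _ _ mu setT (fun x => `|(g x)%:E - (f x)%:E|%E))//.
- exact: integral_ge0.
- by case/integrableP : ifg.
- by apply: measurableT_comp => //; case/integrableP : ifg.
have FP := ae_filter_ringOfSetsType mu.
by apply: filterS fg => x fgx _; rewrite gee0_abs// sube_ge0// lee_fin.
Qed.

(** * Sequential transport *)

Section densities.
Context d (T : measurableType d) {R : realType}.
Variables (gamma nu : probability T R).

(** The density of the image of [nu] under [p] relative to the image of [gamma], phrased with
    preimages so that all integrals stay on [T]. *)
Definition is_density d' (P : measurableType d') (p : T -> P) (h : P -> R) :=
  [/\ measurable_fun [set: P] h, forall u, 0 <= h u &
   forall A, measurable A ->
     nu (p @^-1` A) = (\int[gamma]_(x in p @^-1` A) (h (p x))%:E)%E].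

Section one.
Context d' (P : measurableType d') (p : T -> P).
Hypothesis mp : measurable_fun [set: T] p.

Let mpA A : measurable A -> measurable (p @^-1` A).
Proof. by move=> mA; rewrite -[X in measurable X]setTI; exact: mp. Qed.

Lemma density_exists : nu `<< gamma -> exists h, is_density p h.
Proof.
move=> numu.
have dom : image_prob nu mp `<< image_prob gamma mp.
  apply/null_content_dominatesP => A mA /= A0.
  by have /null_content_dominatesP := numu; apply; [exact: mpA|exact: A0].
pose f := Radon_Nikodym_SigmaFinite.f (image_prob nu mp) (image_prob gamma mp).
have mf : measurable_fun setT f.
  exact: measurable_int (Radon_Nikodym_SigmaFinite.f_integrable dom).
have f0 x : (0 <= f x)%E by exact: Radon_Nikodym_SigmaFinite.f_ge0.
have ffin x : f x \is a fin_num by exact: Radon_Nikodym_SigmaFinite.f_fin_num.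
exists (fine \o f); split.
- exact: (measurableT_comp (@fine_measurable R setT measurableT) mf).
- by move=> u /=; exact: fine_ge0.
move=> A mA; have -> : nu (p @^-1` A) = image_prob nu mp A by [].
rewrite (Radon_Nikodym_SigmaFinite.f_integral dom mA).
rewrite (ge0_integral_pushforward mp)//; last exact: measurable_funTS.
by apply: eq_integral => x _ /=; rewrite fineK.
Qed.

Variable h : P -> R.
Hypothesis ph : is_density p h.

Let mh : measurable_fun [set: P] h. Proof. by case: ph. Qed.
Let h0 u : 0 <= h u. Proof. by case: ph. Qed.

Lemma density_image_prob A : measurable A ->
  image_prob nu mp A = (\int[image_prob gamma mp]_(u in A) (h u)%:E)%E.
Proof.
move=> mA; rewrite (ge0_integral_pushforward mp)//.
- by case: ph => _ _; exact.
- by apply/measurable_funTS/measurable_EFinP.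
- by move=> u _; rewrite lee_fin.
Qed.

Lemma ge0_integral_density_of (f : P -> \bar R) : measurable_fun setT f ->
  (forall u, 0 <= f u)%E ->
  (\int[nu]_x f (p x) = \int[gamma]_x (f (p x) * (h (p x))%:E))%E.
Proof.
move=> mf f0.
rewrite -(ge0_integral_image_prob nu mp)//.
rewrite (@ge0_integral_density _ _ _ (image_prob gamma mp) (image_prob nu mp) h mh h0 density_image_prob)//.
rewrite (ge0_integral_image_prob gamma mp)//.
- by apply: emeasurable_funM => //; exact/measurable_EFinP.
- by move=> u; rewrite mule_ge0// lee_fin.
Qed.

Lemma density_gt0 : {ae nu, forall x, 0 < h (p x)}.
Proof.
have m0 : measurable (p @^-1` [set u | h u = 0]).
  by apply: mpA; have := mh measurableT (measurable_set1 0); rewrite setTI.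
exists (p @^-1` [set u | h u = 0]); split => //.
  case: ph => _ _ ->.
    by apply: integral0_eq => x /= ->.
  by have := mh measurableT (measurable_set1 0); rewrite setTI.
by move=> x /= /negP; rewrite -leNgt => hx; apply/eqP; rewrite eq_le hx h0.
Qed.

Lemma measurable_densityV : measurable_fun setT (fun x => (h (p x))^-1).
Proof. by apply: measurable_funV_ge0 => //; exact: measurableT_comp. Qed.

Lemma integral_density_of : (\int[gamma]_x (h (p x))%:E = 1)%E.
Proof.
by case: ph => _ _ /(_ setT measurableT); rewrite preimage_setT probability_setT.
Qed.

(** Against [gamma] the quotient becomes [w] restricted to the set where [h] is nonzero; it is an
    inequality because [h] may vanish. *)
Lemma integral_density_ratio (w : P -> R) : measurable_fun setT w ->
  (forall u, 0 <= w u) -> (\int[gamma]_x (w (p x))%:E <= 1)%E ->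
  (\int[nu]_x (w (p x) / h (p x))%:E <= 1)%E.
Proof.
move=> mw w0; apply: le_trans.
rewrite (ge0_integral_density_of (f := fun u => (w u / h u)%:E)).
- apply: ge0_le_integral => //.
  + by move=> x _; rewrite -EFinM lee_fin mulr_ge0// divr_ge0.
  + apply/measurable_EFinP; apply: measurable_funM.
      by apply: measurable_funM; [exact: measurableT_comp|exact: measurable_densityV].
    exact: measurableT_comp.
  + by apply/measurable_EFinP; exact: measurableT_comp.
  + move=> x _; rewrite -EFinM lee_fin.
    have [->|hx] := eqVneq (h (p x)) 0; first by rewrite mulr0.
    by rewrite divfK.
- apply/measurable_EFinP; apply: measurable_funM => //.
  exact: measurable_funV_ge0.
- by move=> u; rewrite lee_fin divr_ge0.
Qed.

End one.

(** Entropy decreases under the coarsening [r]: integrate [ln (h / k) <= h / k - 1], whose right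
    side has integral at most 0. Integrability holds since ln h lies between [1 - 1 / h] and
    [ln k + h / k - 1]. With [r] the identity it compares two densities of the same image. *)
Lemma gibbs d1 (P1 : measurableType d1) d2 (P2 : measurableType d2)
    (p : T -> P1) (q : T -> P2) (r : P2 -> P1) (h : P1 -> R) (k : P2 -> R) :
  measurable_fun [set: T] p -> measurable_fun [set: T] q ->
  measurable_fun [set: P2] r -> (forall x, p x = r (q x)) ->
  is_density p h -> is_density q k ->
  nu.-integrable setT (fun x => (ln (k (q x)))%:E) ->
  nu.-integrable setT (fun x => (ln (h (p x)))%:E) /\
  (\int[nu]_x (ln (h (p x)))%:E <= \int[nu]_x (ln (k (q x)))%:E)%E.
Proof.
move=> mp mq mr prq ph qk iq.
have [mh h0 _] := ph; have [mk k0 _] := qk.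
have FP := ae_filter_ringOfSetsType nu.
have mhp : measurable_fun setT (fun x => h (p x)) by exact: measurableT_comp.
have mln : measurable_fun setT (fun x => ln (h (p x))).
  by apply: measurableT_comp => //; exact: measurable_ln.
have mlnk : measurable_fun setT (fun x => ln (k (q x))).
  by case/integrableP: iq => /measurable_EFinP.
have mV := measurable_densityV mp ph.
have mVk := measurable_densityV mq qk.
have w1 : (\int[nu]_x (h (p x) / k (q x))%:E <= 1)%E.
  under eq_integral do rewrite prq.
  apply: (integral_density_ratio mq qk (w := h \o r)) => //.
  - exact: measurableT_comp.
  - by move=> u; exact: h0.
  by under eq_integral do rewrite /= -prq; rewrite (integral_density_of ph).
have w2 : (\int[nu]_x (1 / h (p x))%:E <= 1)%E.
  apply: (integral_density_ratio mp ph (w := cst 1)) => //.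
  have := integral_cst gamma measurableT (1%E : \bar R).
  rewrite mul1e [X in _ = X -> _]probability_setT => e.
  by rewrite le_eqVlt; apply/orP; left; apply/eqP; exact: e.
have iw1 : nu.-integrable setT (fun x => (h (p x) / k (q x))%:E).
  apply/integrableP; split; first by apply/measurable_EFinP/measurable_funM.
  under eq_integral do rewrite gee0_abs ?lee_fin ?divr_ge0//.
  exact: le_lt_trans w1 (ltry _).
have iw2 : nu.-integrable setT (fun x => (1 / h (p x))%:E).
  apply/integrableP; split; first by apply/measurable_EFinP/measurable_funM.
  under eq_integral do rewrite gee0_abs ?lee_fin ?divr_ge0//.
  exact: le_lt_trans w2 (ltry _).
have lnle (x : R) : 0 < x -> ln x <= x - 1.
  move=> x0; have := @le_ln1Dx R (x - 1).
  by rewrite addrCA subrr addr0; apply; lra.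
have ip : nu.-integrable setT (fun x => (ln (h (p x)))%:E).
  apply/integrableP; split; first exact/measurable_EFinP.
  have iabs : nu.-integrable setT
      (fun x => (`|ln (k (q x))|%:E + (h (p x) / k (q x))%:E + (1 / h (p x))%:E))%E.
    by apply: integrableD => //; apply: integrableD => //; exact: (integrable_abse iq).
  have [_] := integrableP _ _ _ iabs; apply: le_lt_trans.
  apply: ae_ge0_le_integral => //.
  - by apply/measurableT_comp => //; exact/measurable_EFinP.
  - by case/integrableP: iabs => ? _; apply: measurableT_comp.
  apply: filterS2 (density_gt0 mp ph) (density_gt0 mq qk) => x hx kx _ /=.
  rewrite lee_fin [leRHS]ger0_norm ?ler_norml; last first.
    by rewrite !addr_ge0// divr_ge0.
  have r0 : 0 < h (p x) / k (q x) by rewrite divr_gt0.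
  have := lnle _ r0; rewrite ln_div ?posrE// => l1.
  have i0 : 0 < 1 / h (p x) by rewrite divr_gt0.
  have := lnle _ i0; rewrite ln_div ?posrE// ln1 => l2.
  have := ler_norm (ln (k (q x))); have := normr_ge0 (ln (k (q x))).
  by move=> l3 l4; apply/andP; split; lra.
split => //.
apply: (@le_trans _ _ (\int[nu]_x ((ln (k (q x)))%:E + ((h (p x) / k (q x))%:E - 1)))%E).
  have i1 : nu.-integrable setT (cst 1%E : T -> \bar R).
    exact: finite_measure_integrable_cst.
  apply: (ae_le_integral (g := fun x => ln (k (q x)) + (h (p x) / k (q x) - 1))) => //.
    by have := integrableD measurableT iq (integrableB measurableT iw1 i1).
  apply: filterS2 (density_gt0 mp ph) (density_gt0 mq qk) => x hx kx.
  have r0 : 0 < h (p x) / k (q x) by rewrite divr_gt0.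
  have := lnle _ r0; rewrite ln_div ?posrE// => l1; lra.
have i1 : nu.-integrable setT (cst 1%E : T -> \bar R).
  exact: finite_measure_integrable_cst.
rewrite integralD//; last exact: integrableB.
have := integral_cst nu measurableT (1%E : \bar R).
rewrite mul1e [X in _ = X -> _]probability_setT => c1.
rewrite integralB// [X in (_ + (_ - X))%E]c1.
by rewrite geeDl// sube_le0.
Qed.

(** [gibbs] against a constant map, for which 1 is a density. *)
Lemma density_entropy_ge0 d1 (P1 : measurableType d1) (p : T -> P1) (h : P1 -> R) :
  measurable_fun [set: T] p -> is_density p h ->
  nu.-integrable setT (fun x => (ln (h (p x)))%:E) ->
  (0 <= \int[nu]_x (ln (h (p x)))%:E)%E.
Proof.
move=> mp ph ip.
have dc : is_density (fun=> point : P1) (cst (1 : R)).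
  split => // A mA; rewrite integral_cst ?mul1e; last first.
    by rewrite preimage_cst; case: ifP.
  rewrite preimage_cst; case: ifP => _; first exact: (etrans (probability_setT nu) (esym (probability_setT gamma))).
  by rewrite !measure0.
have [_] := gibbs (measurable_cst _) mp (measurable_cst _) (fun=> erefl) dc ph ip.
by rewrite /cst ln1 integral0.
Qed.

End densities.

Section sequential_transport.
Context d (T : measurableType d) {R : realType}.
Let N : probability (measurableTypeR R) R := normal_prob 0 1.
Variables (gamma nu : probability T R) (f : T -> R).
Hypothesis numu : nu `<< gamma.
Hypothesis df : is_density gamma nu id f.
Hypothesis ilnf : nu.-integrable setT (fun x => (ln (f x))%:E).
Variables (X : nat -> T -> R) (b : nat -> bool).
Hypothesis mX : forall n, measurable_fun [set: T] (X n).
Hypothesis XN : forall n, b n -> forall (B : nat -> set R) (A : set R),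
  (forall k, measurable (B k)) -> measurable A ->
  (gamma [set x | (forall k, (k < n)%N -> B k (X k x)) /\ A (X n x)] =
   gamma [set x | forall k, (k < n)%N -> B k (X k x)] * N A)%E.
Hypothesis X0 : forall n, ~~ b n -> {ae gamma, forall x, X n x = 0}.

(** Padding with zeros puts the pasts of all lengths in the single type [seqR R]. *)
Definition truncate_seq n (u : seqR R) : seqR R := fun k => if (k < n)%N then u k else 0.

Lemma measurable_truncate_seq n : measurable_fun setT (truncate_seq n).
Proof.
apply: measurable_fun_seqR => k; rewrite /truncate_seq.
by case: (k < n)%N => //; exact: measurable_coord.
Qed.

Let past n (x : T) : seqR R := truncate_seq n (X ^~ x).

Let mpast n : measurable_fun setT (past n).
Proof.
apply: measurable_fun_seqR => k; rewrite /past /truncate_seq.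
by case: (k < n)%N.
Qed.

(** Carries the same information as [past n.+1]. The pair has the product form needed for one step,
    the sequence lets the entropies telescope. *)
Let pq n (x : T) : seqR R * measurableTypeR R := (past n x, X n x).

Let mpq n : measurable_fun setT (pq n).
Proof. by apply: measurable_fun_pair; [exact: mpast|exact: mX]. Qed.

Let D n := sval (cid (density_exists (mpast n) numu)).
Let DP n : is_density gamma nu (past n) (D n).
Proof. by rewrite /D; case: cid. Qed.

Let H n := sval (cid (density_exists (mpq n) numu)).
Let HP n : is_density gamma nu (pq n) (H n).
Proof. by rewrite /H; case: cid. Qed.

Let mH n : measurable_fun setT (H n). Proof. by case: (HP n). Qed.
Let H0 n q : 0 <= H n q. Proof. by case: (HP n). Qed.

Let tau n (q : seqR R * R) : R :=
  if b n then conditional_rearrangement (H n) q else 0.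

Let mtau n : measurable_fun setT (tau n).
Proof.
rewrite /tau; case: (b n) => //.
exact: (measurable_conditional_rearrangement (@mH n) (@H0 n)).
Qed.

Definition sequential_transport n (x : T) : R := tau n (pq n x).

Local Notation S := sequential_transport.

Lemma measurable_sequential_transport n : measurable_fun setT (S n).
Proof. exact: (measurableT_comp (@mtau n) (@mpq n)). Qed.

Let mu n := image_prob gamma (mpast n).

(** For fixed [B] both sides are finite measures in [A]: the image of [gamma] restricted to [X n] in
    [B], and a multiple of the law of the past. By [seqR_measure_unique] cylinders suffice, and
    there the claim is [XN]. *)
Let past_indep n (A : set (seqR R)) (B : set R) : b n -> measurable A -> measurable B ->
  (gamma [set x | A (past n x) /\ B (X n x)] = gamma (past n @^-1` A) * N B)%E.
Proof.
move=> bn mA mB.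
have mXB : measurable (X n @^-1` B) by rewrite -[X in measurable X]setTI; exact: mX.
have NB : (fine (N B))%:E = N B by rewrite fineK// fin_num_measure.
pose m1 := measure_function_pushforward__canonical__measure_function_Measure
  (mrestr gamma mXB) (mpast n).
have NB0 : 0 <= fine (N B) by rewrite fine_ge0.
pose m2 := mscale (NngNum NB0) (mu n).
have -> : gamma [set x | A (past n x) /\ B (X n x)] = m1 A by [].
rewrite -NB muleC; have -> : ((fine (N B))%:E * gamma (past n @^-1` A) = m2 A)%E by [].
apply: seqR_measure_unique => //.
  by rewrite /= /pushforward /mrestr preimage_setT setTI -ge0_fin_numE// fin_num_measure.
move=> m C mC.
change (gamma [set x | (forall k, (k < m)%N -> C k (past n x k)) /\ B (X n x)] =
  (fine (N B))%:E * gamma [set x | forall k, (k < m)%N -> C k (past n x k)])%E.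
rewrite NB muleC.
(* Beyond rank [n] the past is 0, so these sides of the cylinder are either all satisfied or make
   both events empty. *)
have [C0|C0] := pselect (forall k, (n <= k < m)%N -> C k 0); last first.
  have E0 (Q : T -> Prop) : [set x | (forall k, (k < m)%N -> C k (past n x k)) /\ Q x] = set0.
    apply/seteqP; split => // x /= [h _]; apply: C0 => k /andP[nk km].
    by move: (h k km); rewrite /past /truncate_seq ltnNge nk.
  rewrite E0 (_ : [set x | _] = set0) ?measure0 ?mul0e//.
  rewrite -(E0 (fun=> True)).
  by apply/seteqP; split => x //= [].
pose C' k := if (k < m)%N then C k else setT.
have C'E x : (forall k, (k < m)%N -> C k (past n x k)) <->
    (forall k, (k < n)%N -> C' k (X k x)).
  split=> h k.
    move=> kn; rewrite /C'; case: ifP => // km.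
    by have := h k km; rewrite /past /truncate_seq kn.
  move=> km; rewrite /past /truncate_seq; case: ifPn => kn.
    by have := h k kn; rewrite /C' km.
  by apply: C0; rewrite leqNgt kn.
rewrite (_ : [set x | _ /\ _] =
    [set x | (forall k, (k < n)%N -> C' k (X k x)) /\ B (X n x)]); last first.
  by apply/seteqP; split => x /= [/C'E].
rewrite XN//; last by move=> k; rewrite /C'; case: ifP.
by congr (gamma _ * _)%E; apply/seteqP; split => x /= /C'E.
Qed.

Let pqE n A : b n -> measurable A ->
  image_prob gamma (mpq n) A = (mu n \x N)%E A.
Proof.
move=> bn mA; apply/esym; apply: product_measure_unique => // A1 A2 mA1 mA2.
exact: past_indep.
Qed.

Let nuE n A : b n -> measurable A ->
  image_prob nu (mpq n) A = (\int[(mu n \x N)%E]_(q in A) (H n q)%:E)%E.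
Proof.
move=> bn mA; rewrite (density_image_prob (mpq n) (HP n))//.
by apply: eq_measure_integral => B mB _; exact: pqE.
Qed.

Let marginalP n : b n -> is_density gamma nu (past n) (marginal (H n)).
Proof.
move=> bn; split.
- exact: (measurable_marginal (@mH n) (@H0 n)).
- by move=> u; apply: (marginal_ge0 (@H0 n)).
move=> A mA.
have := marginal_density (@mH n) (@H0 n) (fun B mB => nuE bn mB) mA.
rewrite (ge0_integral_pushforward (mpast n))//.
- apply/measurable_funTS/measurable_EFinP.
  exact: (measurable_marginal (@mH n) (@H0 n)).
- by move=> u _; rewrite lee_fin; apply: (marginal_ge0 (@H0 n)).
Qed.

Let to_id d' (P : measurableType d') (p : T -> P) h : measurable_fun setT p ->
  is_density gamma nu p h ->
  nu.-integrable setT (fun x => (ln (h (p x)))%:E) /\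
  (\int[nu]_x (ln (h (p x)))%:E <= \int[nu]_x (ln (f x))%:E)%E.
Proof. by move=> mp ph; apply: (gibbs mp (@measurable_id _ _ setT) mp _ ph df). Qed.

Let Ent n := (\int[nu]_x (ln (D n (past n x)))%:E)%E.

Let Ent_fin n : Ent n \is a fin_num.
Proof.
have [iD _] := to_id (mpast n) (DP n).
exact: (integrable_fin_num measurableT iD).
Qed.

Let Ent_pq n : (\int[nu]_x (ln (H n (pq n x)))%:E <= Ent n.+1)%E.
Proof.
have [iD _] := to_id (mpast n.+1) (DP n.+1).
have mr : measurable_fun setT (fun u : seqR R => (truncate_seq n u, u n : measurableTypeR R)).
  by apply: measurable_fun_pair; [exact: measurable_truncate_seq|exact: measurable_coord].
have [//|_ //] := gibbs (mpq n) (mpast n.+1) mr _ (HP n) (DP n.+1) iD.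
move=> x; rewrite /pq /past /truncate_seq ltnSn; congr pair.
by apply/funext => k; case: ifPn => // kn; rewrite ltnS (ltnW kn).
Qed.

Let Ent_past n : (Ent n <= \int[nu]_x (ln (H n (pq n x)))%:E)%E.
Proof.
have [iH _] := to_id (mpq n) (HP n).
by have [] := gibbs (mpast n) (mpq n) (@measurable_fst _ _ _ _) (fun=> erefl) (DP n) (HP n) iH.
Qed.

Let cost n := (\int[nu]_x ((X n x - S n x) ^+ 2)%:E)%E.

(** A degenerate coordinate is 0 almost everywhere for [gamma], hence for [nu], and is sent to 0.
    For the others [step_cost] gives a difference of entropies, and [gibbs] moves both terms in the
    right direction. *)
Let cost_le n : (cost n <= 2%:E * (Ent n.+1 - Ent n))%E.
Proof.
have FP := ae_filter_ringOfSetsType nu.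
rewrite /cost; have [bn|bn] := boolP (b n); last first.
  rewrite (_ : (\int[nu]_x _)%E = 0%E).
    by rewrite mule_ge0// sube_ge0 ?Ent_fin//; exact: (le_trans (Ent_past n) (Ent_pq n)).
  rewrite -(integral0 nu [set: T]).
  apply: ae_eq_integral => //.
    apply/measurable_EFinP/measurable_funX/measurable_funB => //.
    exact: measurable_sequential_transport.
  have X0' : {ae nu, forall x, X n x = 0}.
    have [Z [mZ Z0 XZ]] := X0 bn; exists Z; split => //.
    by have /null_content_dominatesP := numu; exact.
  apply: filterS X0' => x Xx _ /=.
  by rewrite /sequential_transport /tau (negbTE bn) Xx subr0 expr0n.
have [iH _] := to_id (mpq n) (HP n).
have [iM _] := to_id (mpast n) (marginalP bn).
(* [D n] and [marginal (H n)] are densities of the same image of [nu]; this one inequality is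
   enough, so their almost everywhere equality is not proved. *)
have EM : (Ent n <= \int[nu]_x (ln (marginal (H n) (past n x)))%:E)%E.
  by have [] := gibbs (mpast n) (mpast n) (@measurable_id _ _ setT) (fun=> erefl) (DP n) (marginalP bn) iM.
have mlnH : measurable_fun setT (fun q => (ln (H n q))%:E).
  by apply/measurable_EFinP; apply: measurableT_comp => //; exact: measurable_ln.
have mlnM : measurable_fun setT (fun q : seqR R * measurableTypeR R => (ln (marginal (H n) q.1))%:E).
  apply/measurable_EFinP; apply: measurableT_comp; first exact: measurable_ln.
  by apply: (measurableT_comp (measurable_marginal (@mH n) (@H0 n))).
have := step_cost (@mH n) (@H0 n) (fun B mB => nuE bn mB)
  (integrable_image_prob (mpq n) mlnH iH) (integrable_image_prob (mpq n) mlnM iM).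
rewrite (ge0_integral_image_prob nu (mpq n)); last 2 first.
- apply/measurable_EFinP/measurable_funX/measurable_funB => //.
  exact: (measurable_conditional_rearrangement (@mH n) (@H0 n)).
- by move=> q; rewrite lee_fin sqr_ge0.
rewrite (integral_image_prob (mpq n) mlnH iH) (integral_image_prob (mpq n) mlnM iM) => h.
have -> : (\int[nu]_x ((X n x - S n x) ^+ 2)%:E = \int[nu]_x
   (((pq n x).2 - conditional_rearrangement (H n) (pq n x)) ^+ 2)%:E)%E.
  by apply: eq_integral => x _; rewrite /sequential_transport /tau bn.
apply: (le_trans h); apply: lee_wpmul2l => //.
by apply: leeB => //; exact: Ent_pq.
Qed.

(** The steps telescope to [Ent n - Ent 0]. Each [Ent n] is at most the full entropy by [gibbs], and
    [Ent 0] is nonnegative, so no convergence of [Ent n] is involved. *)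
Lemma sequential_transport_cost :
  (\int[nu]_x (\sum_(n <oo) ((X n x - S n x) ^+ 2)%:E) <=
   2%:E * \int[nu]_x (ln (f x))%:E)%E.
Proof.
rewrite integral_nneseries//; last 2 first.
- move=> n; apply/measurable_EFinP/measurable_funX/measurable_funB => //.
  exact: measurable_sequential_transport.
- by move=> n x _; rewrite lee_fin sqr_ge0.
have part n : (\sum_(0 <= k < n) cost k <= 2%:E * (Ent n - Ent 0%N))%E.
  elim: n => [|n IH].
    by rewrite big_geq// subee// mule0.
  rewrite big_nat_recr//=; apply: (le_trans (leeD IH (cost_le n))).
  rewrite -(fineK (Ent_fin n.+1)) -(fineK (Ent_fin n)) -(fineK (Ent_fin 0%N)).
  rewrite -!EFinB -!EFinM -EFinD lee_fin; lra.
apply: lime_le; first by apply: is_cvg_nneseries => n _ _; apply: integral_ge0 => x _; rewrite lee_fin sqr_ge0.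
apply: nearW => n; apply: (le_trans (part n)); apply: lee_wpmul2l => //.
have [iD ED] := to_id (mpast n) (DP n).
apply: (le_trans _ ED); rewrite -/(Ent n) geeDl// oppe_le0.
apply: (density_entropy_ge0 (mpast 0%N) (DP 0%N)).
by have [] := to_id (mpast 0%N) (DP 0%N).
Qed.

(** By induction: each [S k] depends only on X_0, ..., X_k, so an event on S_0, ..., S_(n-1) is an
    event [A] on the past of [X n]. Then [step_law] splits off the same factor under [nu] as [XN]
    does under [gamma]. *)
Lemma sequential_transport_law n (B : nat -> set R) : (forall k, measurable (B k)) ->
  nu [set x | forall k, (k < n)%N -> B k (S k x)] =
  gamma [set x | forall k, (k < n)%N -> B k (X k x)].
Proof.
move=> mB; elim: n => [|n IH].
  have E (Q : nat -> T -> Prop) : [set x | forall k, (k < 0)%N -> Q k x] = setT.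
    by apply/seteqP; split.
  rewrite !(E (fun k x => B k _)).
  exact: (etrans (probability_setT nu) (esym (probability_setT gamma))).
pose A := [set u : seqR R | forall k, (k < n)%N -> B k (tau k (truncate_seq k u, u k))].
have mA : measurable A.
  rewrite (_ : A = \bigcap_(k in [set k | (k < n)%N])
      ((fun u : seqR R => tau k (truncate_seq k u, u k)) @^-1` B k)); last first.
    by apply/seteqP; split => x /= h k /h.
  apply: bigcap_measurableType => k _; rewrite -[X in measurable X]setTI.
  suff : measurable_fun setT (fun u : seqR R => tau k (truncate_seq k u, u k)) by exact.
  apply: measurableT_comp => //.
  by apply: measurable_fun_pair; [exact: measurable_truncate_seq|exact: measurable_coord].
have AE x : A (past n x) <-> forall k, (k < n)%N -> B k (S k x).
  have e k : (k < n)%N -> (truncate_seq k (past n x), past n x k) = pq k x.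
    move=> kn; rewrite /pq /past /truncate_seq kn; congr pair.
    by apply/funext => j; case: ifPn => // jk; rewrite (ltn_trans jk kn).
  by split => h k kn; have := h k kn; rewrite /S /= e.
have recE (Y : nat -> T -> R) :
    [set x | forall k, (k < n.+1)%N -> B k (Y k x)] =
    [set x | (forall k, (k < n)%N -> B k (Y k x)) /\ B n (Y n x)].
  apply/seteqP; split => x /=.
    by move=> h; split => [k kn|]; apply: h; rewrite ?ltnSn// ltnS ltnW.
  by move=> [h1 h2] k; rewrite ltnS leq_eqVlt => /predU1P[->//|]; exact: h1.
rewrite !recE; have [bn|bn] := boolP (b n).
  rewrite XN// -IH.
  have h : (nu [set x | A (past n x) /\ B n (conditional_rearrangement (H n) (pq n x))] =
      nu [set x | A (past n x)] * N (B n))%E.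
    exact: (step_law (@mH n) (@H0 n) (fun C mC => nuE bn mC) mA (mB n)).
  have -> : [set x | forall k, (k < n)%N -> B k (S k x)] = [set x | A (past n x)].
    by apply: eq_set => x; rewrite (propext (AE x)).
  rewrite -h; congr (nu _).
  have Sn x : S n x = conditional_rearrangement (H n) (pq n x).
    by rewrite /sequential_transport /tau bn.
  by apply: eq_set => x; rewrite Sn (propext (AE x)).
have mBX : measurable [set x | forall k, (k < n)%N -> B k (X k x)].
  rewrite (_ : [set x | _] = \bigcap_(k in [set k | (k < n)%N]) (X k @^-1` B k)); last first.
    by apply/seteqP; split => x /= h k /h.
  by apply: bigcap_measurableType => k _; rewrite -[X in measurable X]setTI; exact: mX.
have mBn : measurable (X n @^-1` B n) by rewrite -[X in measurable X]setTI; exact: mX.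
have FP := ae_filter_ringOfSetsType gamma.
have S0 x : S n x = 0 by rewrite /sequential_transport /tau (negbTE bn).
have [B0|B0] := pselect (B n 0).
  rewrite (_ : [set x | _] = [set x | forall k, (k < n)%N -> B k (S k x)]); last first.
    by apply/seteqP; split => x /= => [[]//|h]; rewrite S0.
  rewrite IH; apply: ae_eq_measure => //; first exact: measurableI.
  by apply: filterS (X0 bn) => x /= ->; split => // -[].
rewrite (_ : [set x | _] = set0); last first.
  by apply/seteqP; split => x //=; rewrite S0 => -[].
rewrite measure0 -(measure0 gamma); apply: ae_eq_measure => //; first exact: measurableI.
by apply: filterS (X0 bn) => x /= ->; split => // -[].
Qed.

End sequential_transport.

Lemma bounded_integrable d (T : measurableType d) (R : realType)
    (P : probability T R) (f : T -> R) (C : R) :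
  measurable_fun [set: T] f -> (forall x, `|f x| <= C) ->
  P.-integrable setT (EFin \o f).
Proof.
move=> mf fC; apply: measurable_bounded_integrable => //.
- by rewrite -ge0_fin_numE// fin_num_measure.
- by exists C; split=> [|M CM x _]; rewrite ?num_real//= (le_trans _ (ltW CM)).
Qed.

(** Chebyshev's inequality, from the variance of the normal law. *)
Lemma normal_prob_concentration (R : realType) (x s r : R) : s != 0 -> 0 < r ->
  (normal_prob x s [set z | (r <= `|z - x|)%R] <= ((s / r) ^+ 2)%:E)%E.
Proof.
move=> s0 r0.
pose A : set (measurableTypeR R) := [set z | r <= `|z - x|].
have mA : measurable A.
  have : measurable_fun [set: R] (fun z => r <= `|z - x|).
    apply: measurable_fun_ler => //.
    by apply: measurableT_comp => //; exact: measurable_funB.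
  by move=> /(_ measurableT [set true]); rewrite setTI; apply.
rewrite -/A expr_div_n EFinM.
have r20 : 0 < r ^+ 2 by rewrite exprn_gt0.
rewrite lee_pdivlMr//.
rewrite -(normal_prob_variance x s0).
apply: (@le_trans _ _ (\int[normal_prob x s]_(z in A) ((z - x) ^+ 2)%:E)%E).
  rewrite muleC -integral_cst//.
  apply: ge0_le_integral => //.
  - by move=> z _; rewrite lee_fin ltW.
  - by apply/measurable_funTS/measurable_EFinP/measurable_funX; exact: measurable_funB.
  - move=> z Az; rewrite lee_fin -[leRHS]real_normK ?num_real//.
    by rewrite ler_pXn2r// ?nnegrE// ltW.
apply: ge0_subset_integral => //.
- by apply/measurable_EFinP/measurable_funX; exact: measurable_funB.
- by move=> z _; rewrite lee_fin sqr_ge0.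
Qed.

(** * Characteristic functions and independence *)

Section char_fun_unique.
Context {R : realType}.
Let N : probability (measurableTypeR R) R := normal_prob 0 1.
Variables (m1 m2 : probability (measurableTypeR R) R).
Hypothesis char12 : forall t a : R,
  (\int[m1]_x (cos (t * x + a))%:E = \int[m2]_x (cos (t * x + a))%:E)%E.

(* The left side is, up to normalization, the density at [y] of [m] convolved
   with a normal law, so cosine transforms determine it. *)
Let gauss_kernel (m : probability (measurableTypeR R) R) (t y : R) :
  (\int[m]_x (expR (- (t * (x - y)) ^+ 2 / 2))%:E =
   \int[N]_z \int[m]_x (cos (t * z * x + - (t * z * y)))%:E)%E.
Proof.
pose f (q : measurableTypeR R * measurableTypeR R) : \bar R :=
  (cos (t * (q.1 - y) * (q.2 - 0) + 0))%:E.
have mf : measurable_fun setT f.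
  apply/measurable_EFinP/measurable_cosT.
  apply: measurable_funD => //; apply: measurable_funM.
    by apply: measurable_funM => //; exact: measurable_funB.
  exact: measurable_funB.
have if' : (m \x N)%E.-integrable setT f.
  apply: (@bounded_integrable _ _ _ (m \x N : probability _ R)%E _ 1).
    exact/measurable_EFinP.
  by move=> q; rewrite ler_norml cos_geN1 cos_le1.
transitivity (\int[m]_x \int[N]_z f (x, z))%E.
  apply: eq_integral => x _; rewrite /f/=.
  rewrite (normal_prob_char_fun 0 (oner_neq0 R)) cos0 mul1r expr1n mulr1.
  by [].
rewrite Fubini//; apply: eq_integral => z _; apply: eq_integral => x _.
by rewrite /f/=; congr (cos _)%:E; ring.
Qed.

Let pdf12 (s y : R) : s != 0 ->
  (\int[m1]_x (normal_pdf x s y)%:E = \int[m2]_x (normal_pdf x s y)%:E)%E.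
Proof.
move=> s0; have E (m : probability (measurableTypeR R) R) :
    (\int[m]_x (normal_pdf x s y)%:E =
     (normal_peak s)%:E * \int[m]_x (expR (- (s^-1 * (x - y)) ^+ 2 / 2))%:E)%E.
  rewrite -ge0_integralZl//.
  - apply: eq_integral => x _; rewrite normal_pdfE// -EFinM; congr (_ * expR _)%:E.
    by field.
  - apply/measurable_EFinP; apply: (@measurableT_comp _ _ _ _ _ _ expR) => //.
    apply: measurable_funM => //; apply: measurableT_comp => //.
    by apply: measurable_funX; apply: measurable_funM => //; exact: measurable_funB.
  - by rewrite lee_fin normal_peak_ge0.
rewrite !E !gauss_kernel; congr (_ * _)%E.
by apply: eq_integral => z _; exact: char12.
Qed.

(** The indicator of [a, b] smoothed by a normal law. By Tonelli its integral depends on the measure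
    only through the kernels of [pdf12], for which [m1] and [m2] agree. *)
Let K (s a b x : R) : \bar R :=
  (\int[@lebesgue_measure R]_y (normal_pdf x s y * \1_(`[a, b]%classic) y)%:E)%E.

Let KE s a b x : K s a b x = normal_prob x s `[a, b]%classic.
Proof.
rewrite /K /normal_prob [RHS]integral_mkcond.
apply: eq_integral => y _; rewrite patchE indicE.
by case: ifP => _; rewrite ?mulr1 ?mulr0.
Qed.

Let kern s a b (q : measurableTypeR R * measurableTypeR R) : \bar R :=
  (normal_pdf q.1 s q.2 * \1_(`[a, b]%classic) q.2)%:E.

Let mkern s a b : s != 0 -> measurable_fun setT (kern s a b).
Proof.
move=> s0; apply/measurable_EFinP; apply: measurable_funM; last first.
  by apply: (measurableT_comp (measurable_indic _)).
rewrite (_ : (fun q => _) = fun q : measurableTypeR R * measurableTypeR R =>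
  normal_peak s * expR (- (q.2 - q.1) ^+ 2 / (s ^+ 2 *+ 2))).
  apply: measurable_funM => //; apply: (@measurableT_comp _ _ _ _ _ _ expR) => //.
  apply: measurable_funM => //; apply: measurableT_comp => //.
  by apply: measurable_funX; exact: measurable_funB.
by apply/funext => q; rewrite normal_pdfE.
Qed.

Let kern0 s a b q : (0 <= kern s a b q)%E.
Proof. by rewrite lee_fin mulr_ge0// normal_pdf_ge0. Qed.

Let mK s a b : s != 0 -> measurable_fun [set: measurableTypeR R] (K s a b).
Proof.
move=> s0.
exact: (measurable_fun_fubini_tonelli_F (kern s a b) (mkern a b s0) (@kern0 s a b)).
Qed.

Let K12 s a b : s != 0 -> (\int[m1]_x K s a b x = \int[m2]_x K s a b x)%E.
Proof.
move=> s0.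
have E (m : probability (measurableTypeR R) R) : (\int[m]_x K s a b x =
    \int[@lebesgue_measure R]_y (\int[m]_x (normal_pdf x s y)%:E * (\1_(`[a, b]%classic) y)%:E))%E.
  rewrite [LHS](fubini_tonelli (m1 := m) (m2 := @lebesgue_measure R) (kern s a b) (mkern a b s0) (@kern0 s a b))//.
    apply: eq_integral => y _; rewrite -ge0_integralZr//.
    - apply/measurable_EFinP.
      rewrite (_ : (fun q => _) = fun q : measurableTypeR R =>
        normal_peak s * expR (- (y - q) ^+ 2 / (s ^+ 2 *+ 2))).
        apply: measurable_funM => //; apply: (@measurableT_comp _ _ _ _ _ _ expR) => //.
        apply: measurable_funM => //; apply: measurableT_comp => //.
        by apply: measurable_funX; exact: measurable_funB.
      by apply/funext => q; rewrite normal_pdfE.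
    - by move=> x _; rewrite lee_fin normal_pdf_ge0.
by rewrite !E; apply: eq_integral => y _; rewrite pdf12.
Qed.

Let r n : R := n.+1%:R^-1.
Let r0 n : 0 < r n. Proof. by rewrite invr_gt0. Qed.
Let s0 n : r n ^+ 2 != 0. Proof. by rewrite gt_eqF// exprn_gt0. Qed.

(** At deviation [r n ^ 2] Chebyshev leaves mass at most [r n ^ 2] beyond distance [r n]. Shrinking
    the interval by [r n] at both ends makes the limit the indicator of the open interval even at a
    and b. *)
Let k a b n x := fine (K (r n ^+ 2) (a + r n) (b - r n) x).

Let kE a b n x : K (r n ^+ 2) (a + r n) (b - r n) x = (k a b n x)%:E.
Proof. by rewrite /k fineK// KE fin_num_measure. Qed.

Let k01 a b n x : 0 <= k a b n x <= 1.
Proof. by rewrite -!lee_fin -kE KE measure_ge0 probability_le1. Qed.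

Let conc n x : (normal_prob x (r n ^+ 2) [set z | (r n <= `|z - x|)%R] <= (r n ^+ 2)%:E)%E.
Proof.
have := normal_prob_concentration x (s0 n) (r0 n).
by rewrite {2}expr2 mulfK// gt_eqF.
Qed.

Let mconc n x : measurable [set z : measurableTypeR R | (r n <= `|z - x|)%R].
Proof.
have : measurable_fun [set: R] (fun z => r n <= `|z - x|).
  apply: measurable_fun_ler => //.
  by apply: measurableT_comp => //; exact: measurable_funB.
by move=> /(_ measurableT [set true]); rewrite setTI; apply.
Qed.

Let k_in a b n x : a + 2 * r n <= x -> x <= b - 2 * r n -> 1 - r n ^+ 2 <= k a b n x.
Proof.
move=> ax xb; rewrite -lee_fin -kE KE EFinB leeBlDr//.
rewrite -(@probability_setT _ _ _ (normal_prob x (r n ^+ 2))).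
apply: (@le_trans _ _ (normal_prob x (r n ^+ 2) `[(a + r n)%R, (b - r n)%R]%classic +
  normal_prob x (r n ^+ 2) [set z | (r n <= `|z - x|)%R])%E); last first.
  by rewrite leeD2l// conc.
apply: (le_trans _ (measureU2 _ _ _)) => //.
apply: le_measure; rewrite ?inE//; first exact: measurableU.
move=> z _; have [h|h] := leP (r n) `|z - x|; [by right|left].
rewrite /= in_itv/=; move: h; rewrite ltr_norml => /andP[h1 h2]; apply/andP.
have := r0 n => rn0; split; lra.
Qed.

Let k_out a b n x : x <= a \/ b <= x -> k a b n x <= r n ^+ 2.
Proof.
move=> xab; rewrite -lee_fin -kE KE; apply: (le_trans _ (conc n x)).
apply: le_measure; rewrite ?inE// => z /=; rewrite in_itv/= => /andP[za zb].
rewrite ler_normr; apply/orP; have := r0 n => rn0.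
by case: xab => h; [left|right]; lra.
Qed.

Let r_cvg : r @ \oo --> (0 : R).
Proof. exact: cvg_harmonic. Qed.

Let k_cvg a b x : (k a b) ^~ x @ \oo --> (\1_(`]a, b[%classic) x : R).
Proof.
have r2 : (fun n => r n ^+ 2) @ \oo --> (0 : R).
  have -> : (fun n => r n ^+ 2) = (fun n => r n * r n) by apply/funext => n; rewrite expr2.
  by rewrite -(mulr0 (0 : R)); exact: cvgM.
rewrite indicE; case: (boolP (x \in `]a, b[%classic)) => /=.
  rewrite inE /= in_itv/= => /andP[ax xb].
  have r22 : (fun n => 1 - r n ^+ 2) @ \oo --> (1 : R).
    by rewrite -[X in _ --> X]subr0; apply: cvgB => //; exact: cvg_cst.
  apply: (@squeeze_cvgr _ _ _ _ (fun n => 1 - r n ^+ 2) (cst 1)) => //; last exact: cvg_cst.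
  have [e e0 He] : exists2 e : R, 0 < e & a + 2 * e <= x /\ x <= b - 2 * e.
    exists (Num.min (x - a) (b - x) / 2); first by rewrite divr_gt0// lt_min; apply/andP; split; lra.
    have h1 : Num.min (x - a) (b - x) <= x - a by rewrite ge_min lexx.
    have h2 : Num.min (x - a) (b - x) <= b - x by rewrite ge_min lexx orbT.
    by split; lra.
  have re : \forall n \near \oo, r n <= e by have /cvgr_le := r_cvg; exact.
  near=> n.
  have rn : r n <= e by near: n; exact: re.
  have /andP[_ ->] := k01 a b n x; rewrite andbT.
  by apply: k_in; case: He; lra.
rewrite notin_setE /= in_itv/= => /negP; rewrite negb_and -!leNgt => /orP xab.
apply: (squeeze_cvgr _ (cvg_cst 0) r2).
by apply: nearW => n; have /andP[-> _] := k01 a b n x; exact: k_out.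
Unshelve. all: by end_near. Qed.

Let lim_k (m : probability (measurableTypeR R) R) a b :
  (fun n => \int[m]_x (k a b n x)%:E)%E @ \oo --> m `]a, b[%classic.
Proof.
rewrite -(setIT `]a, b[%classic) -integral_indic//.
apply: (@dominated_cvg _ _ _ m setT measurableT _ _ (cst 1%E)) => //.
- move=> n; rewrite (_ : (fun x => _) = K (r n ^+ 2) (a + r n) (b - r n)); first exact: mK.
  by apply/funext => x; rewrite kE.
- by move=> x _; apply/fine_cvgP; split; [exact: nearW|exact: k_cvg].
- exact: finite_measure_integrable_cst.
- move=> n x _; rewrite /= lee_fin ger0_norm; by have /andP[] := k01 a b n x.
Qed.

Lemma char_fun_unique (A : set (measurableTypeR R)) : measurable A -> m1 A = m2 A.
Proof.
move=> mA.
apply: (@measure_unique _ R (measurableTypeR R) (@RGenOpens.G R)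
  (fun n => `](- n%:R), n%:R[%classic)) => //.
- exact: RGenOpens.measurableE.
- move=> _ _ [a [b ->]] [c [e ->]]; exists (Num.max a c), (Num.min b e).
  apply/seteqP; split => x /=; rewrite !in_itv/= gt_max lt_min.
    by move=> [/andP[-> ->] /andP[-> ->]].
  by move=> /andP[/andP[-> ->] /andP[-> ->]].
- by move=> n; exists (- n%:R), n%:R.
- apply/seteqP; split => // x _; exists (Num.bound `|x|) => //=.
  by rewrite in_itv/= -ltr_norml archi_boundP.
- move=> _ [a [b ->]].
  have := @lim_k m1 a b; have := @lim_k m2 a b.
  rewrite (_ : (fun n => \int[m2]_x _)%E = (fun n => \int[m1]_x (k a b n x)%:E)%E).
    by move=> c2 c1; apply: (cvg_unique _ c1 c2).
  apply/funext => n; under eq_integral do rewrite -kE.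
  by under [RHS]eq_integral do rewrite -kE; rewrite K12.
- by move=> n; rewrite -ge0_fin_numE// fin_num_measure.
Qed.

End char_fun_unique.

Section bounded_integrals.
Context d (T : measurableType d) {R : realType} (P : probability T R).
Implicit Types f : T -> R.

Lemma EFin_Rintegral (D : set T) f : measurable D -> P.-integrable D (EFin \o f) ->
  (\int[P]_(x in D) (f x)%:E)%E = (\int[P]_(x in D) f x)%:E.
Proof. by move=> mD fi; rewrite /Rintegral fineK// (integrable_fin_num mD fi). Qed.

Lemma bounded_integrableS (D : set T) f (C : R) : measurable D ->
  measurable_fun [set: T] f -> (forall x, `|f x| <= C) ->
  P.-integrable D (EFin \o f).
Proof.
move=> mD mf fC; apply: (integrableS measurableT mD) => //.
exact: bounded_integrable fC.
Qed.

Lemma Rintegral_indicM (D E : set T) f :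
  \int[P]_(x in D) (\1_E x * f x) = \int[P]_(x in D `&` E) f x.
Proof.
rewrite Rintegral_mkcond [RHS]Rintegral_mkcond; apply: eq_Rintegral => x _.
rewrite !patchE in_setI indicE.
by case: (x \in D); case: (x \in E); rewrite //= ?mul1r ?mul0r.
Qed.

End bounded_integrals.

(** [1 + W / C'] is a probability density, as [C'] exceeds the bound of [W] and t = a = 0 gives mean
    0. It does not alter the cosine transforms of [X], hence neither its law, by [char_fun_unique].
    In effect the conditional expectation of [W] given [X] is 0. *)
Lemma Rintegral_preimage_eq0 d (T : measurableType d) (R : realType)
    (P : probability T R) (X W : T -> R) (C : R) :
  measurable_fun [set: T] X -> measurable_fun [set: T] W -> (forall x, `|W x| <= C) ->
  (forall t a : R, \int[P]_x (W x * cos (t * X x + a)) = 0) ->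
  forall B, measurable B -> \int[P]_(x in X @^-1` B) W x = 0.
Proof.
move=> mX mW WC char B mB.
have C0 : 0 <= C by apply: le_trans (WC point); exact: normr_ge0.
pose C' := C + 1; have C'0 : 0 < C' by rewrite ltr_wpDl.
pose U x := 1 + W x / C'.
have mU : measurable_fun [set: T] U by apply: measurable_funD => //; exact: measurable_funM.
have Wabs x : `|W x / C'| <= 1.
  rewrite normrM (@ger0_norm _ C'^-1) ?invr_ge0 ?(ltW C'0)//.
  by rewrite ler_pdivrMr// mul1r (le_trans (WC x))// lerDl.
have U0 x : 0 <= U x by have := Wabs x; rewrite ler_norml /U => /andP[]; lra.
have iW D : measurable D -> P.-integrable D (EFin \o W).
  by move=> mD; exact: bounded_integrableS mW WC.
have mcosX t a : measurable_fun [set: T] (fun x => cos (t * X x + a)).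
  by apply: measurable_cosT; apply: measurable_funD => //; exact: measurable_funM.
have mcos t a : measurable_fun [set: measurableTypeR R] (fun x => cos (t * x + a)).
  by apply: measurable_cosT; apply: measurable_funD => //; exact: measurable_funM.
have bcos (x : R) : `|cos x| <= 1 by rewrite ler_norml cos_geN1 cos_le1.
have iWcos t a : P.-integrable setT (EFin \o (fun x => W x * cos (t * X x + a))).
  apply: (@bounded_integrable _ _ _ _ _ C); first exact: measurable_funM.
  by move=> x; rewrite normrM -[leRHS]mulr1 ler_pM.
have EU (D : set T) (mD : measurable D) :
    (\int[P]_(x in D) (U x)%:E = P D + (C'^-1 * \int[P]_(x in D) W x)%:E)%E.
  rewrite (_ : (fun x => (U x)%:E) = (fun x => 1%:E + (C'^-1)%:E * (W x)%:E)%E); last first.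
    by apply/funext => x; rewrite /U EFinD EFinM muleC.
  rewrite integralD//; last 2 first.
  - by apply: (integrableS measurableT mD) => //; exact: finite_measure_integrable_cst.
  - by apply: integrableZl => //; exact: iW.
  rewrite [X in (X + _)%E]integral_cst// mul1e; congr (_ + _)%E.
  by rewrite integralZl//; [rewrite EFin_Rintegral//; exact: iW|exact: iW].
have W0 : \int[P]_x W x = 0.
  have := char 0 0; rewrite (_ : (fun x => _) = W)//.
  by apply/funext => x; rewrite mul0r addr0 cos0 mulr1.
have U1 : (\int[P]_x (U x)%:E = 1)%E.
  by rewrite EU// W0 mulr0 adde0 probability_setT.
have mB' : measurable (X @^-1` B) by rewrite -[X in measurable X]setTI; exact: mX.
pose PU : probability T R := density_prob mU U0 U1.
have PUE A : measurable A -> PU A = (\int[P]_(x in A) (U x)%:E)%E by [].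
have mX' : @measurable_fun _ _ T (measurableTypeR R) setT X by [].
have : image_prob PU mX' B = image_prob P mX' B.
  apply: (@char_fun_unique R (image_prob PU mX') (image_prob P mX')) => // t a.
  have Icos (Q : probability T R) : (\int[image_prob Q mX']_x (cos (t * x + a))%:E =
      \int[Q]_x (cos (t * X x + a))%:E)%E.
    apply: (integral_image_prob (P := Q) mX' (g := fun x => (cos (t * x + a))%:E)).
      by apply/measurable_EFinP; exact: mcos.
    exact: (@bounded_integrable _ _ _ _ _ 1).
  rewrite !Icos.
  rewrite (@integral_density _ _ _ P PU U)//.
  rewrite (_ : (fun x => (cos (t * X x + a) * U x)%:E) =
    (fun x => (cos (t * X x + a))%:E + (C'^-1)%:E * (W x * cos (t * X x + a))%:E)%E); last first.
    by apply/funext => x; rewrite -EFinM -EFinD /U; congr _%:E; ring.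
  rewrite integralD//; last 2 first.
  - exact: (@bounded_integrable _ _ _ _ _ 1).
  - exact: (integrableZl measurableT _ (iWcos t a)).
  rewrite (integralZl measurableT (iWcos t a)) (EFin_Rintegral _ (iWcos _ _))// char -EFinM mulr0 adde0.
  by [].
rewrite !image_probE PUE// EU// => h.
have : C'^-1 * \int[P]_(x in X @^-1` B) W x = 0.
  have Pfin : P (X @^-1` B) \is a fin_num by rewrite fin_num_measure.
  by move: h; rewrite -(fineK Pfin) -EFinD => -[]; lra.
by move/eqP; rewrite mulf_eq0 invr_eq0 gt_eqF//= => /eqP.
Qed.

Section gaussian_independence.
Context d (T : measurableType d) {R : realType} (P : probability T R).
Let N : probability (measurableTypeR R) R := normal_prob 0 1.
Variables (X : nat -> T -> R) (v : nat -> bool).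
Hypothesis mX : forall n, measurable_fun [set: T] (X n).

Let q (t : nat -> R) k := if v k then t k ^+ 2 else 0.

Hypothesis charX : forall n (t : nat -> R) (a : R),
  \int[P]_x cos (\sum_(0 <= k < n) t k * X k x + a) =
  cos a * expR (- (\sum_(0 <= k < n) q t k) / 2).

Let cyl (B : nat -> set R) n := [set x | forall k, (k < n)%N -> B k (X k x)].

Let mcyl B n : (forall k, measurable (B k)) -> measurable (cyl B n).
Proof.
move=> mB; rewrite (_ : cyl B n = \bigcap_(k in [set k | (k < n)%N]) (X k @^-1` B k)); last first.
  by apply/seteqP; split => x /= h k /h.
by apply: bigcap_measurableType => k _; rewrite -[X in measurable X]setTI; exact: mX.
Qed.

Let cylS B n : cyl B n.+1 = X n @^-1` B n `&` cyl B n.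
Proof.
apply/seteqP; split => x /=.
  by move=> h; split => [|k kn]; apply: h; rewrite ?ltnSn// ltnS ltnW.
by move=> [h1 h2] k; rewrite ltnS leq_eqVlt => /predU1P[->//|]; exact: h2.
Qed.

Let bcos (x : R) : `|cos x| <= 1. Proof. by rewrite ler_norml cos_geN1 cos_le1. Qed.

Let msum m n t : measurable_fun setT (fun x => \sum_(m <= k < n) t k * X k x).
Proof. by apply: measurable_sum => k; exact: measurable_funM. Qed.

Let iD (D : set T) f (C : R) := @bounded_integrableS _ _ _ P D f C.

(** Induction on [m], moving one coordinate at a time from the cosine into the event: the later
    cosine minus its expected value, cut down to the earlier event, has vanishing transforms against
    [X m], so [Rintegral_preimage_eq0] applies to it. *)
Lemma cylinder_char_fun m (B : nat -> set R) : (forall k, measurable (B k)) ->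
  forall n t a,
  \int[P]_(x in cyl B m) cos (\sum_(m <= k < n) t k * X k x + a) =
  fine (P (cyl B m)) * (cos a * expR (- (\sum_(m <= k < n) q t k) / 2)).
Proof.
move=> mB; elim: m => [|m IH] n t a.
  rewrite (_ : cyl B 0 = setT) ?probability_setT ?mul1r//.
  by apply/seteqP; split.
have mE := mcyl m mB; have mE1 := mcyl m.+1 mB.
have [nm|mn] := leqP n m.+1.
  rewrite [X in _ * (_ * expR (- X / 2))]big_geq// oppr0 mul0r expR0 mulr1.
  under eq_Rintegral do rewrite big_geq// add0r.
  by rewrite Rintegral_cst// mulrC.
pose U x := \sum_(m.+1 <= k < n) t k * X k x.
have mU : measurable_fun setT U by exact: msum.
pose S := expR (- (\sum_(m.+1 <= k < n) q t k) / 2).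
pose W x := \1_(cyl B m) x * (cos (U x + a) - cos a * S).
have mW0 : measurable_fun setT (fun x => cos (U x + a) - cos a * S).
  by apply: measurable_funB => //; apply: measurable_cosT; exact: measurable_funD.
have W0b x : `|cos (U x + a) - cos a * S| <= 1 + `|cos a * S|.
  by rewrite (le_trans (ler_normB _ _))// lerD2r.
have mW : measurable_fun setT W by apply: measurable_funM => //; exact: measurable_indic.
have Wb x : `|W x| <= 1 + `|cos a * S|.
  rewrite /W indicE; case: (x \in _); rewrite ?mul1r// mul0r normr0.
  by rewrite addr_ge0.
(* The sign [sg] is 1 or -1: a product of two cosines is half the sum of the cosines of the sum and
   of the difference, and both are instances of the induction hypothesis. *)
have upd (s : R) (sg : R) al : sg ^+ 2 = 1 ->
    \int[P]_(x in cyl B m) cos (s * X m x + sg * U x + al) =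
    fine (P (cyl B m)) * (cos al * (expR (- (if v m then s ^+ 2 else 0) / 2) * S)).
  move=> sg1.
  have e k : (m < k < n)%N -> (k == m) = false.
    by move=> /andP[mk _]; rewrite gtn_eqF.
  pose t' k := if k == m then s else sg * t k.
  have sE x : \sum_(m <= k < n) t' k * X k x = s * X m x + sg * U x.
    rewrite (big_ltn (ltnW mn)) /t' eqxx; congr (_ + _).
    by rewrite /U mulr_sumr; apply: eq_big_nat => k /e ->; rewrite mulrA.
  have qE : \sum_(m <= k < n) q t' k =
      (if v m then s ^+ 2 else 0) + \sum_(m.+1 <= k < n) q t k.
    rewrite (big_ltn (ltnW mn)) /q /t' eqxx; congr (_ + _).
    by apply: eq_big_nat => k /e ->; rewrite exprMn sg1 mul1r.
  have := IH n t' al; under eq_Rintegral do rewrite sE.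
  by rewrite qE opprD mulrDl expRD.
have char0 s al : \int[P]_x (W x * cos (s * X m x + al)) = 0.
  pose c1 x := cos (s * X m x + 1 * U x + (al + a)).
  pose c2 x := cos (s * X m x + (- 1) * U x + (al - a)).
  pose c3 x := cos (s * X m x + al).
  have mc1 : measurable_fun setT c1.
    by apply: measurable_cosT; do 2!apply: measurable_funD => //; exact: measurable_funM.
  have mc2 : measurable_fun setT c2.
    by apply: measurable_cosT; do 2!apply: measurable_funD => //; exact: measurable_funM.
  have mc3 : measurable_fun setT c3.
    by apply: measurable_cosT; apply: measurable_funD => //; exact: measurable_funM.
  have i1 : P.-integrable (cyl B m) (EFin \o c1).
    by apply: (@iD _ _ 1 mE mc1) => x; exact: bcos.
  have i2 : P.-integrable (cyl B m) (EFin \o c2).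
    by apply: (@iD _ _ 1 mE mc2) => x; exact: bcos.
  have i3 : P.-integrable (cyl B m) (EFin \o c3).
    by apply: (@iD _ _ 1 mE mc3) => x; exact: bcos.
  have i12 : P.-integrable (cyl B m) (EFin \o (fun x => c1 x + c2 x)) := integrableD mE i1 i2.
  transitivity (\int[P]_(x in cyl B m) (2^-1 * (c1 x + c2 x) - cos a * S * c3 x)).
    under eq_Rintegral do rewrite /W -mulrA.
    rewrite Rintegral_indicM setTI; apply: eq_Rintegral => x _.
    rewrite mulrBl; congr (_ - _).
    rewrite /c1 /c2.
    have -> : s * X m x + 1 * U x + (al + a) = (s * X m x + al) + (U x + a) by ring.
    have -> : s * X m x + (- 1) * U x + (al - a) = (s * X m x + al) - (U x + a) by ring.
    rewrite (cosD (s * X m x + al) (U x + a)) (cosB (s * X m x + al) (U x + a)).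
    by field.
  rewrite RintegralB//; last 2 first.
  - exact: (integrableZl mE 2^-1 i12).
  - exact: (integrableZl mE (cos a * S) i3).
  rewrite (RintegralZl _ mE i12) (RintegralZl _ mE i3) (RintegralD mE i1 i2).
  rewrite /c1 /c2 (upd s 1) ?expr1n// (upd s (-1)) ?sqrrN ?expr1n//.
  have -> : \int[P]_(x in cyl B m) c3 x =
      fine (P (cyl B m)) * (cos al * expR (- (if v m then s ^+ 2 else 0) / 2)).
    have := IH m.+1 (fun=> s) al; by under eq_Rintegral do rewrite big_nat1; rewrite big_nat1.
  by rewrite cosD cosB; field.
have := Rintegral_preimage_eq0 (mX m) mW Wb char0 (mB m).
rewrite Rintegral_indicM -cylS.
rewrite RintegralB//; last 2 first.
- by apply: (@iD _ _ 1) => //; apply: measurable_cosT; exact: measurable_funD.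
- by apply: (@iD _ _ `|cos a * S|).
move/eqP; rewrite subr_eq0 => /eqP ->.
by rewrite Rintegral_cst// mulrC.
Qed.

(** The law of [X n] is read off its transform. Independence follows from [Rintegral_preimage_eq0]
    for the indicator of the past event minus its probability. *)
Lemma gaussian_independence n (B : nat -> set R) (A : set R) : v n ->
  (forall k, measurable (B k)) -> measurable A ->
  (P [set x | (forall k, (k < n)%N -> B k (X k x)) /\ A (X n x)] =
   P [set x | forall k, (k < n)%N -> B k (X k x)] * N A)%E.
Proof.
move=> vn mB mA.
have mE := mcyl n mB.
have mXn : @measurable_fun _ _ T (measurableTypeR R) setT (X n) by exact: mX.
have mAX : measurable (X n @^-1` A) by rewrite -[X in measurable X]setTI; exact: mX.
have chE C s al : (forall k, measurable (C k)) ->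
    \int[P]_(x in cyl C n) cos (s * X n x + al) =
    fine (P (cyl C n)) * (cos al * expR (- s ^+ 2 / 2)).
  move=> mC; have := cylinder_char_fun n mC n.+1 (fun=> s) al.
  by under eq_Rintegral do rewrite big_nat1; rewrite big_nat1 /q vn.
have cT : cyl (fun=> setT) n = setT by apply/seteqP; split.
have chT s al : \int[P]_x cos (s * X n x + al) = cos al * expR (- s ^+ 2 / 2).
  have := chE (fun=> setT) s al (fun=> measurableT).
  by rewrite cT probability_setT mul1r.
have mc s al : measurable_fun setT (fun x => cos (s * X n x + al)).
  by apply: measurable_cosT; apply: measurable_funD => //; exact: measurable_funM.
have XN : P (X n @^-1` A) = N A.
  apply: (@char_fun_unique R (image_prob P mXn) N) => // t a.
  have := normal_prob_char_fun 0 (oner_neq0 R) t a.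
  under eq_integral do rewrite subr0.
  rewrite expr1n mulr1 => ->.
  rewrite -chT -EFin_Rintegral//; last exact: (@iD _ _ 1).
  apply: (integral_image_prob (P := P) mXn (g := fun x => (cos (t * x + a))%:E)).
    apply/measurable_EFinP/measurable_cosT.
    by apply: measurable_funD => //; exact: measurable_funM.
  exact: (@bounded_integrable _ _ _ _ _ 1).
pose W x : R := \1_(cyl B n) x - fine (P (cyl B n)).
have mW : measurable_fun setT W by apply: measurable_funB => //; exact: measurable_indic.
have Wb x : `|W x| <= 1 + `|fine (P (cyl B n))|.
  rewrite (le_trans (ler_normB _ _))// lerD2r indicE.
  by case: (_ \in _); rewrite ?normr1 ?normr0.
have char0 s al : \int[P]_x (W x * cos (s * X n x + al)) = 0.
  rewrite (_ : (fun x => _) = (fun x => \1_(cyl B n) x * cos (s * X n x + al) -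
    fine (P (cyl B n)) * cos (s * X n x + al))); last first.
    by apply/funext => x; rewrite mulrBl.
  rewrite RintegralB//; last 2 first.
  - apply: (@bounded_integrable _ _ _ _ _ 1).
      by apply: measurable_funM => //; exact: measurable_indic.
    by move=> x; rewrite indicE; case: (_ \in _); rewrite ?mul1r// mul0r normr0.
  - have i : P.-integrable setT (EFin \o (fun x => cos (s * X n x + al))).
      exact: (@bounded_integrable _ _ _ _ _ 1).
    exact: (integrableZl measurableT (fine (P (cyl B n))) i).
  rewrite Rintegral_indicM setTI chE// RintegralZl//; last exact: (@bounded_integrable _ _ _ _ _ 1).
  by rewrite chT subrr.
have := Rintegral_preimage_eq0 mXn mW Wb char0 mA.
have i1 : P.-integrable (X n @^-1` A) (EFin \o (\1_(cyl B n) : T -> R)).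
  apply: (@iD _ _ 1) => //.
  by move=> x; rewrite indicE; case: (_ \in _); rewrite ?normr1 ?normr0.
rewrite RintegralB//; last by apply: (@iD _ _ `|fine (P (cyl B n))|).
rewrite (_ : (fun x => \1_(cyl B n) x) = (fun x => \1_(cyl B n) x * 1)); last first.
  by apply/funext => x; rewrite mulr1.
rewrite Rintegral_indicM !Rintegral_cst//; last exact: measurableI.
rewrite mul1r => /eqP; rewrite subr_eq0 => /eqP h.
rewrite -XN -(fineK (fin_num_measure P _ mAX)) -(fineK (fin_num_measure P _ mE)) -EFinM -h.
rewrite fineK; last by rewrite fin_num_measure//; exact: measurableI.
by congr (P _); apply/seteqP; split => x /= [].
Qed.

(** The cosine transforms of [X n] are those of the Dirac mass at 0. *)
Lemma gaussian_degenerate n : ~~ v n -> {ae P, forall x, X n x = 0}.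
Proof.
move=> vn.
have mXn : @measurable_fun _ _ T (measurableTypeR R) setT (X n) by exact: mX.
have cT : cyl (fun=> setT) n = setT by apply/seteqP; split.
have m0 : measurable (~` [set 0 : R]) by apply: measurableC; exact: measurable_set1.
exists (X n @^-1` ~` [set 0]); split => //.
  by rewrite -[X in measurable X]setTI; exact: mX.
have -> : P (X n @^-1` ~` [set 0]) = \d_(0 : measurableTypeR R) (~` [set 0]).
  apply: (@char_fun_unique R (image_prob P mXn) \d_(0 : measurableTypeR R)) => // t a.
  have mc : measurable_fun [set: measurableTypeR R] (fun x => (cos (t * x + a))%:E).
    apply/measurable_EFinP/measurable_cosT.
    by apply: measurable_funD => //; exact: measurable_funM.
  have mc' : measurable_fun setT (fun x => cos (t * X n x + a)).
    by apply: measurable_cosT; apply: measurable_funD => //; exact: measurable_funM.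
  rewrite (integral_image_prob (P := P) mXn mc); last exact: (@bounded_integrable _ _ _ _ _ 1).
  rewrite integral_dirac// diracT mul1e mulr0 add0r.
  rewrite EFin_Rintegral//; last exact: (@bounded_integrable _ _ _ _ _ 1).
  have := cylinder_char_fun n (fun=> measurableT) n.+1 (fun=> t) a.
  rewrite cT probability_setT mul1r big_nat1 /q (negbTE vn) oppr0 mul0r expR0 mulr1.
  by under eq_Rintegral do rewrite big_nat1; move=> ->.
by rewrite diracE memNset//; apply.
Qed.

End gaussian_independence.

(** * Separation in locally convex spaces *)

Section hahn_banach.
Context {R : realType} {V : lmodType R}.
Implicit Types (p q : V -> R) (x y z : V).

Lemma le_infD (S1 S2 : set R) (u : R) : S1 !=set0 -> S2 !=set0 ->
  (forall a b, S1 a -> S2 b -> u <= a + b) -> u <= inf S1 + inf S2.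
Proof.
move=> S10 S20 h; rewrite -lerBlDr; apply: lb_le_inf => // a S1a.
by rewrite lerBlDr -lerBlDl; apply: lb_le_inf => // b S2b; rewrite lerBlDl; exact: h.
Qed.

(** Only one half of positive homogeneity is required, which is easier to check for infima; the
    other half follows by scaling back, see [sublinearZ]. *)
Definition sublinear q :=
  (forall x y, q (x + y) <= q x + q y) /\ (forall s x, 0 < s -> q (s *: x) <= s * q x).

Lemma sublinearZ q s x : sublinear q -> 0 < s -> q (s *: x) = s * q x.
Proof.
move=> [_ qZ] s0; apply/eqP; rewrite eq_le qZ//=.
rewrite -ler_pdivlMl// (le_trans _ (qZ _ _ _)) ?invr_gt0//.
by rewrite scalerA mulVf ?scale1r// gt_eqF.
Qed.

Lemma sublinear0 q : sublinear q -> q 0 = 0.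
Proof.
move=> sq; have := sublinearZ 0 sq (ltr0n R 2); rewrite scaler0; lra.
Qed.

Lemma sublinearN q x : sublinear q -> - q (- x) <= q x.
Proof.
by move=> sq; have [qD _] := sq; have := qD x (- x); rewrite subrr sublinear0//; lra.
Qed.

Let slide_set q z y := [set q (y + t *: z) - t * q z | t in [set t | 0 <= t]].

(* A minimal sublinear functional is fixed by every slide, hence odd, hence linear. *)
Definition slide q z y := inf (slide_set q z y).

Let slide_nonempty q z y : slide_set q z y !=set0.
Proof. by exists (q (y + 0 *: z) - 0 * q z), 0 => /=. Qed.

Let slide_lb q z y : sublinear q -> lbound (slide_set q z y) (- q (- y)).
Proof.
move=> sq _ [t /= t0 <-]; have [qD _] := sq.
have tz : t * q z = q (t *: z).
  move: t0; rewrite le_eqVlt => /predU1P[<-|t0]; last by rewrite sublinearZ.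
  by rewrite mul0r scale0r sublinear0.
rewrite tz; have := qD (y + t *: z) (- y).
by rewrite addrAC subrr add0r; lra.
Qed.

Lemma slide_le_at q z y t : sublinear q -> 0 <= t ->
  slide q z y <= q (y + t *: z) - t * q z.
Proof.
move=> sq t0; apply: ge_inf; last by exists t.
by exists (- q (- y)); exact: slide_lb.
Qed.

Lemma slide_le q z y : sublinear q -> slide q z y <= q y.
Proof.
by move=> sq; have := slide_le_at z y sq (lexx 0); rewrite scale0r addr0 mul0r subr0.
Qed.

Lemma slideN q z : sublinear q -> slide q z (- z) <= - q z.
Proof.
move=> sq; have := slide_le_at z (- z) sq ler01.
by rewrite scale1r addNr sublinear0// mul1r sub0r.
Qed.

Lemma sublinear_slide q z : sublinear q -> sublinear (slide q z).
Proof.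
move=> sq; have [qD qZ] := sq; split.
- move=> x y; apply: le_infD => // _ _ [t1 /= t10 <-] [t2 /= t20 <-].
  apply: (le_trans (slide_le_at z (x + y) sq (addr_ge0 t10 t20))).
  rewrite scalerDl addrACA mulrDl.
  have := qD (x + t1 *: z) (y + t2 *: z); lra.
- move=> s x s0; rewrite -ler_pdivrMl//; apply: lb_le_inf => // _ [t /= t0 <-].
  rewrite ler_pdivrMl//; apply: (le_trans (slide_le_at z _ sq (mulr_ge0 (ltW s0) t0))).
  by rewrite -scalerA -scalerDr sublinearZ// mulrBr mulrA.
Qed.

(** Zorn's lemma for the reversed pointwise order: a chain is bounded by its pointwise infimum,
    which is finite because every member is at least [- p (- x)] at x. *)
Lemma minimal_sublinear p : sublinear p -> exists q,
  [/\ sublinear q, forall x, q x <= p x &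
      forall q', sublinear q' -> (forall x, q' x <= q x) -> forall x, q' x = q x].
Proof.
move=> sp.
pose Q := {q : V -> R | sublinear q /\ (forall x, q x <= p x)}.
pose r (q q' : Q) := `[< forall x, sval q' x <= sval q x >].
have [| | | |q qmin] := @Zorn Q r.
- by move=> q; apply/asboolP.
- move=> q1 q2 q3 /asboolP h1 /asboolP h2; apply/asboolP => x.
  exact: le_trans (h2 x) (h1 x).
- move=> [q1 h1] [q2 h2] /asboolP/= h12 /asboolP/= h21.
  by apply: eq_exist => /=; apply/funext => x; apply/eqP; rewrite eq_le h21 h12.
- move=> A Atot.
  have [A0|A0] := pselect (A !=set0); last first.
    exists (exist _ p (conj sp (fun x => lexx (p x)))) => q Aq.
    by exfalso; apply: A0; exists q.
  pose S x := [set sval q x | q in A].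
  have S0 x : S x !=set0 by case: A0 => q Aq; exists (sval q x), q.
  have Slb x : lbound (S x) (- p (- x)).
    move=> _ [q Aq <-]; have [sq qp] := svalP q.
    by apply: le_trans (sublinearN x sq); rewrite lerN2.
  pose g x := inf (S x).
  have gle (q : Q) x : A q -> g x <= sval q x.
    by move=> Aq; apply: ge_inf; [exists (- p (- x)); exact: Slb|exists q].
  have sg : sublinear g.
    split.
      (* Two members of a chain are comparable, and the smaller one bounds the infimum at [x + y] by
         the sum of both values. *)
      move=> x y; apply: le_infD => // _ _ [q1 Aq1 <-] [q2 Aq2 <-].
      have [/asboolP h|/asboolP h] := Atot _ _ Aq1 Aq2.
        apply: (le_trans (gle _ _ Aq2)); have [[qD _] _] := svalP q2.
        by rewrite (le_trans (qD _ _))// lerD2r.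
      apply: (le_trans (gle _ _ Aq1)); have [[qD _] _] := svalP q1.
      by rewrite (le_trans (qD _ _))// lerD2l.
    move=> s x s0; rewrite -ler_pdivrMl//; apply: lb_le_inf => // _ [q Aq <-].
    rewrite ler_pdivrMl//; apply: (le_trans (gle _ _ Aq)).
    by have [[_ qZ] _] := svalP q; exact: qZ.
  have gp x : g x <= p x.
    by case: A0 => q Aq; apply: (le_trans (gle _ _ Aq)); have [_] := svalP q.
  by exists (exist _ g (conj sg gp)) => q Aq; apply/asboolP => x /=; exact: gle.
exists (sval q); have [sq qp] := svalP q; split => // q' sq' q'q.
have q'p x : q' x <= p x by exact: le_trans (q'q x) (qp x).
move=> x; rewrite -(qmin (exist _ q' (conj sq' q'p)))//.
by apply/asboolP.
Qed.

(** Minimizing below [slide p x0] instead of [p] forces [q (- x0) <= - p x0], which becomes equality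
    at [x0] once [q] is odd. *)
Theorem hahn_banach p x0 : sublinear p ->
  exists l : {linear V -> R^o}, (forall x, (l x : R) <= p x) /\ l x0 = p x0.
Proof.
move=> sp.
have [q [sq qp qmin]] := minimal_sublinear (sublinear_slide x0 sp).
have qN z : q (- z) = - q z.
  apply/eqP; rewrite eq_le; apply/andP; split; last first.
    by have := sublinearN z sq; lra.
  rewrite -(qmin _ (sublinear_slide z sq)) ?slideN// => x.
  exact: slide_le.
have [qD _] := sq.
have qadd x y : q (x + y) = q x + q y.
  apply/eqP; rewrite eq_le qD/=.
  by have := qD (- x) (- y); rewrite -opprD !qN; lra.
have qlin : GRing.linear_for (GRing.scale : R -> R^o -> R^o) (q : V -> R^o).
  move=> a x y; rewrite qadd; congr (_ + _).
  have [a0|a0|<-] := ltgtP 0 a; last by rewrite !scale0r sublinear0.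
    by rewrite sublinearZ.
  rewrite -[a]opprK scaleNr qN sublinearZ ?oppr_gt0//.
  by rewrite scaleNr.
pose L : {linear V -> R^o} := HB.pack (q : V -> R^o) (GRing.isLinear.Build _ _ _ _ _ qlin).
exists L; have LE x : L x = q x by [].
split => [x|]; first by rewrite LE (le_trans (qp x))// slide_le.
apply/eqP; rewrite LE eq_le (le_trans (qp _)) ?slide_le//=.
by rewrite -lerN2 -qN (le_trans (qp _))// slideN.
Qed.

End hahn_banach.

Section separation.
Context {R : realType} {F : tvsType R}.

Lemma convex_nbhs0 (W : set F) : nbhs 0 W -> exists U : set F,
  [/\ open U, U 0, U `<=` W &
      forall x y (k : R), 0 <= k <= 1 -> U x -> U y -> U (k *: x + (1 - k) *: y)].
Proof.
move=> W0; have [B Bconv [Bop Bbasis]] := @locally_convex R F.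
have [U [BU U0] UW] := Bbasis 0 W W0.
exists U; split => //; first exact: Bop.
move=> x y k /andP[k0 k1] Ux Uy.
have := Bconv U (mem_set BU) x y (Itv01 k0 k1) (mem_set Ux) (mem_set Uy).
by rewrite inE.
Qed.

Lemma absorbing_nbhs0 (U : set F) (x : F) : nbhs 0 U ->
  exists2 t : R, 0 < t & U (t *: x).
Proof.
move=> U0.
have U0' : nbhs (((0 : R^o), x).1 *: ((0 : R^o), x).2) U by rewrite /= scale0r.
have [/= A [A1 A2] AU] := @scale_continuous R F ((0 : R^o), x) U U0'.
move: A1 => /nbhs_ballP[e /= e0 eA].
exists (e / 2); first by rewrite divr_gt0.
apply: (AU (e / 2, x)); split => /=; last exact: nbhs_singleton.
by apply: eA; rewrite /ball/= sub0r normrN gtr0_norm ?divr_gt0//; lra.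
Qed.

(** Hahn-Banach for the gauge of a convex open neighbourhood [U] inside [W]. The gauge is at least 1
    at [x0], which lies outside [U], and at most 1 on [U], which bounds the functional near 0 and
    makes it continuous. *)
Lemma separating_functional (x0 : F) (W : set F) : nbhs 0 W -> ~ W x0 ->
  exists l : {linear F -> R^o}, continuous_dual F l /\ l x0 != 0.
Proof.
move=> W0 Wx0; have [U [Uop U0 UW Uconv]] := convex_nbhs0 W0.
have nU : nbhs 0 U by exact: open_nbhs_nbhs.
pose S x := [set t : R | 0 < t /\ U (t^-1 *: x)].
have S0 x : S x !=set0.
  have [t t0 Ut] := absorbing_nbhs0 x nU.
  by exists t^-1; rewrite /S/= invrK invr_gt0.
have Slb x : lbound (S x) 0 by move=> t [/ltW].
pose p x := inf (S x).
have ple x t : S x t -> p x <= t by move=> St; apply: ge_inf => //; exists 0.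
have sp : sublinear p.
  split.
    move=> x y; apply: le_infD => // s t [s0 Us] [t0 Ut]; apply: ple; split.
      by rewrite addr_gt0.
    have st0 : 0 < s + t by rewrite addr_gt0.
    have k01 : 0 <= s / (s + t) <= 1.
      apply/andP; split; first by rewrite divr_ge0 ?ltW.
      by rewrite ler_pdivrMr// mul1r lerDl ltW.
    have := Uconv _ _ _ k01 Us Ut.
    rewrite !scalerA.
    have -> : s / (s + t) * s^-1 = (s + t)^-1 by field; rewrite !gt_eqF.
    have -> : (1 - s / (s + t)) * t^-1 = (s + t)^-1 by field; rewrite !gt_eqF.
    by rewrite -scalerDr.
  move=> s x s0; rewrite -ler_pdivrMl//; apply: lb_le_inf => // t [t0 Ut].
  rewrite ler_pdivrMl//; apply: ple; split; first by rewrite mulr_gt0.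
  by rewrite scalerA invfM mulrC mulrA divff ?mul1r// gt_eqF.
have [l [lp lx0]] := hahn_banach x0 sp.
exists l; split; last first.
  rewrite gt_eqF// (lt_le_trans ltr01)// lx0.
  apply: lb_le_inf => // t [t0 Ut]; rewrite leNgt; apply/negP => t1.
  apply/Wx0/UW.
  have t01 : 0 <= t <= 1 by rewrite !ltW.
  have := Uconv _ _ _ t01 Ut U0.
  by rewrite scaler0 addr0 scalerA divff ?scale1r// gt_eqF.
have lU x : U x -> (l x : R) <= 1.
  by move=> Ux; apply: (le_trans (lp x)); apply: ple; split => //; rewrite invr1 scale1r.
have cont0 (e : R) : 0 < e -> \forall x \near (0 : F), `|l x : R| < e.
  move=> e0.
  have c1 (s : R) (A : set F) : nbhs 0 A -> \forall x \near (0 : F), A (s *: x).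
    move=> nA; have nA' : nbhs (((s : R^o), 0 : F).1 *: ((s : R^o), 0 : F).2) A.
      by rewrite /= scaler0.
    have [/= B [B1 B2] BA] := @scale_continuous R F ((s : R^o), 0 : F) A nA'.
    apply: filterS B2 => x B2x; apply: (BA (s, x)); split => //=.
    exact: nbhs_singleton.
  (* The bound 1 on [U] at both multiples [2 / e] and [- (2 / e)] of x gives [|l x| <= e / 2]. *)
  have h1 := c1 (2 / e) U nU; have h2 := c1 (- (2 / e)) U nU.
  near=> x.
  have Ux1 : U (2 / e *: x) by near: x.
  have Ux2 : U (- (2 / e) *: x) by near: x.
  have := lU _ Ux1; have := lU _ Ux2; rewrite !linearZ/= /GRing.scale/=.
  move=> k1 k2; have -> : (l x : R) = e * (e^-1 * l x) by rewrite mulrA divff ?mul1r// gt_eqF.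
  set a := e^-1 * _.
  have a1 : `|a| <= 1 / 2 by rewrite ler_norml /a; apply/andP; split; lra.
  rewrite normrM gtr0_norm// -[ltRHS]mulr1 ltr_pM2l//; lra.
move=> x; apply/cvgrPdist_lt => e e0.
have W0' : nbhs ((x, - x).1 + (x, - x).2) [set z : F | `|l z : R| < e].
  by rewrite /= subrr; exact: cont0.
have [/= B [B1 B2] BW] := @add_continuous F (x, - x) _ W0'.
have B2' : nbhs x (-%R @^-1` B.2) := @opp_continuous F x _ B2.
rewrite /prop_near1; apply: (filterS _ B2') => y /= B2y; rewrite -linearB.
by apply: (BW (x, - y)); split => //=; exact: nbhs_singleton.
Unshelve. all: by end_near. Qed.

End separation.

Lemma invS_lt (R : realType) (e : R) : 0 < e ->
  exists M : nat, forall m, (M <= m)%N -> m.+1%:R^-1 < e.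
Proof.
move=> e0; exists (Num.bound e^-1) => m Mm; rewrite invf_plt ?posrE//.
apply: (lt_le_trans (archi_boundP _)); first by rewrite invr_ge0 ltW.
by rewrite ler_nat leqW.
Qed.

(** * Tightness and measurable inverses *)

Section metric.
Context {R : realType} {F : tvsType R}.
Variable dist : F -> F -> R.
Hypothesis distP : is_metric dist.
Hypothesis distT : metric_induces_topology dist.
Hypothesis distC : metric_complete dist.

Let distxx x : dist x x = 0. Proof. by case: distP => _ h _ _; apply/h. Qed.
Let dist_sym x y : dist x y = dist y x. Proof. by case: distP. Qed.
Let dist_tri y x z : dist x z <= dist x y + dist y z. Proof. by case: distP. Qed.

Lemma open_dist_ball x e : open [set y : F | dist x y < e].
Proof.
rewrite openE => y /= xy; apply/distT; exists (e - dist x y); first by rewrite subr_gt0.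
by move=> z /= yz; have := dist_tri y x z; lra.
Qed.

Lemma closed_dist_ball x e : closed [set y : F | dist x y <= e].
Proof.
rewrite -[X in closed X]setCK; apply: open_closedC.
rewrite openE => y /= /negP; rewrite -ltNge => xy.
apply/distT; exists (dist x y - e); first by rewrite subr_gt0.
move=> z /= yz; apply/negP; rewrite -ltNge.
by have := dist_tri z x y; rewrite (dist_sym z y); lra.
Qed.

Lemma dist_dense_sequence : separable F ->
  exists u : nat -> F, forall x e, 0 < e -> exists n, dist x (u n) < e.
Proof.
move=> [D /pcard_leP[f] Ddense].
exists (fun n => xget (0 : F) [set x | D x /\ f x = n]) => x e e0.
have [y [/= xy Dy]] : [set y : F | dist x y < e] `&` D !=set0.
  by apply: Ddense; [exists x; rewrite /= distxx|exact: open_dist_ball].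
exists (f y); case: xgetP => [z -> [Dz fzy]|/(_ y)]; last by case.
by rewrite (inj _ _ fzy) // inE.
Qed.

Lemma measurable_borel_closed (A : set F) : closed A -> measurable (A : set (borel F)).
Proof.
move=> cA; rewrite -[A]setCK; apply: measurableC; apply: sub_sigma_algebra.
exact: closed_openC.
Qed.

Lemma continuous_measurable_borel (f : F -> R) : continuous f ->
  measurable_fun [set: borel F] (f : borel F -> R).
Proof.
move=> cf; apply: (@measurability _ _ (borel F) (measurableTypeR R) setT f (@RGenOpens.G R)).
  exact: RGenOpens.measurableE.
move=> _ [_ [a [b ->]] <-]; rewrite setTI; apply: sub_sigma_algebra.
have /continuousP := cf; apply; exact: interval_open.
Qed.

Section with_dense_sequence.
Variable u : nat -> F.
Hypothesis uP : forall x e, 0 < e -> exists n, dist x (u n) < e.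

(** For each center, radius and rational r pick, if there is one, a member exceeding r on the whole
    ball. By continuity any value above q at x is witnessed by such a ball around x with some r > q,
    so the picked members have the same pointwise supremum. *)
Lemma countable_subfamily (I : Type) (S : set I) (ev : I -> F -> R) :
  S !=set0 -> (forall i, S i -> continuous (ev i)) ->
  exists s : nat -> I, (forall n, S (s n)) /\
    forall x q, (exists2 i, S i & q < ev i x) -> exists n, q < ev (s n) x.
Proof.
move=> [i0 Si0] Sc.
pose P (c : nat * nat * rat) i := S i /\
  forall y, dist (u c.1.1) y < c.1.2.+1%:R^-1 -> ratr c.2 < ev i y.
pose pk c := if pselect (exists i, P c i) is left h then projT1 (cid h) else i0.
have pkS c : S (pk c).
  by rewrite /pk; case: pselect => // h; case: cid => i /= [].
have pkP c i : P c i -> P c (pk c).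
  move=> Pci; rewrite /pk; case: pselect => [h|]; first by case: cid.
  by move=> []; exists i.
exists (fun n => pk (odflt (0%N, 0%N, 0 : rat) (unpickle n))); split => // x q [i Si qi].
have [r] := rat_in_itvoo qi; rewrite in_itv/= => /andP[qr ri].
have : nbhs x [set y | ratr r < ev i y].
  by have /cvgr_gt/(_ _ ri) := Sc i Si x.
move=> /distT[e e0 eB].
have [m me] : exists m : nat, m.+1%:R^-1 < e / 2.
  have [M /(_ M (leqnn _))] := invS_lt (divr_gt0 e0 (ltr0n R 2)).
  by exists M.
have m0 : 0 < m.+1%:R^-1 :> R by rewrite invr_gt0.
have [d xd] := uP x m0.
have Pi : P (d, m, r) i.
  split => // y /= dy; apply: eB => /=.
  move: (dist_tri (u d) x y) me xd dy; move: (m.+1%:R^-1) => w; lra.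
exists (pickle (d, m, r)); rewrite pickleK /=.
apply: (lt_trans qr); have [_] := pkP _ _ Pi; apply => /=.
by rewrite dist_sym.
Qed.

Let ballU (m N : nat) := [set x : F | exists2 i, (i < N)%N & dist (u i) x <= m.+1%:R^-1].

Let ballUE m N : ballU m N = \big[setU/set0]_(i < N) [set x : F | dist (u i) x <= m.+1%:R^-1].
Proof.
apply/seteqP; split => [x [i iN xi]|x].
  by rewrite -(bigcup_mkord N (fun i => [set y : F | dist (u i) y <= m.+1%:R^-1])); exists i.
rewrite -(bigcup_mkord N (fun i => [set y : F | dist (u i) y <= m.+1%:R^-1])).
by move=> [i /= iN xi]; exists i.
Qed.

Let closed_ballU m N : closed (ballU m N).
Proof. by rewrite ballUE; apply: closed_bigsetU => i _; exact: closed_dist_ball. Qed.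

(** Total boundedness and completeness: an ultrafilter on the set selects one ball of each radius,
    selected balls meet pairwise, so their centers form a Cauchy sequence, to whose limit the
    ultrafilter converges. *)
Lemma compact_ballU (N : nat -> nat) : compact (\bigcap_m ballU m (N m)).
Proof.
rewrite compact_ultra => U FU UK.
have UB m : exists i, U [set x : F | dist (u i) x <= m.+1%:R^-1].
  have : U (ballU m (N m)) by apply: filterS UK => x; exact.
  elim: (N m) => [|n IH] Un.
    by have [x []] := filter_ex Un.
  have [h|h] := in_ultra_setVsetC [set x : F | dist (u n) x <= m.+1%:R^-1] FU.
    by exists n.
  apply: IH; apply: filterS (filterI Un h) => x [[i]].
  by rewrite ltnS leq_eqVlt => /predU1P[->//|iN xi] _; exists i.
pose c m := projT1 (cid (UB m)).
have cP m : U [set x : F | dist (u (c m)) x <= m.+1%:R^-1] by rewrite /c; case: cid.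
pose v m := u (c m).
have vd m n : dist (v m) (v n) <= m.+1%:R^-1 + n.+1%:R^-1.
  have [x [/= xm xn]] := filter_ex (filterI (cP m) (cP n)).
  rewrite (le_trans (dist_tri x _ _))// lerD//.
  by rewrite dist_sym.
have [x vx] : exists x : F, v @ \oo --> x.
  apply: distC => e e0; have [M hM] := invS_lt (divr_gt0 e0 (ltr0n R 2)).
  exists M => m n Mm Mn; move: (vd m n) (hM m Mm) (hM n Mn).
  by move: (m.+1%:R^-1) (n.+1%:R^-1) => w1 w2; lra.
have Ux : U --> x.
  move=> W /distT[e e0 eW].
  have e3 : 0 < e / 2 by rewrite divr_gt0.
  have [M hM] := invS_lt e3.
  have : nbhs x [set y | dist x y < e / 2] by apply/distT; exists (e / 2).
  move=> /vx [M2 _ hM2].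
  pose m := maxn M M2.
  have h1 := hM m (leq_maxl _ _).
  have /= h2 := hM2 m (leq_maxr _ _).
  apply: filterS (cP m) => y /= my; apply: eW => /=.
  move: (dist_tri (v m) x y) my h1 h2; rewrite -/(v m).
  by move: (m.+1%:R^-1) => w; lra.
exists x; split => //.
have cK : closed (\bigcap_m ballU m (N m)).
  by apply: closed_bigI => m _; exact: closed_ballU.
apply: cK => B /Ux UB'; exact: filter_ex (filterI UK UB').
Qed.

(** By density, finitely many balls of radius 1 / (m + 1) miss mass at most e / 2^(m + 1). Their
    intersection over m is compact and misses at most e. *)
Lemma ulam (mu : probability (borel F) R) : exists K : nat -> set F,
  (forall n, compact (K n) /\ closed (K n)) /\ mu (~` \bigcup_n K n) = 0%E.
Proof.
have mB m N : measurable (ballU m N : set (borel F)).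
  by apply: measurable_borel_closed; exact: closed_ballU.
have small m (e : R) : 0 < e -> exists N, (mu (~` ballU m N) <= e%:E)%E.
  move=> e0.
  have : mu (~` ballU m N) @[N --> \oo] --> mu (\bigcap_N ~` ballU m N).
    apply: (@nonincreasing_cvg_mu _ (borel F) R mu (fun N => ~` ballU m N)).
    - by rewrite -ge0_fin_numE// fin_num_measure//; exact: measurableC.
    - by move=> N; exact: measurableC.
    - by apply: bigcapT_measurable => N; exact: measurableC.
    - move=> N1 N2 N12; apply/subsetPset => x /= h [i iN xi]; apply: h.
      by exists i => //; exact: leq_trans iN N12.
  rewrite (_ : \bigcap_N _ = set0); last first.
    apply/seteqP; split => // x /= h.
    have m0 : 0 < m.+1%:R^-1 :> R by rewrite invr_gt0.
    have [i xi] := uP x m0.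
    by apply: (h i.+1 Logic.I); exists i => //; rewrite dist_sym ltW.
  rewrite measure0 => /fine_cvgP[fin /cvgr_le/(_ e e0) le].
  have [N [fN lN]] := filter_ex (filterI fin le).
  by exists N; rewrite -(fineK fN) lee_fin.
have big n : exists K : set F, [/\ compact K, closed K & (mu (~` K) <= (n.+1%:R^-1)%:E)%E].
  pose e : R := n.+1%:R^-1.
  have e0 m : 0 < e / (2 ^ m.+1)%:R by rewrite divr_gt0 ?invr_gt0// ltr0n expn_gt0.
  pose N m := projT1 (cid (small m _ (e0 m))).
  have NP m : (mu (~` ballU m (N m)) <= (e / (2 ^ m.+1)%:R)%:E)%E by rewrite /N; case: cid.
  have cK : closed (\bigcap_m ballU m (N m)).
    by apply: closed_bigI => m _; exact: closed_ballU.
  exists (\bigcap_m ballU m (N m)); split => //; first exact: compact_ballU.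
  rewrite setC_bigcap; apply: (le_trans (generalized_Boole_inequality _ _ _)).
  - by move=> m; exact: measurableC.
  - by apply: bigcupT_measurable => m; exact: measurableC.
  apply: (@le_trans _ _ (\sum_(m <oo) (e / (2 ^ m.+1)%:R)%:E)%E).
    by apply: lee_nneseries => // m _; exact: NP.
  by apply: epsilon_trick0; rewrite invr_ge0.
pose K n := projT1 (cid (big n)).
have KP n : [/\ compact (K n), closed (K n) & (mu (~` K n) <= (n.+1%:R^-1)%:E)%E].
  by rewrite /K; case: cid.
exists K; split; first by move=> n; case: (KP n).
have mU : measurable (~` (\bigcup_n K n) : set (borel F)).
  by apply: measurableC; apply: bigcupT_measurable => n; apply: measurable_borel_closed; case: (KP n).
apply/eqP; rewrite eq_le measure_ge0 andbT.
apply/lee_addgt0Pr => e e0; rewrite add0e.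
have [M /(_ M (leqnn _)) hM] := invS_lt e0.
have [_ cKM muM] := KP M.
apply: (@le_trans _ _ (mu (~` K M))).
  apply: le_measure; rewrite ?inE//.
    by apply: measurableC; exact: measurable_borel_closed.
  by apply: subsetC => x Kx; exists M.
by rewrite (le_trans muM)// lee_fin ltW.
Qed.

End with_dense_sequence.

(** * Measurable inverse of the coordinates on a countable union of compact sets *)

Section measurable_inverse.
Variable X : nat -> F -> R.
Hypothesis cX : forall n, continuous (X n).

Let coords (x : F) : seqR R := fun n => X n x.

(** A sequence q is in the image when, for every n, some rational vector is within 1 / (n + 1), on
    the first n coordinates, of both q and some point of [K]. These points of [K] have a cluster
    point by compactness, and its coordinates are q. *)
Lemma measurable_image_compact (K : set F) : compact K ->
  measurable (coords @` K).
Proof.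
move=> cK.
pose E n (s : seq rat) : set (seqR R) :=
  if `[< exists2 x, K x & forall k, (k < n)%N -> `|X k x - ratr (nth 0 s k)| < n.+1%:R^-1 >]
  then [set q | forall k, (k < n)%N -> `|q k - ratr (nth 0 s k)| < n.+1%:R^-1] else set0.
have mE n s : measurable (E n s).
  rewrite /E; case: ifP => // _.
  rewrite (_ : [set q | _] = \bigcap_(k in [set k | (k < n)%N])
    [set q : seqR R | `|q k - ratr (nth 0 s k)| < n.+1%:R^-1]); last first.
    by apply/seteqP; split => q /= h k /h.
  apply: bigcap_measurableType => k _.
  have : measurable_fun setT (fun q : seqR R => `|q k - ratr (nth 0 s k)| < n.+1%:R^-1).
    apply: measurable_fun_ltr => //; apply: measurableT_comp => //.
    by apply: measurable_funB => //; exact: measurable_coord.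
  by move=> /(_ measurableT [set true]); rewrite setTI; apply.
rewrite (_ : coords @` K = \bigcap_n \bigcup_j E n (odflt [::] (unpickle j))).
  by apply: bigcapT_measurable => n; exact: bigcupT_measurable.
apply/seteqP; split => [_ [x Kx <-] n _|q h].
  have n0 : 0 < n.+1%:R^-1 :> R by rewrite invr_gt0.
  have near_rat (y : R) : exists r : rat, `|y - ratr r| < n.+1%:R^-1.
    have [r] := @rat_in_itvoo R y (y + n.+1%:R^-1) ltac:(by rewrite ltrDl).
    rewrite in_itv/= => /andP[r1 r2]; exists r.
    rewrite ltr_norml ltrBrDr addrC ltrBlDr r2/= ltrBlDr.
    by rewrite (lt_trans r1)// ltrDr.
  pose r k := projT1 (cid (near_rat (X k x))).
  have rP k : `|X k x - ratr (r k)| < n.+1%:R^-1 by rewrite /r; case: cid.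
  exists (pickle (mkseq r n)) => //; rewrite pickleK /= /E.
  have sP k : (k < n)%N -> `|X k x - ratr (nth 0 (mkseq r n) k)| < n.+1%:R^-1.
    by move=> kn; rewrite nth_mkseq.
  by case: ifPn => [_ //|/asboolP[]]; exists x.
have h' n : exists x, K x /\ forall k, (k < n)%N -> `|X k x - q k| < 2 * n.+1%:R^-1.
  have [j _] := h n Logic.I; rewrite /E; case: ifPn => // /asboolP[x Kx xk] qk.
  exists x; split => // k kn; have := xk k kn; have := qk k kn.
  move: (n.+1%:R^-1) => w; set r := ratr _; rewrite !ltr_norml => /andP[? ?] /andP[? ?].
  by apply/andP; split; lra.
pose x n := projT1 (cid (h' n)).
have xP n : K (x n) /\ forall k, (k < n)%N -> `|X k (x n) - q k| < 2 * n.+1%:R^-1.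
  by rewrite /x; case: cid.
have [y [Ky ycl]] : K `&` cluster (x @ \oo) !=set0.
  by apply: cK; exists 0%N => // n _; case: (xP n).
exists y => //; apply/funext => k; rewrite /coords.
apply/eqP; rewrite -subr_eq0 -normr_eq0 eq_le normr_ge0 andbT.
apply/ler_addgt0Pr => e e0; rewrite add0r.
have e2 : 0 < e / 2 by rewrite divr_gt0.
have nb : nbhs y [set z | `|X k y - X k z| < e / 2].
  by have /cvgrPdist_lt/(_ _ e2) := @cX k y.
have [M hM] : exists M : nat, 2 * M.+1%:R^-1 < e / 2.
  have e4 : 0 < e / 4 by rewrite divr_gt0.
  have [M /(_ M (leqnn _)) b] := invS_lt e4.
  by exists M; move: (M.+1%:R^-1) b => w b; lra.
have tl : (x @ \oo) [set z | `|X k z - q k| < e / 2].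
  exists (maxn M k.+1) => // n /=; rewrite geq_max => /andP[Mn kn].
  have [_ /(_ k kn)] := xP n; move/lt_trans; apply.
  apply: le_lt_trans hM; rewrite ler_pM2l// lef_pV2 ?posrE// ler_nat.
  by [].
have [z [/= z1 z2]] := ycl _ _ tl nb.
have := ler_distD (X k z) (X k y) (q k); lra.
Qed.

Hypothesis injX : forall x y, (forall n, X n x = X n y) -> x = y.

Lemma measurable_inverse (K : nat -> set F) :
  (forall n, compact (K n) /\ closed (K n)) ->
  exists g : seqR R -> borel F, measurable_fun setT g /\
    forall x, (\bigcup_n K n) x -> g (coords x) = x.
Proof.
move=> KP; pose S := \bigcup_n K n.
have Sinj x y : coords x = coords y -> x = y.
  by move=> xy; apply: injX => n; have := congr1 (fun q => q n) xy.
pose g (q : seqR R) : borel F := xget (0 : F) [set x | S x /\ coords x = q].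
have gE x : S x -> g (coords x) = x.
  move=> Sx; rewrite /g; case: xgetP => [y _ [Sy /Sinj ->//]|/(_ x)].
  by case.
have mS (C : set F) : closed C -> measurable (coords @` (S `&` C)).
  move=> cC; rewrite (_ : S `&` C = \bigcup_n (K n `&` C)); last by rewrite -setI_bigcupl.
  rewrite image_bigcup; apply: bigcupT_measurable => n.
  by apply: measurable_image_compact; apply: compact_closedI => //; case: (KP n).
exists g; split => //.
apply: (@measurability _ _ (seqR R) (borel F) setT g (@open F)) => //.
move=> _ [C oC <-]; rewrite setTI.
have mcase : measurable (g @^-1` ~` C).
  have cC : closed (~` C) by exact: open_closedC.
  (* Sequences outside the image are sent to the default 0, so they join the preimage exactly when 0
     belongs to the closed set. *)
  have E : g @^-1` (~` C) = coords @` (S `&` ~` C) `|`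
      (if `[< C (0 : F) >] then set0 else ~` (coords @` (S `&` setT))).
    apply/seteqP; split => q /=.
      move=> Cq; have [[x [Sx xq]]|nS] := pselect (exists x, S x /\ coords x = q).
        left; exists x => //; split => //; by rewrite -(gE x Sx) xq.
      right; have g0 : g q = (0 : F).
        by rewrite /g; case: xgetP => // x _ [Sx xq]; exfalso; apply: nS; exists x.
      case: asboolP => [C0|_]; first by apply: Cq; rewrite g0.
      by move=> [x [Sx _] xq]; apply: nS; exists x.
    move=> [[x [Sx Cx] <-]|]; first by rewrite gE.
    case: asboolP => // C0 nS; rewrite /g; case: xgetP => [x _ [Sx xq]|//].
    by exfalso; apply: nS; exists x.
  rewrite E; apply: measurableU; first exact: mS.
  case: ifP => // _; apply: measurableC; apply: mS; exact: closedT.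
by rewrite -[C]setCK preimage_setC; exact: measurableC.
Qed.

End measurable_inverse.

End metric.

Lemma affine_ge0_eq0 (R : realType) (u v : R) :
  (forall t, 0 <= u + 2 * t * v) -> v = 0.
Proof.
move=> h; apply/eqP/negP => v0.
(* At this t the affine function takes the value -1. *)
have := h (- (u + 1) / (2 * v)).
suff -> : 2 * (- (u + 1) / (2 * v)) * v = - (u + 1) by lra.
by field; apply/negP.
Qed.

(** * Gram-Schmidt for Gaussian functionals *)

Section gaussian_functionals.
Context {R : realType} {F : tvsType R} (gamma : probability (borel F) R).
Hypothesis ggamma : gaussian_measure gamma.

(** A predicate on plain functions, so that sums and Gram-Schmidt residuals need not be packed as
    linear maps. *)
Definition linear_functional (f : F -> R) :=
  continuous f /\ forall a x y, f (a *: x + y) = a * f x + f y.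

Lemma linear_functional_dual f : linear_functional f ->
  exists2 l : {linear F -> R^o}, continuous_dual F l & forall x, l x = f x.
Proof.
move=> [cf flin].
have flin' : GRing.linear_for (GRing.scale : R -> R^o -> R^o) (f : F -> R^o).
  by move=> a x y; rewrite flin.
pose L : {linear F -> R^o} := HB.pack (f : F -> R^o) (GRing.isLinear.Build _ _ _ _ _ flin').
by exists L.
Qed.

Lemma dual_linear_functional (l : {linear F -> R^o}) : continuous_dual F l ->
  linear_functional (fun x => l x : R).
Proof. by move=> cl; split => // a x y; rewrite linearP. Qed.

Lemma linear_functional0 : linear_functional (fun=> 0).
Proof.
split=> [x|a x y]; first exact: cvg_cst.
by rewrite mulr0 addr0.
Qed.

Lemma linear_functionalDZ (c : R) f g : linear_functional f -> linear_functional g ->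
  linear_functional (fun x => f x + c * g x).
Proof.
move=> [cf fl] [cg gl]; split => [x|a x y].
  by apply: cvgD; [exact: cf|apply: cvgM; [exact: cvg_cst|exact: cg]].
by rewrite fl gl; ring.
Qed.

Lemma linear_functionalB f x y : linear_functional f -> f (x - y) = f x - f y.
Proof.
move=> [_ fl]; have := fl (- 1) y x.
by rewrite scaleN1r mulN1r (addrC (- y)) (addrC (- f y)).
Qed.

Lemma linear_functional_sum n (c : nat -> R) (f : nat -> F -> R) :
  (forall k, (k < n)%N -> linear_functional (f k)) ->
  linear_functional (fun x => \sum_(0 <= k < n) c k * f k x).
Proof.
elim: n => [_|n IH h].
  rewrite (_ : (fun x => _) = fun=> 0); first exact: linear_functional0.
  by apply/funext => x; rewrite big_geq.
rewrite (_ : (fun x => _) = fun x => \sum_(0 <= k < n) c k * f k x + c n * f n x); last first.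
  by apply/funext => x; rewrite big_nat_recr.
apply: linear_functionalDZ; last exact: h.
by apply: IH => k kn; apply: h; rewrite ltnS ltnW.
Qed.

Definition mean (f : F -> R) : R := \int[gamma]_x f x.

Definition cov (f g : F -> R) : R := \int[gamma]_x ((f x - mean f) * (g x - mean g)).

Lemma measurable_linear_functional f : linear_functional f ->
  measurable_fun [set: borel F] (f : borel F -> R).
Proof. by move=> [cf _]; exact: continuous_measurable_borel. Qed.

(** Everything is computed on the law of [f], Dirac or normal; its parameters are then recognized as
    the mean and the variance, so both cases end in one formula. *)
Lemma gaussian_functional f : linear_functional f ->
  [/\ gamma.-integrable setT (EFin \o (f : borel F -> R)),
      gamma.-integrable setT (EFin \o ((fun x => f x ^+ 2) : borel F -> R)) &
      forall a, \int[gamma]_x cos (f x + a) = cos (mean f + a) * expR (- cov f f / 2)].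
Proof.
move=> lf; have mf := measurable_linear_functional lf.
have [l cl lE] := linear_functional_dual lf.
have [m [s [s0 law]]] := ggamma cl.
have lfE : (l : borel F -> R) = f by apply/funext => x; rewrite lE.
rewrite {}lfE in law.
have mf' : @measurable_fun _ _ (borel F) (measurableTypeR R) setT f by exact: mf.
have mcos (t a : R) : measurable_fun [set: measurableTypeR R] (fun x => cos (t * x + a)).
  by apply: measurable_cosT; apply: measurable_funD => //; exact: measurable_funM.
have bcos (x : R) : `|cos x| <= 1 by rewrite ler_norml cos_geN1 cos_le1.
have [Iv Im Ic] : [/\
   (\int[image_prob gamma mf']_x ((x - m) ^+ 2)%:E = (s ^+ 2)%:E)%E,
   (\int[image_prob gamma mf']_x (x - m)%:E = 0)%E &
   forall a, (\int[image_prob gamma mf']_x (cos (1 * x + a))%:E =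
    (cos (m + a) * expR (- s ^+ 2 / 2))%:E)%E].
  have [s00|sn0] := eqVneq s 0.
    have E (g : R -> \bar R) : measurable_fun [set: measurableTypeR R] g ->
        (\int[image_prob gamma mf']_x g x = g m)%E.
      move=> mg; transitivity (\int[\d_(m : measurableTypeR R)]_x g x)%E.
        apply: eq_measure_integral => A mA _.
        by have := law A mA; rewrite s00 eqxx.
      by rewrite integral_dirac// diracT mul1e.
    split.
    - rewrite E ?subrr ?s00//.
      by apply/measurable_EFinP/measurable_funX; exact: measurable_funB.
    - by rewrite E ?subrr//; apply/measurable_EFinP; exact: measurable_funB.
    - move=> a; rewrite E ?mul1r; last by apply/measurable_EFinP; exact: mcos.
      by rewrite s00 expr0n/= oppr0 mul0r expR0 mulr1.
  have E (g : R -> \bar R) :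
      (\int[image_prob gamma mf']_x g x = \int[normal_prob m s]_x g x)%E.
    apply: eq_measure_integral => A mA _.
    by have := law A mA; rewrite (negbTE sn0).
  split.
  - by rewrite E normal_prob_variance.
  - by rewrite E normal_prob_centered.
  - move=> a; rewrite E.
    have := normal_prob_char_fun m sn0 1 (m + a).
    rewrite expr1n mul1r => <-; apply: eq_integral => x _; congr (cos _)%:E; ring.
have I2 : (\int[gamma]_x ((f x - m) ^+ 2)%:E = (s ^+ 2)%:E)%E.
  rewrite -Iv (ge0_integral_image_prob gamma mf')//.
  - by apply/measurable_EFinP/measurable_funX; exact: measurable_funB.
  - by move=> x; rewrite lee_fin sqr_ge0.
have i2 : gamma.-integrable setT (EFin \o ((fun x => (f x - m) ^+ 2) : borel F -> R)).
  apply/integrableP; split.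
    by apply/measurable_EFinP/measurable_funX; exact: measurable_funB.
  under eq_integral do rewrite gee0_abs ?lee_fin ?sqr_ge0//.
  by rewrite I2 ltry.
have ic (c : R) : gamma.-integrable setT (EFin \o (cst c : borel F -> R)).
  exact: (@bounded_integrable _ _ _ _ _ `|c|).
have i1 : gamma.-integrable setT (EFin \o (f : borel F -> R)).
  have ib : gamma.-integrable setT
      (EFin \o ((fun x => (1 + `|m|) + (f x - m) ^+ 2) : borel F -> R)).
    exact: (integrableD measurableT (ic (1 + `|m|)) i2).
  apply: (le_integrable measurableT _ _ ib); first exact/measurable_EFinP.
  move=> x _ /=; rewrite lee_fin [leRHS]ger0_norm ?addr_ge0 ?sqr_ge0//.
  have h1 : `|f x| <= `|f x - m| + `|m|.
    by rewrite -[X in `|X| <= _](subrK m) ler_normD.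
  have h2 : `|f x - m| <= 1 + (f x - m) ^+ 2.
    rewrite -[X in _ <= _ + X]real_normK ?num_real//.
    have := sqr_ge0 (`|f x - m| - 1); rewrite sqrrB expr1n mulr1; have := sqr_ge0 `|f x - m|; lra.
  lra.
have meanE : mean f = m.
  have : (\int[gamma]_x (f x - m)%:E = 0)%E.
    rewrite -[RHS]Im (integral_image_prob (P := gamma) mf' (g := fun x => (x - m)%:E))//.
    - by apply/measurable_EFinP; exact: measurable_funB.
    - exact: (integrableB measurableT i1 (ic m)).
  rewrite EFin_Rintegral//; last exact: (integrableB measurableT i1 (ic m)).
  have c1 : \int[gamma]_x (cst m : borel F -> R) x = m.
    by rewrite Rintegral_cst// [X in fine X]probability_setT mulr1.
  rewrite (RintegralB measurableT i1 (ic m)) [X in _ - X]c1.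
  by move=> [] /eqP; rewrite subr_eq0 => /eqP.
split => //.
- have ib : gamma.-integrable setT
      (EFin \o ((fun x => 2 * (f x - m) ^+ 2 + 2 * m ^+ 2) : borel F -> R)).
    exact: (integrableD measurableT (integrableZl measurableT 2 i2) (ic (2 * m ^+ 2))).
  apply: (le_integrable measurableT _ _ ib).
    by apply/measurable_EFinP; exact: measurable_funX.
  move=> x _ /=; rewrite lee_fin ger0_norm ?sqr_ge0// ger0_norm; last first.
    by rewrite addr_ge0// mulr_ge0// sqr_ge0.
  have := sqr_ge0 (f x - 2 * m); rewrite !expr2; lra.
- move=> a; have -> : cov f f = s ^+ 2.
    rewrite /cov meanE; apply: EFin_inj; rewrite -I2 -EFin_Rintegral//.
  rewrite meanE; apply: EFin_inj; rewrite -Ic -EFin_Rintegral//; last first.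
    apply: (@bounded_integrable _ _ _ _ _ 1) => //.
    have := measurableT_comp (mcos 1 a) mf'.
    by under eq_fun do rewrite mul1r.
  rewrite (integral_image_prob (P := gamma) mf' (g := fun x => (cos (1 * x + a))%:E)).
  - by apply: eq_integral => x _; rewrite mul1r.
  - by apply/measurable_EFinP; exact: mcos.
  - by apply: (@bounded_integrable _ _ _ _ _ 1) => //; exact: (measurableT_comp (mcos 1 a) mf').
Qed.

Let integrable_cst (c : R) : gamma.-integrable setT (EFin \o (cst c : borel F -> R)).
Proof. exact: (@bounded_integrable _ _ _ _ _ `|c|). Qed.

Let integrable_lf f : linear_functional f ->
  gamma.-integrable setT (EFin \o (f : borel F -> R)).
Proof. by move=> /gaussian_functional[]. Qed.

Let mcenter f : linear_functional f ->
  measurable_fun setT ((fun x => f x - mean f) : borel F -> R).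
Proof. by move=> lf; apply: measurable_funB => //; exact: measurable_linear_functional. Qed.

Let integrable_center_sqr f : linear_functional f ->
  gamma.-integrable setT (EFin \o ((fun x => (f x - mean f) ^+ 2) : borel F -> R)).
Proof.
move=> lf; have [_ i2 _] := gaussian_functional lf.
have ib := integrableD measurableT (integrableZl measurableT 2 i2)
  (integrable_cst (2 * mean f ^+ 2)).
apply: (le_integrable measurableT _ _ ib).
  by apply/measurable_EFinP/measurable_funX; exact: mcenter.
move=> x _ /=; rewrite lee_fin ger0_norm ?sqr_ge0// ger0_norm; last first.
  by rewrite addr_ge0// mulr_ge0// sqr_ge0.
have := sqr_ge0 (f x + mean f); rewrite !expr2; lra.
Qed.

Lemma integrable_cov f g : linear_functional f -> linear_functional g ->
  gamma.-integrable setT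
    (EFin \o ((fun x => (f x - mean f) * (g x - mean g)) : borel F -> R)).
Proof.
move=> lf lg.
have ib := integrableD measurableT (integrable_center_sqr lf) (integrable_center_sqr lg).
apply: (le_integrable measurableT _ _ ib).
  by apply/measurable_EFinP/measurable_funM; exact: mcenter.
move=> x _ /=; rewrite lee_fin [leRHS]ger0_norm ?addr_ge0 ?sqr_ge0//.
rewrite normrM -(real_normK (num_real (f x - _))) -(real_normK (num_real (g x - _))).
move: `|f x - _| `|g x - _| => a b.
have := sqr_ge0 (a - b); have := sqr_ge0 a; have := sqr_ge0 b; rewrite sqrrB; lra.
Qed.

Lemma meanDZ c f g : linear_functional f -> linear_functional g ->
  mean (fun x => f x + c * g x) = mean f + c * mean g.
Proof.
move=> lf lg.
have ig : gamma.-integrable setT (EFin \o ((fun x => c * g x) : borel F -> R)).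
  exact: (integrableZl measurableT c (integrable_lf lg)).
rewrite /mean (RintegralD measurableT (integrable_lf lf) ig).
by rewrite (RintegralZl c measurableT (integrable_lf lg)).
Qed.

Lemma covC f g : cov f g = cov g f.
Proof. by rewrite /cov; apply: eq_Rintegral => x _; rewrite mulrC. Qed.

Lemma covDZl c f g h : linear_functional f -> linear_functional g -> linear_functional h ->
  cov (fun x => f x + c * g x) h = cov f h + c * cov g h.
Proof.
move=> lf lg lh.
have ig : gamma.-integrable setT
    (EFin \o ((fun x => c * ((g x - mean g) * (h x - mean h))) : borel F -> R)).
  exact: (integrableZl measurableT c (integrable_cov lg lh)).
rewrite /cov meanDZ// -(RintegralZl c measurableT (integrable_cov lg lh)).
rewrite -(RintegralD measurableT (integrable_cov lf lh) ig).
by apply: eq_Rintegral => x _; ring.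
Qed.

Lemma cov_ge0 f : 0 <= cov f f.
Proof. by apply: Rintegral_ge0 => x _; rewrite -expr2 sqr_ge0. Qed.

Lemma variance_cov f : linear_functional f -> 'V_gamma[(f : borel F -> R)]%E = (cov f f)%:E.
Proof.
move=> lf; rewrite /variance covariance.unlock expectation.unlock /cov.
by rewrite -EFin_Rintegral//; exact: integrable_cov.
Qed.

Local Opaque cov mean.

(** If [f] has variance 0, the variance of [g + t f] is affine in t and never negative, so its slope
    vanishes. *)
Lemma cov_eq0 f g : linear_functional f -> linear_functional g ->
  cov f f = 0 -> cov f g = 0.
Proof.
move=> lf lg ff0.
have h t : 0 <= cov g g + 2 * t * cov f g.
  have lfg := linear_functionalDZ t lg lf.
  pose gf x := g x + t * f x.
  have e1 : cov gf gf = cov g gf + t * cov f gf := covDZl t lg lf lfg.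
  have e2 : cov gf g = cov g g + t * cov f g := covDZl t lg lf lg.
  have e3 : cov gf f = cov g f + t * cov f f := covDZl t lg lf lf.
  have := cov_ge0 gf; rewrite e1 (covC g gf) (covC f gf) e2 e3 ff0 (covC g f).
  have -> : 2 * t * cov f g = t * cov f g + t * cov f g by rewrite -mulrA mulr_natl mulr2n.
  by rewrite mulr0 addr0 addrA.
exact: affine_ge0_eq0 h.
Qed.

Section gram_schmidt.
Variable l : nat -> F -> R.
Hypothesis ll : forall n, linear_functional (l n).

Let residual n (e : nat -> F -> R) (x : F) : R :=
  l n x - \sum_(0 <= k < n) cov (l n) (e k) * e k x.

(** The value 1 keeps a functional of variance 0 instead of annihilating it, and [gram_schmidt_span]
    divides by the scale. *)
Let scale_of (f : F -> R) : R := if cov f f == 0 then 1 else (Num.sqrt (cov f f))^-1.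

Let normalize f (x : F) : R := scale_of f * f x.

(** Course-of-values recursion: stage [n] stores the first [n] functions, so the next residual can
    use all of them. *)
Fixpoint gs_table n : nat -> F -> R :=
  if n is m.+1 then
    fun k => if k == m then normalize (residual m (gs_table m)) else gs_table m k
  else fun _ _ => 0.

Definition gram_schmidt n : F -> R := gs_table n.+1 n.

Local Notation xi := gram_schmidt.

Let gs_tableE n k : (k < n)%N -> gs_table n k = xi k.
Proof.
elim: n => // n IH; rewrite ltnS leq_eqVlt => /predU1P[->//|kn].
by rewrite /= ltn_eqF// IH.
Qed.

Let res n := residual n xi.

Let xiE n : xi n = normalize (res n).
Proof.
rewrite /gram_schmidt /= eqxx /res; congr normalize.
apply/funext => x; rewrite /residual; congr (_ - _).
by apply: eq_big_nat => k /andP[_ kn]; rewrite gs_tableE.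
Qed.

Definition gs_active n : bool := cov (xi n) (xi n) != 0.

Let scale_of_gt0 f : 0 < scale_of f.
Proof.
rewrite /scale_of; case: eqVneq => // f0.
by rewrite invr_gt0 sqrtr_gt0 lt0r f0 cov_ge0.
Qed.

Let linear_res n : (forall k, (k < n)%N -> linear_functional (xi k)) ->
  linear_functional (res n).
Proof.
move=> h; rewrite (_ : res n = fun x => l n x + (- 1) *
    (\sum_(0 <= k < n) cov (l n) (xi k) * xi k x)); last first.
  by apply/funext => x; rewrite /res /residual mulN1r.
by apply: linear_functionalDZ => //; exact: linear_functional_sum.
Qed.

Lemma linear_gram_schmidt n : linear_functional (xi n).
Proof.
elim/ltn_ind: n => n IH; rewrite xiE.
rewrite (_ : normalize _ = fun x => 0 + scale_of (res n) * res n x); last first.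
  by apply/funext => x; rewrite add0r.
by apply: linear_functionalDZ; [exact: linear_functional0|exact: linear_res].
Qed.

Local Notation lxi := linear_gram_schmidt.

Let lres n : linear_functional (res n). Proof. by apply: linear_res => k _; exact: lxi. Qed.

Let lzero := linear_functional0.

Let cov0l f : linear_functional f -> cov (fun=> 0) f = 0.
Proof.
move=> lf; have := covDZl 1 lzero lzero lf.
have -> : (fun x : F => 0 + 1 * 0) = (fun=> 0 : R).
  by apply/funext => x; rewrite mul1r addr0.
by lra.
Qed.

Lemma cov_suml n (c : nat -> R) f : linear_functional f ->
  cov (fun x => \sum_(0 <= k < n) c k * xi k x) f = \sum_(0 <= k < n) c k * cov (xi k) f.
Proof.
move=> lf; elim: n => [|n IH].
  rewrite [RHS]big_geq// -[RHS](cov0l lf).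
  suff -> : (fun x => \sum_(0 <= k < 0) c k * xi k x) = (fun=> 0) by [].
  by apply/funext => x; rewrite big_geq.
have ls : linear_functional (fun x => \sum_(0 <= k < n) c k * xi k x).
  by apply: linear_functional_sum => k _; exact: lxi.
rewrite [RHS]big_nat_recr//= -IH -(covDZl (c n) ls (lxi n) lf).
suff -> : (fun x => \sum_(0 <= k < n.+1) c k * xi k x) =
  (fun x => \sum_(0 <= k < n) c k * xi k x + c n * xi n x) by [].
by apply/funext => x; rewrite big_nat_recr.
Qed.

Let cov_normalize f g : linear_functional f -> linear_functional g ->
  cov (normalize f) g = scale_of f * cov f g.
Proof.
move=> lf lg; have := covDZl (scale_of f) lzero lf lg.
rewrite (cov0l lg) add0r => <-.
suff -> : normalize f = (fun x => 0 + scale_of f * f x) by [].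
by apply/funext => x; rewrite add0r.
Qed.

Let lnormalize f : linear_functional f -> linear_functional (normalize f).
Proof.
move=> lf; rewrite (_ : normalize _ = fun x => 0 + scale_of f * f x).
  exact: linear_functionalDZ.
by apply/funext => x; rewrite add0r.
Qed.

Lemma cov_gram_schmidt n : cov (xi n) (xi n) = (gs_active n)%:R.
Proof.
rewrite /gs_active; case: eqVneq => //= h.
move: h; rewrite xiE cov_normalize//; last exact: lnormalize.
rewrite covC cov_normalize//.
rewrite mulf_eq0 negb_or mulf_eq0 negb_or => /andP[_ /andP[_ r0]].
rewrite /scale_of (negbTE r0) mulrA -invfM -expr2 sqr_sqrtr ?cov_ge0//.
by rewrite mulVf.
Qed.

(** By strong induction only the projection on [xi k] survives, and it cancels the covariance of
    [l n] with [xi k]. *)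
Lemma cov_gram_schmidt_lt n k : (k < n)%N -> cov (xi n) (xi k) = 0.
Proof.
elim/ltn_ind: n k => n IH k kn.
have orth i j : (i < n)%N -> (j < n)%N -> i != j -> cov (xi i) (xi j) = 0.
  move=> i_n j_n; rewrite neq_ltn => /orP[ij|ji]; last exact: IH.
  by rewrite covC; exact: IH.
rewrite xiE (cov_normalize (lres n) (lxi k)).
suff -> : cov (res n) (xi k) = 0 by rewrite mulr0.
pose s x := \sum_(0 <= j < n) cov (l n) (xi j) * xi j x.
have ls : linear_functional s by apply: linear_functional_sum => j _; exact: lxi.
have -> : res n = fun x => l n x + (- 1) * s x.
  by apply/funext => x; rewrite /res /residual mulN1r.
rewrite (covDZl (- 1) (ll n) ls (lxi k)) cov_suml; last exact: lxi.
have -> : \sum_(0 <= j < n) cov (l n) (xi j) * cov (xi j) (xi k) =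
    cov (l n) (xi k) * (gs_active k)%:R.
  rewrite (@big_cat_nat _ _ _ k)//=; last exact: ltnW.
  rewrite big_nat big1 ?add0r; last first.
    move=> j /andP[_ jk]; rewrite orth ?mulr0//; first exact: ltn_trans jk kn.
    by rewrite ltn_eqF.
  rewrite big_ltn// cov_gram_schmidt big_nat big1 ?addr0// => j /andP[kj jn].
  by rewrite orth ?mulr0// gtn_eqF.
(* For a degenerate [xi k] the projection subtracts nothing, but the covariance is already 0 by
   [cov_eq0]. *)
have [_|deg] := boolP (gs_active k); first by rewrite mulr1; lra.
rewrite mulr0 mulr0 addr0 covC (cov_eq0 (lxi k) (ll n))//.
by move: deg; rewrite negbK => /eqP.
Qed.

Lemma cov_gram_schmidt_sum n (c : nat -> R) :
  cov (fun x => \sum_(0 <= k < n) c k * xi k x) (fun x => \sum_(0 <= k < n) c k * xi k x) =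
  \sum_(0 <= k < n) c k ^+ 2 * (gs_active k)%:R.
Proof.
have ls m : linear_functional (fun x => \sum_(0 <= k < m) c k * xi k x).
  by apply: linear_functional_sum => k _; exact: lxi.
rewrite (cov_suml n c (ls n)); apply: eq_big_nat => k /andP[_ kn].
rewrite (covC (xi k)) (cov_suml n c (lxi k)) (@big_cat_nat _ _ _ k)//=; last exact: ltnW.
rewrite big_nat big1 ?add0r; last first.
  by move=> j /andP[_ jk]; rewrite covC cov_gram_schmidt_lt ?mulr0.
rewrite big_ltn// cov_gram_schmidt big_nat big1 ?addr0; first by rewrite expr2 mulrA.
by move=> j /andP[kj jn]; rewrite cov_gram_schmidt_lt ?mulr0.
Qed.

(** An identity at every point and not only almost everywhere, thanks to nonzero scales and the
    retained degenerate functionals. Separation of points and the bound on [cm_dist] rely on it. *)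
Lemma gram_schmidt_span n : exists c : nat -> R,
  l n = fun x => \sum_(0 <= k < n.+1) c k * xi k x.
Proof.
exists (fun k => if k == n then (scale_of (res n))^-1 else cov (l n) (xi k)).
apply/funext => x; rewrite big_nat_recr//= eqxx xiE /normalize mulrA mulVf ?gt_eqF// mul1r.
rewrite {1}/res /residual addrC -[LHS](subrK (\sum_(0 <= k < n) cov (l n) (xi k) * xi k x)).
congr (_ + _); apply: eq_big_nat => k /andP[_ kn].
by rewrite ltn_eqF.
Qed.

Lemma gram_schmidt_char_fun n (t : nat -> R) a :
  \int[gamma]_x cos (\sum_(0 <= k < n) t k * (xi k x - mean (xi k)) + a) =
  cos a * expR (- (\sum_(0 <= k < n) if gs_active k then t k ^+ 2 else 0) / 2).
Proof.
pose f x := \sum_(0 <= k < n) t k * xi k x.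
have lf : linear_functional f by apply: linear_functional_sum => k _; exact: lxi.
have mf : mean f = \sum_(0 <= k < n) t k * mean (xi k).
  rewrite /f; elim: (n) => [|m IH].
    rewrite big_geq//; have := meanDZ 1 lzero lzero.
    rewrite (_ : (fun x : F => 0 + 1 * 0) = fun=> 0); last first.
      by apply/funext => x; rewrite mul1r addr0.
    rewrite (_ : (fun x : F => \sum_(0 <= k < 0) t k * xi k x) = fun=> 0); first by lra.
    by apply/funext => x; rewrite big_geq.
  have ls : linear_functional (fun x => \sum_(0 <= k < m) t k * xi k x).
    by apply: linear_functional_sum => k _; exact: lxi.
  rewrite [RHS]big_nat_recr//= -IH -(meanDZ (t m) ls (lxi m)).
  suff -> : (fun x => \sum_(0 <= k < m.+1) t k * xi k x) =
    (fun x => \sum_(0 <= k < m) t k * xi k x + t m * xi m x) by [].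
  by apply/funext => x; rewrite big_nat_recr.
(* The phase absorbs the mean, so centering the coordinates costs nothing. *)
have [_ _ /(_ (a - mean f))] := gaussian_functional lf.
have -> : mean f + (a - mean f) = a by rewrite addrC subrK.
rewrite cov_gram_schmidt_sum.
rewrite (_ : \sum_(0 <= k < n) (if gs_active k then t k ^+ 2 else 0) =
  \sum_(0 <= k < n) t k ^+ 2 * (gs_active k)%:R); last first.
  by apply: eq_bigr => k _; case: gs_active; rewrite ?mulr1 ?mulr0.
move=> <-; apply: eq_Rintegral => x _; congr cos.
rewrite mf addrCA addrC; congr (_ + _).
by rewrite /f -sumrB; apply: eq_bigr => k _; rewrite mulrBr.
Qed.

End gram_schmidt.

End gaussian_functionals.

(** * The transport inequality *)

(** The integral of a nonnegative function is a supremum over the simple functions below it,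
    measurable or not. This is what handles [cm_dist]. *)
Lemma le_integral_ge0_nonmeasurable d (T : measurableType d) (R : realType)
    (mu : {measure set T -> \bar R}) (f g : T -> \bar R) :
  (forall x, 0 <= f x)%E -> (forall x, f x <= g x)%E ->
  (\int[mu]_x f x <= \int[mu]_x g x)%E.
Proof.
move=> f0 fg; have g0 x : (0 <= g x)%E by exact: le_trans (f0 x) (fg x).
rewrite !ge0_integralTE//; apply: ereal_sup_le => _ [h hf <-].
by exists h => // x; exact: le_trans (hf x) (fg x).
Qed.

(** The negative part of [ln f] is at most [1 / f], whose [nu]-integral is at most 1. So if [ln f]
    is not integrable, its positive part has infinite integral and so does [ln f]. *)
Lemma relative_entropy_density d (T : measurableType d) (R : realType)
    (nu gamma : probability T R) :
  relative_entropy nu gamma = +oo%E \/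
  exists f : T -> R, [/\ nu `<< gamma, is_density gamma nu id f,
    nu.-integrable setT (fun x => (ln (f x))%:E) &
    relative_entropy nu gamma = (\int[nu]_x (ln (f x))%:E)%E].
Proof.
have [numu|] := asboolP (nu `<< gamma); last first.
  by move=> h; left; rewrite /relative_entropy asboolF.
have FP := ae_filter_ringOfSetsType nu.
pose g := Radon_Nikodym_SigmaFinite.f nu gamma.
have mg : measurable_fun setT g.
  exact: measurable_int (Radon_Nikodym_SigmaFinite.f_integrable numu).
have g0 x : (0 <= g x)%E by exact: Radon_Nikodym_SigmaFinite.f_ge0.
have gfin x : g x \is a fin_num by exact: Radon_Nikodym_SigmaFinite.f_fin_num.
pose f := fine \o g.
have mf : measurable_fun setT f.
  exact: (measurableT_comp (@fine_measurable R setT measurableT) mg).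
have gE x : g x = (f x)%:E by rewrite /f /= fineK.
have df : is_density gamma nu id f.
  split => //; first by move=> u; exact: fine_ge0.
  move=> A mA; rewrite preimage_id (Radon_Nikodym_SigmaFinite.f_integral numu mA).
  by apply: eq_integral => x _; rewrite -gE.
have f0 x : 0 <= f x by exact: fine_ge0.
have fpos := density_gt0 (@measurable_id _ _ setT) df.
pose RN := Radon_Nikodym (charge_of_finite_measure nu) gamma.
have mRN : measurable_fun setT RN.
  by apply: measurable_int (Radon_Nikodym_integrable _).
have RNfin x : RN x \is a fin_num by exact: Radon_Nikodym_fin_num.
(* The two versions of the derivative agree almost everywhere for [gamma], and absolute continuity
   carries this to [nu]. *)
have RNE : {ae nu, forall x, RN x = (f x)%:E}.
  have [Z [mZ Z0 hZ]] := ae_eq_Radon_Nikodym_SigmaFinite numu (@measurableT _ T).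
  exists Z; split => //; first by have /null_content_dominatesP := numu; exact.
  by apply: subset_trans hZ => x /= h1 h2; apply: h1; rewrite -gE; exact: (esym (h2 Logic.I)).
have mlneRN : measurable_fun setT (fun x => lne (RN x)).
  rewrite (_ : (fun x => lne (RN x)) =
    (fun x => if (fine (RN x) <= 0)%R then -oo%E else (ln (fine (RN x)))%:E)); last first.
    by apply/funext => x; rewrite -{1}(fineK (RNfin x)).
  have mfRN : measurable_fun setT (fun x => fine (RN x)).
    exact: (measurableT_comp (@fine_measurable R setT measurableT) mRN).
  apply: measurable_fun_ifT => //; first exact: measurable_fun_ler.
  by apply/measurable_EFinP; apply: measurableT_comp => //; exact: measurable_ln.
have mlnf : measurable_fun setT (fun x => ln (f x)).
  by apply: measurableT_comp => //; exact: measurable_ln.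
have RE : relative_entropy nu gamma = (\int[nu]_x (ln (f x))%:E)%E.
  rewrite /relative_entropy asboolT//; apply: ae_eq_integral => //.
    exact/measurable_EFinP.
  apply: filterS2 RNE fpos => x Rx fx _; rewrite -/RN Rx lne_EFin//.
have [iln|niln] := pselect (nu.-integrable setT (fun x => (ln (f x))%:E)).
  by right; exists f.
left; rewrite RE integralE.
have negfin : (\int[nu]_x ((fun x => (ln (f x))%:E)^\- x) < +oo)%E.
  have w2 : (\int[nu]_x (1 / f x)%:E <= 1)%E.
    apply: (integral_density_ratio (@measurable_id _ _ setT) df (w := cst 1)) => //.
    have := integral_cst gamma measurableT (1%E : \bar R).
    rewrite mul1e [X in _ = X -> _]probability_setT => e.
    by rewrite le_eqVlt; apply/orP; left; apply/eqP; exact: e.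
  have mV := measurable_densityV (@measurable_id _ _ setT) df.
  apply: (le_lt_trans _ (le_lt_trans w2 (ltry 1))).
  apply: ae_ge0_le_integral => //.
  - by apply: measurable_funeneg; exact/measurable_EFinP.
  - by move=> x _; rewrite lee_fin divr_ge0.
  - by apply/measurable_EFinP; exact: measurable_funM.
  apply: filterS fpos => x fx _; rewrite funenegE ge_max.
  rewrite lee_fin; apply/andP; split; last by rewrite lee_fin divr_ge0.
  have i0 : 0 < 1 / f x by rewrite divr_gt0.
  have := @le_ln1Dx R (1 / f x - 1); rewrite addrCA subrr addr0 ln_div ?posrE// ln1 => h.
  have : -1 < 1 / f x - 1 by lra.
  move=> /h; lra.
rewrite (_ : (\int[nu]_x ((fun x => (ln (f x))%:E)^\+ x) = +oo)%E); last first.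
  apply/eqP; rewrite -leye_eq leNgt; apply/negP => posfin; apply: niln.
  apply/integrableP; split; first exact/measurable_EFinP.
  rewrite (_ : (fun x => _) = (fun x => (fun x => (ln (f x))%:E)^\+ x +
     (fun x => (ln (f x))%:E)^\- x)%E); last first.
    by apply/funext => x; rewrite -[LHS]/((abse \o (fun x => (ln (f x))%:E)) x) fune_abse.
  rewrite ge0_integralD//; first by rewrite lte_add_pinfty.
  - by apply: measurable_funepos; exact/measurable_EFinP.
  - by apply: measurable_funeneg; exact/measurable_EFinP.
set X := (\int[nu]_x _)%E in negfin *.
have Xfin : X \is a fin_num by rewrite ge0_fin_numE// integral_ge0.
by rewrite -(fineK Xfin).
Qed.

Section cm_bound.
Context {R : realType} {F : tvsType R} (gamma : probability (borel F) R).
Hypothesis ggamma : gaussian_measure gamma.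
Variable l : nat -> F -> R.
Hypothesis ll : forall n, linear_functional (l n).
Hypothesis lsup : forall (h : F) (c : R),
  (forall n, cov gamma (l n) (l n) <= 1 -> l n h <= c) -> (cm_norm gamma h <= c%:E)%E.

Local Notation xi := (gram_schmidt gamma l).
Local Notation v := (gs_active gamma l).

Definition gs_coord k (x : F) : R := xi k x - mean gamma (xi k).

(* The infinite weight forces agreement on the coordinates that are degenerate
   under [gamma]. *)
Definition gs_weight k : \bar R := if v k then 1%E else +oo%E.

Lemma gs_weight_ge1 k : (1 <= gs_weight k)%E.
Proof. by rewrite /gs_weight; case: ifP => // _; exact: leey. Qed.

Let w0 k : (0 <= gs_weight k)%E. Proof. exact: le_trans (lee01) (gs_weight_ge1 k). Qed.

Definition gs_cost (x y : F) : \bar R :=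
  (\sum_(k <oo) gs_weight k * ((gs_coord k x - gs_coord k y) ^+ 2)%:E)%E.

Lemma cm_norm_ge0 h : (0 <= cm_norm gamma h)%E.
Proof.
apply: ereal_sup_ubound.
have [L cL LE] := linear_functional_dual (linear_functional0 (F := F)).
exists L; last by rewrite LE.
split => //.
rewrite (_ : (L : borel F -> R) = (fun=> 0)); last by apply/funext => x; exact: LE.
by rewrite variance_cst.
Qed.

(* Cauchy-Schwarz along the expansion of each [l n] in the orthonormal [xi]. *)
Lemma cm_dist_sqr_le x y : (cm_dist gamma x y ^+ 2 <= gs_cost x y)%E.
Proof.
have t0 k : (0 <= gs_weight k * ((gs_coord k x - gs_coord k y) ^+ 2)%:E)%E.
  by rewrite mule_ge0// lee_fin sqr_ge0.
have [->|Cfin] := eqVneq (gs_cost x y) +oo%E; first exact: leey.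
have C0 : (0 <= gs_cost x y)%E by apply: nneseries_ge0.
pose S := fine (gs_cost x y).
have SE : gs_cost x y = S%:E by rewrite fineK// ge0_fin_numE// ltey.
have S0 : 0 <= S by rewrite fine_ge0.
pose d k := gs_coord k x - gs_coord k y.
have dE k : d k = xi k (x - y).
  rewrite (linear_functionalB _ _ (linear_gram_schmidt gamma ll k)) /d /gs_coord; ring.
have d0 k : ~~ v k -> d k = 0.
  move=> vk; apply/eqP/negP => /negP dk.
  move/eqP: Cfin; apply; apply: (nneseries_pinfty (k := k)) => //.
  by rewrite /gs_weight (negbTE vk) gt0_mulye// lte_fin exprn_even_gt0.
have dS n : \sum_(0 <= k < n) d k ^+ 2 <= S.
  rewrite -lee_fin -SE -sumEFin.
  apply: (le_trans _ (nneseries_lim_ge n _)); last by move=> k _ _; exact: t0.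
  apply: lee_sum => k _; rewrite -[leLHS]mul1e lee_wpmul2r// ?lee_fin ?sqr_ge0//.
  exact: gs_weight_ge1.
have normS : (cm_norm gamma (x - y)%R <= (Num.sqrt S)%:E)%E.
  apply/lee_addgt0Pr => e e0; rewrite -EFinD; apply: lsup => n Vn.
  (* The added [e] keeps [s] positive when [S] is 0, so that dividing by it is legitimate. *)
  pose s := Num.sqrt S + e.
  have s0 : 0 < s by rewrite ltr_wpDl// sqrtr_ge0.
  have Ss : S <= s ^+ 2.
    rewrite -[leLHS]sqr_sqrtr// ler_pXn2r// ?nnegrE ?sqrtr_ge0 ?(ltW s0)//.
    by rewrite lerDl ltW.
  have [c lc] := gram_schmidt_span gamma l n.
  move: Vn; rewrite lc (cov_gram_schmidt_sum ggamma ll) => Vn.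
  (* The weighted inequality 2 c d <= s c^2 + d^2 / s: the squares of the active [c k] sum to at
     most 1 and those of [d k] to at most s^2, so the total is at most s. *)
  have step k : c k * xi k (x - y) <= (s * (c k ^+ 2 * (v k)%:R) + d k ^+ 2 / s) / 2.
    rewrite -dE; have [vk|vk] := boolP (v k); last first.
      by rewrite d0// mulr0 mulr0 mulr0 expr0n/= mul0r addr0 mul0r.
    pose w := d k / s; have dw : d k = w * s by rewrite divfK// gt_eqF.
    have dw2 : d k ^+ 2 / s = w ^+ 2 * s.
      by rewrite dw; field; rewrite gt_eqF.
    rewrite mulr1 dw2 dw; have := mulr_ge0 (ltW s0) (sqr_ge0 (c k - w)).
    by rewrite sqrrB; lra.
  apply: (le_trans (ler_sum_nat _)).
    by move=> k _; exact: step.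
  rewrite -mulr_suml big_split/= -mulr_sumr -mulr_suml.
  have h1 : s * (\sum_(0 <= k < n.+1) c k ^+ 2 * (v k)%:R) <= s.
    by rewrite -[leRHS]mulr1 ler_pM2l.
  have h2 : (\sum_(0 <= k < n.+1) d k ^+ 2) / s <= s.
    by rewrite ler_pdivrMr// -expr2 (le_trans (dS _)).
  rewrite -/s; lra.
rewrite SE /cm_dist mem_set; last exact: le_lt_trans normS (ltry _).
rewrite -[S]sqr_sqrtr// expe2 expr2 EFinM.
by apply: lee_pmul => //; exact: cm_norm_ge0.
Qed.

End cm_bound.

Section functionals.
Context {R : realType} {F : tvsType R} (gamma : probability (borel F) R).
Hypothesis ggamma : gaussian_measure gamma.
Variable dist : F -> F -> R.
Hypothesis distP : is_metric dist.
Hypothesis distT : metric_induces_topology dist.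
Variable u : nat -> F.
Hypothesis uP : forall x e, 0 < e -> exists n, dist x (u n) < e.

(** Two countable families are interleaved, both from [countable_subfamily]: odd indices compute the
    supremum defining [cm_norm], even indices separate points by [separating_functional]. *)
Lemma exists_functionals : exists l : nat -> F -> R,
  [/\ forall n, linear_functional (l n),
      forall x, (forall n, l n x = 0) -> x = 0 &
      forall (h : F) (c : R), (forall n, cov gamma (l n) (l n) <= 1 -> l n h <= c) ->
        (cm_norm gamma h <= c%:E)%E].
Proof.
have [L0 cL0 L0E] := linear_functional_dual (linear_functional0 (F := F)).
pose ev (L : {linear F -> R^o}) (x : F) : R := L x.
pose S1 : set {linear F -> R^o} :=
  [set L | continuous_dual F L /\ ('V_gamma[(L : borel F -> R)] <= 1)%E].
have [s2 [s2S s2P]] : exists s : nat -> {linear F -> R^o},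
    (forall n, continuous_dual F (s n)) /\
    forall x q, (exists2 i, continuous_dual F i & q < ev i x) -> exists n, q < ev (s n) x.
  apply: (countable_subfamily distP distT uP); first by exists L0.
  by move=> i; exact.
have [s1 [s1S s1P]] : exists s : nat -> {linear F -> R^o}, (forall n, S1 (s n)) /\
    forall x q, (exists2 i, S1 i & q < ev i x) -> exists n, q < ev (s n) x.
  apply: (countable_subfamily distP distT uP); last by move=> i [].
  exists L0; split => //.
  rewrite (_ : (L0 : borel F -> R) = cst 0); last by apply/funext => x; exact: L0E.
  by rewrite variance_cst lee01.
pose l n : F -> R := if odd n then ev (s1 n./2) else ev (s2 n./2).
have ll n : linear_functional (l n).
  rewrite /l; case: odd; apply: dual_linear_functional => //.
  by case: (s1S n./2).
exists l; split => // [x lx|h c hc].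
- apply/eqP/negP => /negP x0.
  have [d0 dx0 _ _] := distP.
  have nW : nbhs (0 : F) [set y | dist 0 y < dist 0 x].
    apply/distT; exists (dist 0 x) => //.
    by rewrite lt0r d0 andbT; apply/eqP => /dx0 /esym /eqP; rewrite (negbTE x0).
  have [L [cL Lx]] := separating_functional nW (fun h => negP (negbT (ltxx _)) h).
  (* [s2P] detects only values above 0, so a functional negative at x is replaced by its
     opposite. *)
  suff [L' cL' L'x] : exists2 L' : {linear F -> R^o}, continuous_dual F L' & 0 < ev L' x.
    have [n] := s2P x 0 (ex_intro2 _ _ L' cL' L'x).
    by have := lx n.*2; rewrite /l odd_double doubleK => ->; rewrite ltxx.
  have [Lx0|Lx0|Lx0] := ltgtP (ev L x) 0.
  + have [L' cL' L'E] := linear_functional_dual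
      (linear_functionalDZ (- 1) (linear_functional0 (F := F)) (dual_linear_functional cL)).
    exists L' => //; rewrite /ev L'E add0r mulN1r oppr_gt0.
    exact: Lx0.
  + by exists L.
  + by move/eqP: Lx; case; exact: Lx0.
apply: ge_ereal_sup => _ [L LS1 <-].
rewrite lee_fin leNgt; apply/negP => cL.
have [n] := s1P h c (ex_intro2 _ _ L LS1 cL).
apply/negP; rewrite -leNgt.
have := hc n.*2.+1; rewrite /l /= odd_double/= uphalf_double; apply.
have [cs1 Vs1] := s1S n.
by rewrite -lee_fin -(variance_cov ggamma (dual_linear_functional cs1)).
Qed.

End functionals.

Lemma cm_transport_cost_density (R : realType) (F : tvsType R)
    (gamma nu : probability (borel F) R) (f : borel F -> R) :
  gaussian_frechet_space gamma -> nu `<< gamma -> is_density gamma nu id f ->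
  nu.-integrable setT (fun x => (ln (f x))%:E) ->
  (cm_transport_cost nu gamma <= 2%:E * \int[nu]_x (ln (f x))%:E)%E.
Proof.
move=> [[sepF [dist [distP distT distC]]] ggamma] numu df ilnf.
have [u uP] := dist_dense_sequence distP distT sepF.
have [l [ll lsep lsup]] := exists_functionals ggamma distP distT uP.
pose X := gs_coord gamma l; pose v := gs_active gamma l.
have lxi k := linear_gram_schmidt gamma ll k.
have cX k : continuous (X k).
  move=> x; apply: cvgB; last exact: cvg_cst.
  by have [c _] := lxi k; exact: c.
have mX k : measurable_fun setT (X k : borel F -> R) by exact: continuous_measurable_borel.
have injX x y : (forall k, X k x = X k y) -> x = y.
  move=> Xxy; apply/eqP; rewrite -subr_eq0; apply/eqP; apply: lsep => n.
  have [c ->] := gram_schmidt_span gamma l n.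
  rewrite big1// => k _; rewrite (linear_functionalB _ _ (lxi k)).
  by have := Xxy k; rewrite /X /gs_coord => /addIr ->; rewrite subrr mulr0.
have chX := gram_schmidt_char_fun ggamma ll.
have XN n : v n -> forall (B : nat -> set R) (A : set R),
  (forall k, measurable (B k)) -> measurable A ->
  (gamma [set x | (forall k, (k < n)%N -> B k (X k x)) /\ A (X n x)] =
   gamma [set x | forall k, (k < n)%N -> B k (X k x)] * normal_prob 0 1 A)%E.
  by move=> vn B A mB mA; exact: (gaussian_independence mX chX vn mB mA).
have X0 n : ~~ v n -> {ae gamma, forall x, X n x = 0}.
  by move=> vn; exact: (gaussian_degenerate mX chX vn).
pose S := sequential_transport numu v mX.
have mS k : measurable_fun setT (S k : borel F -> R) by exact: measurable_sequential_transport.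
have cost := sequential_transport_cost numu df ilnf mX XN X0.
have law := sequential_transport_law numu mX XN X0.
have [K [KP K0]] := ulam distP distT distC uP gamma.
have [g [mg gE]] := measurable_inverse cX injX KP.
pose Xs (x : borel F) : seqR R := fun k => X k x.
pose Ss (x : borel F) : seqR R := fun k => S k x.
have mXs : measurable_fun setT Xs by exact: measurable_fun_seqR.
have mSs : measurable_fun setT Ss by exact: measurable_fun_seqR.
have lawE (A : set (seqR R)) : measurable A -> nu (Ss @^-1` A) = gamma (Xs @^-1` A).
  apply: (@seqR_measure_unique R (image_prob nu mSs) (image_prob gamma mXs)).
    by rewrite -ge0_fin_numE// fin_num_measure.
  exact: law.
pose y x := g (Ss x).
have my : measurable_fun setT y by exact: measurableT_comp.
have mK : measurable (\bigcup_n K n : set (borel F)).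
  by apply: bigcupT_measurable => n; exact: (@measurable_borel_closed R F _ (KP n).2).
have Fg := ae_filter_ringOfSetsType gamma.
have Fn := ae_filter_ringOfSetsType nu.
have aeK : {ae gamma, forall x, (\bigcup_n K n) x}.
  by exists (~` \bigcup_n K n); split => //; exact: measurableC.
have lawy (A : set (borel F)) : measurable A -> nu (y @^-1` A) = gamma A.
  move=> mA; have mgA : measurable (g @^-1` A).
    by rewrite -[X in measurable X]setTI; exact: mg.
  have -> : nu (y @^-1` A) = gamma (Xs @^-1` (g @^-1` A)) by exact: lawE.
  apply: ae_eq_measure => //.
    by rewrite -[X in measurable X]setTI; exact: mXs.
  by apply: filterS aeK => x Kx /=; rewrite gE.
(* The law of [Ss] under [nu] is that of [Xs] under [gamma], which is carried by the image of the
   compact sets; on this image [g] is a genuine inverse. *)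
have ySs : {ae nu, forall x, Xs (y x) = Ss x}.
  pose M := [set Xs x | x in \bigcup_n K n].
  have mM : measurable M.
    rewrite /M image_bigcup; apply: bigcupT_measurable => n.
    by apply: (measurable_image_compact cX); case: (KP n).
  have mMC : measurable (Ss @^-1` (~` M)).
    by rewrite -[X in measurable X]setTI; apply: mSs => //; exact: measurableC.
  exists (Ss @^-1` (~` M)); split => //.
    rewrite lawE; last exact: measurableC.
    apply/eqP; rewrite eq_le measure_ge0 andbT -K0.
    apply: le_measure; rewrite ?inE//.
    - by rewrite -[X in measurable X]setTI; apply: mXs => //; exact: measurableC.
    - exact: measurableC.
    - by move=> x /= h Kx; apply: h; exists x.
  move=> x /= h [z Kz zS]; apply: h.
  by rewrite /y -zS gE.
have X0nu n : ~~ v n -> {ae nu, forall x, X n x = S n x}.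
  move=> vn; have [Z [mZ Z0 XZ]] := X0 n vn; exists Z; split => //.
    by have /null_content_dominatesP := numu; exact.
  apply: subset_trans XZ => x /= h Xx; apply: h.
  by rewrite Xx /S /sequential_transport /= (negbTE vn).
pose xy (x : borel F) := (x, y x).
have mxy : measurable_fun setT xy by exact: measurable_fun_pair.
pose pi : probability (borel F * borel F)%type R := image_prob nu mxy.
have pic : couplings nu gamma pi.
  split => A mA; first by [].
  exact: lawy.
apply: (@le_trans _ _ (\int[pi]_z (cm_dist gamma z.1 z.2) ^+ 2)%E).
  by apply: ereal_inf_lbound; exists pi.
have w0 k : (0 <= gs_weight gamma l k)%E.
  exact: le_trans lee01 (gs_weight_ge1 gamma l k).
(* From here on the integrand is measurable and the image measure can be unfolded. *)
apply: (@le_trans _ _ (\int[pi]_z gs_cost gamma l z.1 z.2)%E).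
  apply: le_integral_ge0_nonmeasurable => z.
    rewrite expe2; apply: mule_ge0; rewrite /cm_dist; case: ifP => // _; exact: cm_norm_ge0.
  exact: cm_dist_sqr_le.
have mcost : measurable_fun setT (fun z : borel F * borel F => gs_cost gamma l z.1 z.2).
  apply: ge0_emeasurable_sum.
    by move=> k z _ _; rewrite mule_ge0// lee_fin sqr_ge0.
  move=> k _; apply: emeasurable_funM => //.
  apply/measurable_EFinP/measurable_funX/measurable_funB.
    exact: (measurableT_comp (mX k) (@measurable_fst _ _ _ _)).
  exact: (measurableT_comp (mX k) (@measurable_snd _ _ _ _)).
have cost0 x z : (0 <= gs_cost gamma l x z)%E.
  by apply: nneseries_ge0 => k _ _; rewrite mule_ge0// lee_fin sqr_ge0.
rewrite ge0_integral_image_prob//.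
apply: le_trans cost; rewrite le_eqVlt; apply/orP; left; apply/eqP.
apply: ae_eq_integral => //.
- exact: (measurableT_comp mcost mxy).
- apply: ge0_emeasurable_sum => [k x _ _|k _]; first by rewrite lee_fin sqr_ge0.
  by apply/measurable_EFinP/measurable_funX/measurable_funB.
(* Outside one [nu]-null set all degenerate coordinates agree, so their infinite weights multiply
   0. *)
have aeX : {ae nu, forall x, forall n, ~~ v n -> X n x = S n x}.
  apply: ae_foralln => n; have [vn|vn] := boolP (v n); first exact: aeW.
  by apply: filterS (X0nu n vn) => x ->.
apply: filterS2 ySs aeX => x yx Xx _ /=.
apply: eq_eseriesr => k _.
have -> : gs_coord gamma l k (y x) = S k x.
  by have := congr1 (fun q : seqR R => q k) yx.
rewrite /gs_weight; case: ifPn => vk; first by rewrite mul1e.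
have -> : gs_coord gamma l k x = S k x by exact: Xx.
by rewrite (Xx k vk) subrr expr0n/= mule0.
Qed.

Local Open Scope ereal_scope.

Theorem theorem1p2 (R : realType) (F : tvsType R)
    (gamma : probability (borel F) R)
    (hgamma : gaussian_frechet_space gamma)
    (nu : probability (borel F) R) :
  cm_transport_cost nu gamma <= 2%:E * relative_entropy nu gamma.
Proof.
have [->|[f [numu df ilnf ->]]] := relative_entropy_density nu gamma.
  by rewrite gt0_muley ?lte_fin// leey.
exact: cm_transport_cost_density.
Qed.
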